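(* Let $V_\lambda$ be a finite-dimensional irreducible $\mathfrak{o}_{2n}$-module with highest weight $\lambda$. Consider the parameters $\alpha_{kj}=\alpha_{kj}^{\underline\lambda}\in\mathbb{C}$ ($\underline\lambda$ a chain of weights starting from $\lambda$, $2\le k\le n$, $1\le j\le k-1$), with $\alpha_{kj}-\beta_{kj}$ kept equal to the fixed nonnegative integers occurring in $V_\lambda$ and with the $\alpha_{k0}$ kept fixed. There is a path $\alpha(t)$, $t\in[0,\infty)$, in the space of these parameters such that: (1) $\alpha(0)$ is the collection of $\alpha_{kj}$ which occurs in the $\mathfrak{o}_{2n}$-module $V_\lambda$; (2) the spectrum of $\bigotimes_{k=1}^n\mathcal{B}^+$ on $\bigoplus_{\underline\lambda}\bigotimes_{k=1}^n\Big(\big(\bigotimes_{j=1}^{k-1}L(\alpha_{kj}(t),\beta_{kj}(t))\big)\otimes W(-\alpha_{k0})\Big)$ is simple for all $t>0$; (3) the limit of the corresponding eigenbasis as $t\to+\infty$ is the product of the $\mathfrak{sl}_2$-weight bases of the factors $L(\alpha_{kj},\beta_{kj})=V_{\alpha_{kj}-\beta_{kj}}$.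
   Context: Everything is over $\mathbb{C}$. **Lie algebras and weights.** $\mathfrak{o}_{2n}$ is spanned by $F_{ij}=E_{ij}-E_{-j,-i}$, $i,j\in\{-n,\dots,-1,1,\dots,n\}$; $\mathfrak{o}_{2k}\subset\mathfrak{o}_{2n}$ is spanned by $F_{ij}$ with $|i|,|j|\le k$. Highest weights $\lambda=(\lambda_1,\dots,\lambda_n)$ (eigenvalues of $F_{11},\dots,F_{nn}$ on a vector killed by all $F_{ij}$, $i<j$) of finite-dimensional irreducible $\mathfrak{o}_{2n}$-modules are the tuples with all $\lambda_i\in\mathbb{Z}$ or all $\lambda_i\in\mathbb{Z}+\frac12$ and $-|\lambda_1|\ge\lambda_2\ge\dots\ge\lambda_n$. **Chains.** A chain is $\underline\lambda=(\lambda^{(n)}=\lambda,\lambda^{(n-1)},\dots,\lambda^{(1)})$, with $\lambda^{(k)}=(\lambda_{k1},\dots,\lambda_{kk})$ a highest weight of a finite-dimensional irreducible $\mathfrak{o}_{2k}$-module, such that all multiplicity spaces $V^{\lambda^{(k-1)}}_{\lambda^{(k)}}=\mathrm{Hom}_{\mathfrak{o}_{2k-2}}(V_{\lambda^{(k-1)}},V_{\lambda^{(k)}})$ are nonzero. As a vector space $V_\lambda\simeq\bigoplus_{\underline\lambda}\bigotimes_{k=1}^nV^{\lambda^{(k-1)}}_{\lambda^{(k)}}$ (for $k=1$ the factor is $V_{\lambda^{(1)}}$). **Twisted Yangian.** $Y^+(2)$ is generated by the coefficients of $s_{ij}(u)=\sum_{r\ge0}s_{ij}^{(r)}u^{-r}$,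 $s^{(0)}_{ij}=\delta_{ij}$, $i,j\in\{-1,1\}$, with relations $$[s_{ij}(u),s_{kl}(v)]=\tfrac{1}{u-v}\big(s_{kj}(u)s_{il}(v)-s_{kj}(v)s_{il}(u)\big)-\tfrac1{u+v}\big(s_{i,-k}(u)s_{-j,l}(v)-s_{k,-i}(v)s_{-l,j}(u)\big)+\tfrac1{u^2-v^2}\big(s_{k,-i}(u)s_{-j,l}(v)-s_{k,-i}(v)s_{-j,l}(u)\big),$$ $$s_{-j,-i}(-u)=s_{ij}(u)+\frac{s_{ij}(u)-s_{ij}(-u)}{2u}.$$ The Bethe subalgebra $\mathcal{B}^+$ is the commutative subalgebra generated by $s_{11}^{(2m+1)}$, $m\ge0$, and the center of $Y^+(2)$. **Modules.** For $\alpha,\beta\in\mathbb{C}$ with $\alpha-\beta\in\mathbb{Z}_{\ge0}$, $L(\alpha,\beta)$ is the irreducible $\mathfrak{gl}_2$-module of highest weight $(\alpha,\beta)$ (rows and columns indexed by $-1,1$); as an $\mathfrak{sl}_2$-module it is $V_{\alpha-\beta}$, of dimension $\alpha-\beta+1$, which is used to identify $L(\alpha,\beta)$ for different $(\alpha,\beta)$ with equal difference with one fixed vector space. It is a module over the Yangian $Y(2)=Y(\mathfrak{gl}_2)$ via $t_{ij}(u)\mapsto\delta_{ij}+E_{ij}u^{-1}$, and tensor products are $Y(2)$-modules via $\Delta(t_{ij}(u))=\sum_at_{ia}(u)\otimes t_{aj}(u)$. $W(\delta)$ is the one-dimensional $Y^+(2)$-module with $s_{11}(u)\mapsto\frac{u+\delta}{u+1/2}$,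 $s_{-1,-1}(u)\mapsto\frac{u-\delta+1}{u+1/2}$, $s_{1,-1}(u),s_{-1,1}(u)\mapsto0$. If $L$ is a $Y(2)$-module, $Y^+(2)$ acts on $L\otimes W(\delta)$ by $s_{ij}(u)\mapsto\sum_{a,b}t_{ia}(u)t_{-j,-b}(-u)\otimes s_{ab}(u)$. **Parameters occurring in $V_\lambda$.** For a chain $\underline\lambda$ and $k\ge2$, the space $V^{\lambda^{(k-1)}}_{\lambda^{(k)}}$ is, via the Olshanski centralizer construction, the irreducible $Y^+(2)$-module $L(\alpha_{k1},\beta_{k1})\otimes\dots\otimes L(\alpha_{k,k-1},\beta_{k,k-1})\otimes W(-\alpha_{k0})$ with $$\alpha_{k1}=\min\{-|\lambda_{k1}|,-|\lambda_{k-1,1}|\}-\tfrac12,\quad \alpha_{k0}=\alpha_{k1}+|\lambda_{k1}+\lambda_{k-1,1}|,$$ $$\alpha_{kj}=\min\{\lambda_{kj},\lambda_{k-1,j}\}-j+\tfrac12\ (2\le j\le k-1),\quad \beta_{kj}=\max\{\lambda_{k,j+1},\lambda_{k-1,j+1}\}-j+\tfrac12\ (1\le j\le k-1),$$ where for $j=k-1$ the maximum is understood as $\lambda_{kk}$. For $k=1$ the factor is the one-dimensional module $W(-\alpha_{10})$ with $\alpha_{10}=-\lambda_{11}-\frac12$. These are the $\alpha_{kj},\beta_{kj}$ that ''occur in $V_\lambda$''. **Conventions.** In $\bigotimes_k\mathcal{B}^+$ the $k$-th copy of $\mathcal{B}^+$ acts on the $k$-th tensor factor of each summand. A commutative algebra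 acts with simple spectrum if it acts diagonalizably with one-dimensional joint eigenspaces; the eigenbasis is then the set of joint eigenlines. Paths are continuous; limits of eigenbases are limits of eigenlines in projective space. *)

(* Defs.v *)
From HB Require Import structures.
From mathcomp Require Import all_boot all_order all_algebra.
From mathcomp Require Import finmap complex zify.
From mathcomp Require Import all_classical all_reals all_analysis.

Set Implicit Arguments.
Unset Strict Implicit.
Unset Printing Implicit Defensive.

Import Order.TTheory GRing.Theory Num.Theory numFieldNormedType.Exports.
Import passmx.

Local Open Scope classical_set_scope.
Local Open Scope ring_scope.
Local Open Scope complex_scope.

(* R[i], typed as an abstract number field so that MathComp-Analysis finds the
   topology defined by the modulus. *)
Definition Cx (R : realType) : numClosedFieldType := R[i].

(* The index set {-n, ..., -1, 1, ..., n}, in increasing order, is encoded by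
   'I_(n + n): negation is [rev_ord], and j in {1, ..., n} sits at position
   n + j - 1, i.e. at [rshift n j'] with j' : 'I_n of value j - 1. *)
Definition Fmx (R : realType) (n : nat) (i j : 'I_(n + n)) : 'M[Cx R]_(n + n) :=
  delta_mx i j - delta_mx (rev_ord j) (rev_ord i).

Definition o_alg (R : realType) (n : nat) : {vspace 'M[Cx R]_(n + n)} :=
  <<[seq Fmx R p.1 p.2 | p : 'I_(n + n) * 'I_(n + n)]>>%VS.

(* Only the values of [o_act] on [o_alg R n] matter. *)
Record o_module (R : realType) (n : nat) := OModule {
  o_space : vectType (Cx R);
  o_act : {linear 'M[Cx R]_(n + n) -> 'End(o_space)};
  o_actP : {in o_alg R n &, forall A B : 'M[Cx R]_(n + n),
    o_act (A *m B - B *m A) =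
      (o_act A \o o_act B)%VF - (o_act B \o o_act A)%VF} }.

Definition o_irreducible (R : realType) (n : nat) (M : o_module R n) : Prop :=
  (exists v : o_space M, v != 0) /\
  forall U : {vspace o_space M},
    (forall A v, A \in o_alg R n -> v \in U -> o_act M A v \in U) ->
    U = 0%VS \/ U = fullv.

(* A weight (lambda_1, ..., lambda_n) is the sequence of its entries, so that
   lambda_j is [lam`_j.-1]. *)
Definition highest_weight (R : realType) (n : nat) (M : o_module R n)
    (lam : seq R) : Prop :=
  exists v : o_space M,
    [/\ v != 0,
        (forall i j : 'I_(n + n), (i < j)%N -> o_act M (Fmx R i j) v = 0) &
        (forall j : 'I_n,
           o_act M (Fmx R (rshift n j) (rshift n j)) v = (lam`_j)%:C *: v)].

Definition dominant (R : realType) (n : nat) (lam : seq R) : Prop :=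
  [/\ size lam = n,
      (forall j, (j < n)%N -> lam`_j \is a Num.int) \/
      (forall j, (j < n)%N -> lam`_j - 2^-1 \is a Num.int),
      ((1 < n)%N -> lam`_1 <= - `|lam`_0|) &
      (forall j, (0 < j)%N -> (j.+1 < n)%N -> lam`_j.+1 <= lam`_j)].

(* The integrality in [dominant] is automatic for n >= 2, but not for the
   abelian Lie algebra o_2. *)
Definition irrep_of_weight (R : realType) (n : nat) (M : o_module R n)
    (lam : seq R) : Prop :=
  [/\ dominant n lam, o_irreducible M & highest_weight M lam].

(* The inclusion {-k, ..., k} \subset {-k-1, ..., k+1} of index sets. *)
Definition up_index (k : nat) (i : 'I_(k + k)) : 'I_(k.+1 + k.+1) :=
  (inord i.+1 : 'I_(k + k.+1).+1).

Definition o_hom_nonzero (R : realType) (k : nat)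
    (M : o_module R k) (M' : o_module R k.+1) : Prop :=
  exists f : 'Hom(o_space M, o_space M'),
    f != 0 /\
    forall i j : 'I_(k + k),
      (f \o o_act M (Fmx R i j))%VF =
      (o_act M' (Fmx R (up_index i) (up_index j)) \o f)%VF.

(* A chain lists its weights by increasing rank: lambda^(k) is at position
   k - 1. *)
Definition level (R : realType) (c : seq (seq R)) (k : nat) : seq R :=
  nth [::] c k.-1.

Definition entry (R : realType) (c : seq (seq R)) (k j : nat) : R :=
  (level c k)`_j.-1.

(* [M k] is the module V_(lambda^(k)), which is unique up to isomorphism. *)
Definition is_chain (R : realType) (n : nat) (V : o_module R n) (lam : seq R)
    (c : seq (seq R)) : Prop :=
  [/\ size c = n, level c n = lam &
      exists M : forall k, o_module R k,
        [/\ M n = V,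
            (forall k, (0 < k <= n)%N -> irrep_of_weight (M k) (level c k)) &
            (forall k, (0 < k < n)%N -> o_hom_nonzero (M k) (M k.+1))]].

Lemma eigenvalues_finite (R : realType) (W : vectType (Cx R)) (f : 'End(W)) :
  exists s : seq (Cx R), forall (a : Cx R) (v : W), v != 0 -> f v = a *: v -> a \in s.
Proof.
pose e := vbasis (@fullv _ W).
have eb : basis_of fullv e by exact: vbasisP.
pose A := mxof e e f; pose P := char_poly A.
have [r Pr] := closed_field_poly_normal P.
exists r => a v v0 fv.
have : eigenvalue A a.
  apply/eigenvalueP; exists (rVof e v).
    by rewrite -rVof_app // fv linearZ.
  by rewrite rVof_eq0.
rewrite eigenvalue_root_char -/P Pr rootZ ?root_prod_XsubC //.
by rewrite lead_coef_eq0 monic_neq0 // char_poly_monic.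
Qed.

Lemma seqs_finite (T : eqType) (s : seq T) (n : nat) :
  exists L : seq (seq T), forall x, (size x <= n)%N -> {subset x <= s} -> x \in L.
Proof.
elim: n => [|n [L HL]].
  by exists [:: [::]] => -[|y x].
exists ([::] :: [seq y :: x | y <- s, x <- L]) => -[|y x] //= xn xs.
rewrite in_cons; apply/orP; right; apply/allpairsP; exists (y, x) => /=.
split=> //; first by apply: xs; rewrite mem_head.
by apply: HL => // z zx; apply: xs; rewrite in_cons zx orbT.
Qed.

Lemma chain_embed (R : realType) (n : nat) (M : forall k, o_module R k) :
  (forall k, (0 < k <= n)%N -> o_irreducible (M k)) ->
  (forall k, (0 < k < n)%N -> o_hom_nonzero (M k) (M k.+1)) ->
  forall e k, (0 < k)%N -> (k + e = n)%N ->
  exists2 g : 'Hom(o_space (M k), o_space (M n)), lker g = 0%VS &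
    forall i : 'I_(k + k), exists p : 'I_(n + n),
      forall v, g (o_act (M k) (Fmx R i i) v) = o_act (M n) (Fmx R p p) (g v).
Proof.
move=> irr hom; elim=> [|e IH] k k0.
  rewrite addn0 => <-; exists \1%VF.
    by apply/eqP/lker0P => x y; rewrite !id_lfunE.
  by move=> i; exists i => v; rewrite !id_lfunE.
rewrite addnS -addSn => kn.
have [g g0 gP] := IH k.+1 isT kn.
have [f [f0 fP]] := hom k ltac:(lia).
have [_ irrk] := irr k ltac:(lia).
have kst A v : A \in o_alg R k -> v \in lker f -> o_act (M k) A v \in lker f.
  pose X := [seq Fmx R p.1 p.2 | p : 'I_(k + k) * 'I_(k + k)].
  move=> /(coord_span (X := in_tuple X)) -> vk.
  rewrite linear_sum sum_lfunE memv_suml //= => i _.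
  rewrite linearZ /= scale_lfunE memvZ //.
  have : X`_i \in X by rewrite mem_nth.
  case/mapP=> -[a b] _ -> /=; rewrite memv_ker -comp_lfunE fP comp_lfunE.
  by move: vk; rewrite memv_ker => /eqP ->; rewrite linear0.
have ker0 : lker f = 0%VS.
  case: (irrk _ kst) => // kerT; case/negP: f0; apply/eqP/lfunP => v.
  by rewrite zero_lfunE; apply/eqP; rewrite -memv_ker kerT memvf.
exists (g \o f)%VF.
  apply/eqP/lker0P => x y; rewrite !comp_lfunE => h.
  by apply: (lker0P (introT eqP ker0)); apply: (lker0P (introT eqP g0)).
move=> i; have [p pP] := gP (up_index i); exists p => v.
have fv := congr1 (fun h : 'Hom(_, _) => h v) (fP i i).
by rewrite /= !comp_lfunE in fv; rewrite !comp_lfunE fv pP.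
Qed.

(* [chains] below is thus the actual set of chains, and not the default value
   of [fset_set] on infinite sets. *)
Lemma finite_is_chain (R : realType) (n : nat) (V : o_module R n) (lam : seq R) :
  finite_set [set c | is_chain V lam c].
Proof.
have ev (p : 'I_(n + n)) := eigenvalues_finite (o_act V (Fmx R p p)).
have [S SP] := choice ev.
pose E := [seq complex.Re a | a <- flatten [seq S p | p : 'I_(n + n)]].
have [L LP] := seqs_finite E n; have [LL LLP] := seqs_finite L n.
apply: (sub_finite_set _ (finite_seq LL)) => c /= [sc _ [M [MV Mirr Mhom]]].
apply: LLP; first by rewrite sc.
move=> x xc; have := xc; rewrite -index_mem sc; set k := index x c => kn.
have xE : x = level c k.+1 by rewrite /level /= nth_index.
have [[sx _ _ _] _ [v [v0 _ hv]]] := Mirr k.+1 kn.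
apply: LP; first by rewrite xE sx.
move=> a ax; have : (index a x < k.+1)%N by rewrite -sx -xE index_mem.
move=> jk; have aE : a = x`_(index a x) by rewrite nth_index.
have [g g0 gP] : exists2 g : 'Hom(o_space (M k.+1), o_space (M n)), lker g = 0%VS &
    forall i : 'I_(k.+1 + k.+1), exists p : 'I_(n + n),
      forall v, g (o_act (M k.+1) (Fmx R i i) v) = o_act (M n) (Fmx R p p) (g v).
  by apply: (@chain_embed _ _ _ _ Mhom (n - k.+1)) => //; [
    move=> l /Mirr[] | rewrite subnKC].
have [p pP] := gP (rshift k.+1 (Ordinal jk)).
rewrite MV in g g0 gP pP.
have -> : a = complex.Re (a%:C) by [].
apply: map_f; apply/flattenP; exists (S p); first by rewrite map_f // mem_enum.
apply: (SP p _ (g v)).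
  by apply: contra v0; rewrite -memv_ker g0 memv0.
by rewrite -pP hv /= -xE -aE linearZ.
Qed.

Definition alpha_occ (R : realType) (c : seq (seq R)) (k j : nat) : R :=
  let alpha1 :=
    Num.min (- `|entry c k 1|) (- `|entry c k.-1 1|) - 2^-1 in
  match j with
  | 0 => if k == 1%N then - entry c 1 1 - 2^-1
         else alpha1 + `|entry c k 1 + entry c k.-1 1|
  | 1 => alpha1
  | _ => Num.min (entry c k j) (entry c k.-1 j) - j%:R + 2^-1
  end.

Definition beta_occ (R : realType) (c : seq (seq R)) (k j : nat) : R :=
  (if j == k.-1 then entry c k k
   else Num.max (entry c k j.+1) (entry c k.-1 j.+1)) - j%:R + 2^-1.

(* The number alpha - beta as an element of [nat]: by the branching rule it is
   a nonnegative integer for every chain. *)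
Definition gap_occ (R : realType) (c : seq (seq R)) (k j : nat) : nat :=
  Num.truncn (alpha_occ c k j - beta_occ c k j).

(* A vector is the column of its coordinates; [op_of K] sends the basis vector
   e_q to the sum of the K p q e_p. *)
Notation op R I := 'M[Cx R]_#|{: I}|.
Notation vec R I := 'cV[Cx R]_#|{: I}|.

Definition op_of (R : realType) (I : finType) (K : I -> I -> Cx R) :
    op R I :=
  \matrix_(p, q) K (enum_val p) (enum_val q).

Definition coef (R : realType) (I : finType) (X : op R I) (p q : I) :
    Cx R :=
  X (enum_rank p) (enum_rank q).

Definition basis_vec (R : realType) (I : finType) (p : I) : vec R I :=
  delta_mx (enum_rank p) 0.

(* The product basis of the tensor product over j of the spaces with bases
   [I_ j] is indexed by the choice functions f; [at_factor X] is X acting on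
   the factor j, tensored with the identity on the other factors. *)
Definition at_factor (R : realType) (J : finType) (I_ : J -> finType) (j : J)
    (X : op R (I_ j)) : op R {dffun forall l, I_ l} :=
  op_of (fun f g : {dffun forall l, I_ l} =>
    if [forall l, (l != j) ==> (f l == g l)] then coef X (f j) (g j) else 0).

Definition direct_sum (R : realType) (J : finType) (I_ : J -> finType)
    (X : forall j, op R (I_ j)) : op R {j : J & I_ j} :=
  op_of (fun x y : {j : J & I_ j} =>
    if tag x == tag y then coef (X (tag x)) (tagged x) (tagged_as x y) else 0).

(* The index set {-1, 1}: [true] is 1, [false] is -1, negation is [~~]. *)

(* Y^+(2) is the set of expressions in the generators s_ij^(r), modulo [Yeq]. *)
Inductive yexpr (R : realType) : Type :=
| YGen of bool & bool & nat
| YCst of Cx R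
| YAdd of yexpr R & yexpr R
| YMul of yexpr R & yexpr R.

Declare Scope yexpr_scope.
Delimit Scope yexpr_scope with Y.
Bind Scope yexpr_scope with yexpr.
Notation "x + y" := (YAdd x y) : yexpr_scope.
Notation "x * y" := (YMul x y) : yexpr_scope.
Notation "x - y" := (YAdd x (YMul (YCst (-1)) y)) : yexpr_scope.

Definition sgen (R : realType) (i j : bool) (p : int) : yexpr R :=
  if p is Posz r then YGen R i j r else YCst 0.

Section TwistedYangianRelations.
Context (R : realType) (i j k l : bool).
Local Notation s := (sgen R).

(* The coefficients of u^(-p) v^(-q), for integers p and q, of the expressions
   [s_ij(u), s_kl(v)],
   s_kj(u) s_il(v) - s_kj(v) s_il(u),
   s_{i,-k}(u) s_{-j,l}(v) - s_{k,-i}(v) s_{-l,j}(u),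
   s_{k,-i}(u) s_{-j,l}(v) - s_{k,-i}(v) s_{-j,l}(u). *)
Definition Ycomm (p q : int) : yexpr R :=
  (s i j p * s k l q - s k l q * s i j p)%Y.
Definition Yterm1 (p q : int) : yexpr R :=
  (s k j p * s i l q - s k j q * s i l p)%Y.
Definition Yterm2 (p q : int) : yexpr R :=
  (s i (~~ k) p * s (~~ j) l q - s k (~~ i) q * s (~~ l) j p)%Y.
Definition Yterm3 (p q : int) : yexpr R :=
  (s k (~~ i) p * s (~~ j) l q - s k (~~ i) q * s (~~ j) l p)%Y.

(* The quaternary relation multiplied by u^2 - v^2. *)
Definition Yquat_lhs (p q : int) : yexpr R :=
  (Ycomm (p + 2) q - Ycomm p (q + 2))%Y.
Definition Yquat_rhs (p q : int) : yexpr R :=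
  ((Yterm1 (p + 1) q + Yterm1 p (q + 1))
   - (Yterm2 (p + 1) q - Yterm2 p (q + 1))
   + Yterm3 p q)%Y.

(* The symmetry relation multiplied by 2u, at u^(-r+1). *)
Definition Ysym_lhs (r : nat) : yexpr R :=
  (YCst (2 * (-1) ^+ r) * s (~~ j) (~~ i) r)%Y.
Definition Ysym_rhs (r : nat) : yexpr R :=
  (YCst 2 * s i j r + YCst (1 + (-1) ^+ r) * s i j (r%:Z - 1))%Y.

End TwistedYangianRelations.

(* Equality in Y^+(2): the least congruence for which the expressions form an
   associative unital algebra over the complex numbers in which the defining
   relations hold. *)
Inductive Yeq (R : realType) : yexpr R -> yexpr R -> Prop :=
| Yeq_refl x : Yeq x x
| Yeq_sym x y : Yeq x y -> Yeq y x
| Yeq_trans x y z : Yeq x y -> Yeq y z -> Yeq x z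
| Yeq_add x x' y y' : Yeq x x' -> Yeq y y' -> Yeq (x + y) (x' + y')
| Yeq_mul x x' y y' : Yeq x x' -> Yeq y y' -> Yeq (x * y) (x' * y')
| Yeq_addA x y z : Yeq (x + (y + z)) (x + y + z)
| Yeq_addC x y : Yeq (x + y) (y + x)
| Yeq_add0 x : Yeq (YCst 0 + x) x
| Yeq_mulA x y z : Yeq (x * (y * z)) (x * y * z)
| Yeq_mulDl x y z : Yeq ((x + y) * z) (x * z + y * z)
| Yeq_mulDr x y z : Yeq (x * (y + z)) (x * y + x * z)
| Yeq_mul1 x : Yeq (YCst 1 * x) x
| Yeq_mul0 x : Yeq (YCst 0 * x) (YCst 0)
| Yeq_cstD a b : Yeq (YCst (a + b)) (YCst a + YCst b)
| Yeq_cstM a b : Yeq (YCst (a * b)) (YCst a * YCst b)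
| Yeq_cstC a x : Yeq (YCst a * x) (x * YCst a)
| Yeq_gen0 i j : Yeq (YGen R i j 0) (YCst (i == j)%:R)
| Yeq_quat i j k l p q :
    Yeq (Yquat_lhs R i j k l p q) (Yquat_rhs R i j k l p q)
| Yeq_symm i j r : Yeq (Ysym_lhs R i j r) (Ysym_rhs R i j r).

Definition Ycentral (R : realType) (z : yexpr R) : Prop :=
  forall x, Yeq (z * x) (x * z).

Inductive Bethe (R : realType) : yexpr R -> Prop :=
| Bethe_gen m : Bethe (YGen R true true (m.*2.+1))
| Bethe_center z : Ycentral z -> Bethe z
| Bethe_cst a : Bethe (YCst a)
| Bethe_add x y : Bethe x -> Bethe y -> Bethe (x + y)
| Bethe_mul x y : Bethe x -> Bethe y -> Bethe (x * y)
| Bethe_eq x y : Yeq x y -> Bethe x -> Bethe y.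

(* The action on a module where s_ij^(r) acts by [s i j r]. *)
Fixpoint Yact (R : realType) (d : nat) (s : bool -> bool -> nat -> 'M[Cx R]_d)
    (e : yexpr R) : 'M[Cx R]_d :=
  match e with
  | YGen i j r => s i j r
  | YCst a => a%:M
  | YAdd x y => Yact s x + Yact s y
  | YMul x y => Yact s x *m Yact s y
  end.

(* The operator E_ab on L(alpha, alpha - m), in the basis
   e_q = E_{1,-1}^q e_0 (0 <= q <= m) of sl_2-weight vectors, where e_0 is the
   highest weight vector: E_{-1,-1} e_0 = alpha e_0, E_{1,1} e_0 =
   (alpha - m) e_0 and E_{-1,1} e_0 = 0. *)
Definition gl2_op (R : realType) (m : nat) (alpha : Cx R) (a b : bool) :
    op R 'I_m.+1 :=
  op_of (fun p q : 'I_m.+1 =>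
    match a, b with
    | false, false => if p == q then alpha - q%:R else 0
    | true, true => if p == q then alpha - m%:R + q%:R else 0
    | true, false => if p == q.+1 :> nat then 1 else 0
    | false, true => if q == p.+1 :> nat then (q * (m.+1 - q))%:R else 0
    end).

(* A formal power series in u^-1 is the sequence of its coefficients. *)
Definition smul (R : realType) (d : nat) (f g : nat -> 'M[Cx R]_d) (r : nat) :
    'M[Cx R]_d :=
  \sum_(i < r.+1) f i *m g (r - i)%N.

Section EvaluationModule.
Context (R : realType) (N : nat) (m : 'I_N -> nat) (alpha : 'I_N -> Cx R)
  (delta : Cx R).

Definition tensor_basis : finType := {dffun forall j : 'I_N, 'I_(m j).+1}.

(* t_ab(u) = delta_ab + E_ab u^-1 acting on the factor j *)
Definition t_factor (j : 'I_N) (a b : bool) (r : nat) :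
    op R tensor_basis :=
  match r with
  | 0 => ((a == b)%:R)%:M
  | 1 => at_factor (I_ := fun j : 'I_N => 'I_(m j).+1 : finType)
           (gl2_op (m j) (alpha j) a b)
  | _ => 0
  end.

(* The iterated coproduct: t_ab(u) on the tensor product of the factors in js;
   the empty product is the trivial module. *)
Fixpoint t_tensor (js : seq 'I_N) (a b : bool) (r : nat) :
    op R tensor_basis :=
  match js with
  | [::] => if r == 0%N then ((a == b)%:R)%:M else 0
  | j :: js' =>
      \sum_(c : bool) smul (t_factor j a c) (fun r' => t_tensor js' c b r') r
  end.

Definition t_op (a b : bool) (r : nat) := t_tensor (enum 'I_N) a b r.

(* t_ab(-u) *)
Definition t_op_neg (a b : bool) (r : nat) : op R tensor_basis :=
  (-1) ^+ r *: t_op a b r.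

(* (u + c) / (u + 1/2) = (1 + c u^-1) * \sum_r (-1/2)^r u^-r *)
Definition W_series (c : Cx R) (r : nat) : Cx R :=
  (- 2^-1) ^+ r + (if r is r'.+1 then c * (- 2^-1) ^+ r' else 0).

Definition W_op (a b : bool) (r : nat) : Cx R :=
  match a, b with
  | true, true => W_series delta r
  | false, false => W_series (1 - delta) r
  | _, _ => 0
  end.

Definition s_op (i j : bool) (r : nat) : op R tensor_basis :=
  \sum_(a : bool) \sum_(b : bool)
    smul (smul (t_op i a) (t_op_neg (~~ j) (~~ b)))
         (fun r' => (W_op a b r')%:M) r.

End EvaluationModule.

Definition joint_eigenvector (R : realType) (d : nat)
    (A : 'M[Cx R]_d -> Prop) (v : 'cV[Cx R]_d) : Prop :=
  v != 0 /\ forall X, A X -> exists x : Cx R, X *m v = x *: v.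

(* The joint eigenspaces are indexed by the functions chi : A -> Cx R; the
   columns of P form a basis of joint eigenvectors. *)
Definition simple_spectrum (R : realType) (d : nat) (A : 'M[Cx R]_d -> Prop) :
    Prop :=
  (exists P : 'M[Cx R]_d,
     P \in unitmx /\ forall q : 'I_d, joint_eigenvector A (col q P)) /\
  (forall (chi : 'M[Cx R]_d -> Cx R) (v w : 'cV[Cx R]_d),
     v != 0 ->
     (forall X, A X -> X *m v = chi X *: v) ->
     (forall X, A X -> X *m w = chi X *: w) ->
     exists a : Cx R, w = a *: v).

(* b |-> [v b] is a bijection from I onto the set of joint eigenlines. *)
Definition eigenlines (R : realType) (d : nat) (I : Type)
    (A : 'M[Cx R]_d -> Prop) (v : I -> 'cV[Cx R]_d) : Prop :=
  (forall b, joint_eigenvector A (v b)) /\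
  (forall w, joint_eigenvector A w ->
     exists! b, exists a : Cx R, w = a *: v b).

(* Convergence of [v t] to [w] as t -> +oo in the projective space, with the
   quotient topology: its open sets are the open cones U. *)
Definition proj_cvg (R : realType) (d : nat) (v : R -> 'cV[Cx R]_d)
    (w : 'cV[Cx R]_d) : Prop :=
  forall U : set 'cV[Cx R]_d,
    open U ->
    (forall (a : Cx R) x, a != 0 -> U x -> U (a *: x)) ->
    U w -> \forall t \near +oo, U (v t).

Section DirectSum.
Context (R : realType) (n : nat) (V : o_module R n) (lam : seq R).

Definition chains : {fset seq (seq R)} := fset_set [set c | is_chain V lam c].

(* alpha_kj for each chain; k : 'I_n and j : 'I_k stand for the numbers k + 1
   and j + 1, which range over 1 <= j + 1 <= (k + 1) - 1. *)
Definition params := forall (c : chains) (k : 'I_n), 'I_k -> Cx R.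

Definition gaps (c : chains) (k : 'I_n) (j : 'I_k) : nat :=
  gap_occ (val c) k.+1 j.+1.

Definition level_basis (c : chains) (k : 'I_n) : finType :=
  tensor_basis (@gaps c k).
Definition chain_basis (c : chains) : finType :=
  {dffun forall k : 'I_n, level_basis c k}.
Definition sum_basis : finType := {c : chains & chain_basis c}.

Definition level_act (alpha : params) (c : chains) (k : 'I_n) :
    yexpr R -> op R (level_basis c k) :=
  Yact (s_op (@gaps c k) (alpha c k)
             (- (alpha_occ (val c) k.+1 0)%:C)).

(* The action of b_1 \otimes ... \otimes b_n. *)
Definition pure_act (alpha : params) (b : 'I_n -> yexpr R) :
    op R sum_basis :=
  direct_sum (fun c : chains =>
    \big[mulmx/1%:M]_(k < n)
      at_factor (I_ := level_basis c) (level_act alpha c k (b k))).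

(* The image of the tensor product over k of the Bethe subalgebras. *)
Definition Bethe_tensor (alpha : params) (X : op R sum_basis) : Prop :=
  exists (N : nat) (b : 'I_N -> 'I_n -> yexpr R),
    (forall i k, Bethe (b i k)) /\ X = \sum_(i < N) pure_act alpha (b i).

End DirectSum.

(* Main.v *)
Require Import Defs.
From HB Require Import structures.
From mathcomp Require Import all_boot all_order all_algebra.
From mathcomp Require Import finmap complex.
From mathcomp Require Import all_classical all_reals all_analysis.
From mathcomp Require Import generic_quotient separable ring zify.

(** On a chain c let the parameters run along the complex line
    alpha_kj = alpha_kj(0) + z d_ckj, with real slopes d_ckj. After rescaling
    u = z w, the operators s_11^(2m+1) on the k-th factor become polynomial in
    1/z, and to first order in 1/z they are diagonal in the product of the
    sl_2-weight bases: their generating function is, up to scalars,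
      (delta - 1/2) prod_j (1 - d_j^2/w^2) + sum_j h_j prod_(l <> j) (1 - d_l^2/w^2),
    where h_j is the weight of the j-th factor. If the d_j^2 are distinct, this
    determines all the h_j. The odd coefficients may vanish identically on
    different chains, so these are told apart by the quadratic central element
    2 s_11^(2) + s_11^(1) - (s_11^(1))^2, which is asymptotic to
    - 2 z^2 sum_j d_cnj^2 on the top factor. A generic linear combination
    X(1/z) of these elements is thus polynomial in 1/z, and diagonal with
    distinct entries at 1/z = 0. Its discriminant is a nonzero polynomial in
    1/z, so a generic ray z = w t avoids its zeros, X has simple spectrum for
    all t > 0, and its eigenlines converge to the coordinate lines. The whole
    Bethe algebra commutes with X, hence has the same eigenlines; for the
    central elements this uses that the defining relations of Y^+(2) hold on
    the modules. *)

Set Implicit Arguments.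
Unset Strict Implicit.
Unset Printing Implicit Defensive.

Import Order.TTheory GRing.Theory Num.Theory.

Local Open Scope ring_scope.

(** * The RTT and reflection equations *)

(** The centre of Y^+(2) enters the Bethe subalgebra through its abstract definition: expressions
    that commute with all others modulo [Yeq]. The action of an arbitrary central element is
    controlled only by the fact that equal expressions act equally, so the quaternary and symmetry
    relations must be verified on the modules. Sklyanin's dressing does this: the one-dimensional
    W(delta) solves the reflection equation, and multiplying it by T(u) and the transpose of T(-u)
    preserves solutions.

    The limit e = 1/z -> 0 is degenerate. To zeroth order e^r s_11^(r) is one scalar on a whole
    tensor product, so it separates nothing inside it. But this scalar series is even, hence absent
    from the odd coefficients, and these can be divided by one more power of e; what remains sees
    the weights. The scalar itself, through its second coefficient, is what the central element
    detects.

    A discriminant that is nonzero at e = 0 may still vanish at finitely many real positive e. This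
    is why the direction w of the ray is complex: each zero excludes a single slope. The start t = 0
    corresponds to e = infinity, where no simplicity is claimed. *)

Section Reflection.
Context (K : comNzRingType) (d : nat).
Local Notation B := 'M[K]_d.

Lemma scale_mulAr (a : K) (x y : B) : x * (a *: y) = a *: (x * y).
Proof. exact/esym/scalemxAr. Qed.

Lemma scale_mulAl (a : K) (x y : B) : a *: x * y = a *: (x * y).
Proof. exact/esym/scalemxAl. Qed.

(* Matrices on C^2 (x) C^2 with entries in B: [f i k j l] is the entry in row
   (i, k) and column (j, l). *)
Definition tens := bool -> bool -> bool -> bool -> B.

Definition tmul (f g : tens) : tens := fun i k j l =>
  \sum_(p : bool * bool) f i k p.1 p.2 * g p.1 p.2 j l.

Local Infix "**" := tmul (at level 40, left associativity).

Lemma tensP (f g : tens) : (forall i k j l, f i k j l = g i k j l) <-> f = g.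
Proof.
by split=> [h|-> //]; do 4!(apply/funext => ?); exact: h.
Qed.

Lemma tmulA (f g h : tens) : f ** (g ** h) = f ** g ** h.
Proof.
apply/tensP => i k j l; rewrite /tmul.
under eq_bigr do rewrite mulr_sumr.
rewrite exchange_big /=; apply: eq_bigr => p _.
by rewrite mulr_suml; apply: eq_bigr => q _; rewrite mulrA.
Qed.

Lemma sum_bool2 (F : bool * bool -> B) :
  \sum_p F p = F (true, true) + F (true, false) + F (false, true) + F (false, false).
Proof.
rewrite (eq_bigr (fun p => F (p.1, p.2))) => [|[]//].
rewrite -(pair_bigA _ (fun a b => F (a, b))) /= !big_bool /=. by rewrite !addrA.
Qed.

Definition leg1 (S : bool -> bool -> B) : tens := fun i k j l => S i j *+ (k == l).
Definition leg2 (S : bool -> bool -> B) : tens := fun i k j l => S k l *+ (i == j).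
(* For x = 1/u and y = 1/v: R(u - v) = 1 - P/(u - v) multiplied by (u - v) x y,
   and the partial transpose of R(-u - v) multiplied by (u + v) x y. *)
Definition Rm (x y : K) : tens := fun i k j l =>
  ((y - x) *+ ((i == j) && (k == l)) - x * y *+ ((i == l) && (k == j)))%:M.
Definition Rt (x y : K) : tens := fun i k j l =>
  ((x + y) *+ ((i == j) && (k == l)) + x * y *+ ((i == ~~ k) && (j == ~~ l)))%:M.

Lemma scalar_mull (a : K) (x : B) : a%:M * x = a *: x.
Proof. exact: mul_scalar_mx. Qed.

Lemma scalar_mulr (a : K) (x : B) : x * a%:M = a *: x.
Proof. exact: mul_mx_scalar. Qed.

Ltac simp_tens :=
  rewrite ?(eqxx, andbT, andbF, mulr1n, mulr0n, mulr0, mul0r, addr0, add0r, subr0, sub0r).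

Lemma leg1_mul S f i k j l : (leg1 S ** f) i k j l = \sum_a S i a * f a k j l.
Proof.
by rewrite /tmul sum_bool2 big_bool /leg1 /=; case: k; simp_tens.
Qed.

Lemma leg2_mul S f i k j l : (leg2 S ** f) i k j l = \sum_a S k a * f i a j l.
Proof.
by rewrite /tmul sum_bool2 big_bool /leg2 /=; case: i; simp_tens.
Qed.

Lemma mul_leg1 S f i k j l : (f ** leg1 S) i k j l = \sum_a f i k a l * S a j.
Proof.
by rewrite /tmul sum_bool2 big_bool /leg1 /=; case: l; simp_tens.
Qed.

Lemma mul_leg2 S f i k j l : (f ** leg2 S) i k j l = \sum_a f i k j a * S a l.
Proof.
by rewrite /tmul sum_bool2 big_bool /leg2 /=; case: j; simp_tens.
Qed.

Lemma leg12 S T i k j l : (leg1 S ** leg2 T) i k j l = S i j * T k l.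
Proof. by rewrite leg1_mul big_bool /leg2; case: j => /=; simp_tens. Qed.

Lemma leg21 S T i k j l : (leg2 T ** leg1 S) i k j l = T k l * S i j.
Proof. by rewrite leg2_mul big_bool /leg1; case: l => /=; simp_tens. Qed.

Lemma leg12_comm (S T : bool -> bool -> B) :
  (forall i j k l, S i j * T k l = T k l * S i j) -> leg1 S ** leg2 T = leg2 T ** leg1 S.
Proof. by move=> ST; apply/tensP => i k j l; rewrite leg12 leg21 ST. Qed.

Lemma Rm_mul x y f i k j l :
  (Rm x y ** f) i k j l = (y - x) *: f i k j l - (x * y) *: f k i j l.
Proof.
rewrite /tmul sum_bool2 /Rm /=; case: i; case: k => /=; simp_tens;
by rewrite ?raddf0 ?mul0r ?addr0 ?add0r !scalar_mull -?scalerBl // scaleNr // addrC.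
Qed.

Lemma mul_Rm x y f i k j l :
  (f ** Rm x y) i k j l = (y - x) *: f i k j l - (x * y) *: f i k l j.
Proof.
rewrite /tmul sum_bool2 /Rm /=; case: j; case: l => /=; simp_tens;
by rewrite ?raddf0 ?mulr0 ?addr0 ?add0r !scalar_mulr -?scalerBl // scaleNr // addrC.
Qed.

Lemma leg1_Rt_leg2 x y S T i k j l : (leg1 S ** Rt x y ** leg2 T) i k j l =
  (x + y) *: (S i j * T k l) + (x * y) *: (S i (~~ k) * T (~~ j) l).
Proof.
rewrite mul_leg2 big_bool /= !leg1_mul !big_bool /Rt /=; case: j; case: k => /=; simp_tens;
rewrite ?raddf0 ?mulr0 ?addr0 ?add0r ?scalar_mulr ?mulrDl ?mul0r ?addr0 ?add0r;
by rewrite ?scale_mulAl -?scalerDl // addrC.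
Qed.

Lemma leg2_Rt_leg1 x y S T i k j l : (leg2 T ** Rt x y ** leg1 S) i k j l =
  (x + y) *: (T k l * S i j) + (x * y) *: (T k (~~ i) * S (~~ l) j).
Proof.
rewrite mul_leg1 big_bool /= !leg2_mul !big_bool /Rt /=; case: i; case: l => /=; simp_tens;
rewrite ?raddf0 ?mulr0 ?addr0 ?add0r ?scalar_mulr ?mulrDl ?mul0r ?addr0 ?add0r;
by rewrite ?scale_mulAl -?scalerDl // addrC.
Qed.

(* The relation between T(1/z) and T(1/w), multiplied by z - w; it is written
   polynomially in z and w, and likewise [quat] below. *)
Definition RTT (z w : K) (S T : bool -> bool -> B) := forall i j k l,
  (w - z) *: (S i j * T k l - T k l * S i j) = (z * w) *: (S k j * T i l - T k j * S i l).

Lemma subr_swap (a b c e : B) : (a - b = c - e) <-> (a - c = b - e).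
Proof.
have H (p q r t : B) : p - q = r - t -> p - r = q - t.
  move=> h; have -> : p = r - t + q by rewrite -h subrK.
  by rewrite addrAC (addrAC r) subrr add0r addrC.
by split=> /H.
Qed.

Lemma subr_cross (a b c e : B) : a - b = c - e -> a + e = b + c.
Proof. by move=> /(canRL (subrK _)) ->; rewrite addrAC subrK addrC. Qed.

Lemma RTT_Rm z w S T : RTT z w S T <->
  Rm z w ** (leg1 S ** leg2 T) = leg2 T ** leg1 S ** Rm z w.
Proof.
rewrite -tensP; split=> h; [move=> i k j l|move=> i j k l].
  rewrite Rm_mul mul_Rm !leg12 !leg21; apply/subr_swap.
  by have := h i j k l; rewrite !scalerBr.
rewrite !scalerBr; apply/subr_swap.
by have := h i k j l; rewrite Rm_mul mul_Rm !leg12 !leg21.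
Qed.

Definition mmul (S T : bool -> bool -> B) i j := \sum_a S i a * T a j.

Lemma leg1M S T : leg1 (mmul S T) = leg1 S ** leg1 T.
Proof.
apply/tensP => i k j l; rewrite leg1_mul /leg1 /mmul -sumrMnl.
by apply: eq_bigr => a _; rewrite /= mulrnAr.
Qed.

Lemma leg2M S T : leg2 (mmul S T) = leg2 S ** leg2 T.
Proof.
apply/tensP => i k j l; rewrite leg2_mul /leg2 /mmul -sumrMnl.
by apply: eq_bigr => a _; rewrite /= mulrnAr.
Qed.

Definition entries_comm (S T : bool -> bool -> B) :=
  forall i j k l, S i j * T k l = T k l * S i j.

(** This is compatibility with the coproduct: entries of different tensor factors commute, so the
    legs can be interleaved and R passes first through S, T and then through S', T'. *)
Lemma RTT_mmul z w S T S' T' : entries_comm S' T -> entries_comm S T' ->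
  RTT z w S T -> RTT z w S' T' -> RTT z w (mmul S S') (mmul T T').
Proof.
move=> /leg12_comm c1 /leg12_comm c2 /RTT_Rm h /RTT_Rm h'; apply/RTT_Rm.
rewrite leg1M leg2M; set r := Rm z w in h h' *.
transitivity (r ** leg1 S ** (leg1 S' ** leg2 T) ** leg2 T'); first by rewrite !tmulA.
rewrite c1; transitivity (r ** (leg1 S ** leg2 T) ** (leg1 S' ** leg2 T')).
  by rewrite !tmulA.
rewrite h; transitivity (leg2 T ** leg1 S ** (r ** (leg1 S' ** leg2 T'))).
  by rewrite !tmulA.
rewrite h'; transitivity (leg2 T ** (leg1 S ** leg2 T') ** leg1 S' ** r).
  by rewrite !tmulA.
by rewrite c2 !tmulA.
Qed.

(** Transposition with respect to the symmetric form pairing e_i with e_{-i}; it turns T(-u) into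
    the right-hand factor of S(u). *)
Definition tr (S : bool -> bool -> B) i j := S (~~ j) (~~ i).
(** Transposing one leg of an RTT relation reverses the products in that leg and turns R into its
    partial transpose. Transposing both legs, as in [RTT_tr12], gives R back. *)
Lemma RTT_tr1 x y S T : RTT (- x) y S T ->
  leg1 (tr S) ** Rt x y ** leg2 T = leg2 T ** Rt x y ** leg1 (tr S).
Proof.
move=> h; apply/tensP => i k j l; rewrite leg1_Rt_leg2 leg2_Rt_leg1 /tr !negbK.
have := h (~~ j) (~~ i) k l; rewrite opprK (addrC y) mulNr scaleNr -scalerN opprB !scalerBr.
exact: subr_cross.
Qed.

Lemma RTT_tr2 x y S T : RTT (- y) x T S ->
  leg1 S ** Rt x y ** leg2 (tr T) = leg2 (tr T) ** Rt x y ** leg1 S.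
Proof.
move=> h; apply/tensP => i k j l; rewrite leg1_Rt_leg2 leg2_Rt_leg1 /tr !negbK.
have := h (~~ l) (~~ k) i j; rewrite opprK mulNr (mulrC y) scaleNr -scalerN opprB !scalerBr.
by move/subr_cross ->.
Qed.

Lemma RTT_tr12 x y S T : RTT (- y) (- x) T S ->
  Rm x y ** (leg1 (tr S) ** leg2 (tr T)) = leg2 (tr T) ** leg1 (tr S) ** Rm x y.
Proof.
move=> h; apply/tensP => i k j l; rewrite Rm_mul mul_Rm !leg12 !leg21 /tr.
have := h (~~ l) (~~ k) (~~ j) (~~ i); rewrite opprK mulrNN (mulrC y) (addrC _ y) !scalerBr.
by move/subr_swap => e; rewrite e.
Qed.

Definition refl_eq x y S T :=
  Rm x y ** leg1 S ** Rt x y ** leg2 T = leg2 T ** Rt x y ** leg1 S ** Rm x y.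

(** Here T, T' stand for T(u), T(v) and M, M' for T(-u), T(-v). Because the inner factors commute
    with the outer ones, the product can be reordered: [e1] and [e4] carry R past the outer pairs,
    [e2] and [e3] exchange a transposed leg with an untransposed one, and in the middle the equation
    for S, S' applies. *)
Lemma refl_conj x y T T' M M' S S' :
  RTT x y T T' -> RTT (- x) y M T' -> RTT (- y) x M' T -> RTT (- y) (- x) M' M ->
  entries_comm S T' -> entries_comm T S' -> entries_comm S (tr M') -> entries_comm (tr M) S' ->
  refl_eq x y S S' ->
  refl_eq x y (mmul T (mmul S (tr M))) (mmul T' (mmul S' (tr M'))).
Proof.
move=> /RTT_Rm e1 /RTT_tr1 e2 /RTT_tr2 e3 /RTT_tr12 e4.
move=> /leg12_comm c1 /leg12_comm c2 /leg12_comm c3 /leg12_comm c4.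
rewrite /refl_eq !leg1M !leg2M => h.
set r := Rm x y in e1 e4 h *; set q := Rt x y in e2 e3 h *.
set t1 := leg1 T in e1 e3 c2 *; set t2 := leg2 T' in e1 e2 c1 *.
set s1 := leg1 S in c1 c3 h *; set s2 := leg2 S' in c2 c4 h *.
set m1 := leg1 (tr M) in e2 e4 c4 *; set m2 := leg2 (tr M') in e3 e4 c3 *.
have -> : r ** (t1 ** (s1 ** m1)) ** q ** (t2 ** (s2 ** m2)) =
          (r ** (t1 ** t2)) ** s1 ** q ** s2 ** (m1 ** m2).
  transitivity (r ** t1 ** s1 ** (m1 ** q ** t2) ** s2 ** m2); first by rewrite !tmulA.
  rewrite e2; transitivity (r ** t1 ** (s1 ** t2) ** q ** (m1 ** s2) ** m2); first by rewrite !tmulA.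
  by rewrite c1 c4 !tmulA.
rewrite e1; transitivity (t2 ** t1 ** (r ** s1 ** q ** s2) ** (m1 ** m2)); first by rewrite !tmulA.
rewrite h; transitivity (t2 ** (t1 ** s2) ** q ** s1 ** (r ** (m1 ** m2))); first by rewrite !tmulA.
rewrite e4 c2; transitivity (t2 ** s2 ** (t1 ** q ** (s1 ** m2)) ** m1 ** r); first by rewrite !tmulA.
rewrite c3; transitivity (t2 ** s2 ** (t1 ** q ** m2) ** s1 ** m1 ** r); first by rewrite !tmulA.
by rewrite e3 !tmulA.
Qed.

Definition quat x y (S T : bool -> bool -> B) i j k l :=
  (y ^+ 2 - x ^+ 2) *: (S i j * T k l - T k l * S i j) =
  (x * y * (x + y)) *: (S k j * T i l - T k j * S i l)
  - (x * y * (y - x)) *: (S i (~~ k) * T (~~ j) l - T k (~~ i) * S (~~ l) j)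
  + ((x * y) ^+ 2) *: (S k (~~ i) * T (~~ j) l - T k (~~ i) * S (~~ j) l).

Lemma refl_quat x y S T : refl_eq x y S T <-> forall i j k l, quat x y S T i j k l.
Proof.
rewrite /refl_eq -tensP.
have E i j k l :
  (Rm x y ** leg1 S ** Rt x y ** leg2 T) i k j l - (leg2 T ** Rt x y ** leg1 S ** Rm x y) i k j l =
  (y ^+ 2 - x ^+ 2) *: (S i j * T k l - T k l * S i j) - (
  (x * y * (x + y)) *: (S k j * T i l - T k j * S i l)
  - (x * y * (y - x)) *: (S i (~~ k) * T (~~ j) l - T k (~~ i) * S (~~ l) j)
  + ((x * y) ^+ 2) *: (S k (~~ i) * T (~~ j) l - T k (~~ i) * S (~~ j) l)).
  rewrite -!tmulA Rm_mul !tmulA mul_Rm !leg1_Rt_leg2 !leg2_Rt_leg1.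
  by apply/matrixP => a b; rewrite !mxE; ring.
split=> h.
  by move=> i j k l; apply/eqP; rewrite -subr_eq0 -E h subrr.
by move=> i k j l; apply/eqP; rewrite -subr_eq0 E h subrr.
Qed.
End Reflection.

(** * Monodromy matrices T(u) of tensor products of evaluation modules *)

Section Transfer.
Context (K : comNzRingType) (d : nat) (J : eqType).
Local Notation B := 'M[K]_d.

Definition gl2_rel (E : bool -> bool -> B) := forall i j k l,
  E i j * E k l - E k l * E i j = E i l *+ (j == k) - E k j *+ (i == l).

Definition tfac (z : K) (E : bool -> bool -> B) : bool -> bool -> B :=
  fun a b => ((a == b)%:R)%:M + z *: E a b.

Fixpoint tgen (E : J -> bool -> bool -> B) (z : K) (js : seq J) : bool -> bool -> B :=
  match js with
  | [::] => fun a b => ((a == b)%:R)%:M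
  | j :: js' => mmul (tfac z (E j)) (tgen E z js')
  end.

Lemma mul_affine (p q z w : K) (X Y : B) :
  (p%:M + z *: X) * (q%:M + w *: Y) =
  (p * q)%:M + (p * w) *: Y + (q * z) *: X + (z * w) *: (X * Y).
Proof.
rewrite mulrDl !mulrDr !scalar_mull scalar_mulr scale_mulAl scale_mulAr !scalerA.
by rewrite -scale_scalar_mx !addrA; congr (_ + _ + _ + _); rewrite scale_scalar_mx // mulr1.
Qed.

(** After expansion both sides are z w (w - z) times the two sides of the gl_2 commutation
    relation. *)
Lemma RTT_tfac z w E : gl2_rel E -> RTT z w (tfac z E) (tfac w E).
Proof.
move=> h i j k l; rewrite /tfac !mul_affine.
have -> : E i j * E k l = E k l * E i j + (E i l *+ (j == k) - E k j *+ (i == l)).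
  by rewrite -h addrC subrK.
rewrite (eq_sym k j).
apply/matrixP => a b; rewrite !mxE !mulmxnE ?mxE.
case: (j == k); case: (i == l); rewrite /= ?mxE; ring.
Qed.

Definition fam_comm (E : J -> bool -> bool -> B) :=
  forall i j a b c e, i != j -> E i a b * E j c e = E j c e * E i a b.

Lemma comm_tfac z w E F : entries_comm E F -> entries_comm (tfac z E) (tfac w F).
Proof.
move=> h i j k l; rewrite /tfac !mul_affine h (mulrC _%:R) (mulrC z w).
by rewrite -!addrA; congr (_ + _); rewrite !addrA; congr (_ + _); rewrite addrC.
Qed.

Lemma comm_mmul (S T U : bool -> bool -> B) :
  entries_comm S U -> entries_comm T U -> entries_comm (mmul S T) U.
Proof.
move=> h h' i j k l; rewrite /mmul mulr_suml mulr_sumr.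
by apply: eq_bigr => a _; rewrite -mulrA h' mulrA h mulrA.
Qed.

Lemma comm_sym (S T : bool -> bool -> B) : entries_comm S T -> entries_comm T S.
Proof. by move=> h i j k l; rewrite h. Qed.

Lemma comm_scalar (f : bool -> bool -> K) (S : bool -> bool -> B) :
  entries_comm S (fun a b => (f a b)%:M).
Proof. by move=> i j k l; rewrite scalar_mull scalar_mulr. Qed.

Lemma tgen_comm E z w j js : fam_comm E -> j \notin js ->
  entries_comm (tfac z (E j)) (tgen E w js).
Proof.
move=> h; elim: js => [|l js IH] /=; first by move=> _; exact: comm_scalar.
rewrite inE negb_or => /andP[jl jjs]; apply/comm_sym/comm_mmul; apply: comm_sym.
  by apply: comm_tfac => a b c e; exact: h.
exact: IH.
Qed.

Lemma RTT_scalar1 z w :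
  RTT z w (fun a b => ((a == b)%:R)%:M : B) (fun a b => ((a == b)%:R)%:M).
Proof.
move=> i j k l; rewrite !scalar_mull !scale_scalar_mx -!raddfB /= !scale_scalar_mx.
by congr (_%:M); rewrite (mulrC (k == l)%:R) !subrr !mulr0.
Qed.

Lemma RTT_tgen E z w js : fam_comm E -> (forall j, gl2_rel (E j)) -> uniq js ->
  RTT z w (tgen E z js) (tgen E w js).
Proof.
move=> hc hg; elim: js => [|j js IH] /=; first by move=> _; exact: RTT_scalar1.
move=> /andP[jjs ujs]; apply: RTT_mmul.
- exact/comm_sym/tgen_comm.
- exact: tgen_comm.
- exact: RTT_tfac.
- exact: IH.
Qed.

(** The matrix of the one-dimensional module W(c) at u = 1/z, cleared of its denominator 1 + z/2. *)
Definition Wd (z : K) (c : K) : bool -> bool -> B := fun a b =>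
  ((a == b)%:R * (1 + (if a then c else 1 - c) * z))%:M.

Lemma Wd_refl x y c : refl_eq x y (Wd x c) (Wd y c).
Proof.
apply/refl_quat => i j k l; rewrite /quat /Wd !scalar_mull !scale_scalar_mx.
rewrite -!raddfB /= !scale_scalar_mx -!raddfB -!raddfD /=; congr (_%:M).
by case: i; case: j; case: k; case: l => /=; ring.
Qed.

(* The generating matrix S(1/z) multiplied by 1 + z/2, which makes it
   polynomial in z. *)
Definition sgenp (E : J -> bool -> bool -> B) (c z : K) js :=
  mmul (tgen E z js) (mmul (Wd z c) (tr (tgen E (- z) js))).

Lemma sgenp_refl E c x y js : fam_comm E -> (forall j, gl2_rel (E j)) -> uniq js ->
  refl_eq x y (sgenp E c x js) (sgenp E c y js).
Proof.
move=> hc hg u; apply: refl_conj; try exact: RTT_tgen.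
- exact/comm_sym/comm_scalar.
- exact/comm_scalar.
- exact/comm_sym/comm_scalar.
- exact/comm_scalar.
- exact: Wd_refl.
Qed.
End Transfer.

(** * The symmetry relation *)

Section SymmetryRelation.
Context (K : idomainType) (d : nat) (J : eqType).
Local Notation B := 'M[K]_d.

Definition wd (z c : K) (a : bool) := 1 + (if a then c else 1 - c) * z.

Lemma sgenpE (E : J -> bool -> bool -> B) c z js i j : sgenp E c z js i j =
  \sum_a wd z c a *: (tgen E z js i a * tgen E (- z) js (~~ j) (~~ a)).
Proof.
rewrite /sgenp {1}/mmul; apply: eq_bigr => a _; rewrite /mmul (bigD1 a) //= big1 => [|b /negPf ba].
  by rewrite addr0 /Wd eqxx mul1r scalar_mull scale_mulAr.
by rewrite /Wd eq_sym ba mul0r raddf0 mul0r.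
Qed.

(** This is the symmetry relation with the denominators 1 + x/2 and 1 - x/2 cleared. Multiplied by
    x, its defect splits into commutators of T(-u) with T(u) and terms with factor x^2; the RTT
    relation at -x and x makes them cancel after the sign change of the summation index. Finally x
    is cancelled in the integral domain K. *)
Lemma sgenp_symm (E : J -> bool -> bool -> B) c x js i j : x != 0 ->
  fam_comm E -> (forall j, gl2_rel (E j)) -> uniq js ->
  2 *: sgenp E c (- x) js (~~ j) (~~ i) =
  (2 - x) *: sgenp E c x js i j - x *: sgenp E c (- x) js i j.
Proof.
move=> x0 hc hg u.
pose t a b := tgen E x js a b; pose t' a b := tgen E (- x) js a b.
have rtt a b e f :
    (2 * x) *: (t' a b * t e f - t e f * t' a b) = - (x ^+ 2) *: (t' e b * t a f - t e b * t' a f).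
  have := RTT_tgen (- x) x hc hg u a b e f; rewrite opprK mulNr -expr2 => <-.
  by rewrite mulrDl mul1r.
apply/eqP; rewrite -subr_eq0.
suff : x *: (2 *: sgenp E c (- x) js (~~ j) (~~ i) -
  ((2 - x) *: sgenp E c x js i j - x *: sgenp E c (- x) js i j)) = 0.
  by move/eqP; rewrite scalemx_eq0 (negPf x0).
rewrite !sgenpE !opprK -/t -/t'.
rewrite (reindex_inj negb_inj) /=.
transitivity (\sum_a (wd (- x) c (~~ a)) *: ((2 * x) *: (t' (~~ j) (~~ a) * t i a - t i a * t' (~~ j) (~~ a)))
   + \sum_a wd (- x) c a *: ((x ^+ 2) *: (t' i a * t (~~ j) (~~ a) - t i a * t' (~~ j) (~~ a)))).
  rewrite !big_bool /wd /= ?negbK /t /t'.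
  by apply/matrixP => p q; rewrite !mxE; ring.
rewrite (reindex_inj negb_inj) /= -big_split big1 // => a _ /=.
by rewrite negbK rtt scaleNr scalerN addNr.
Qed.
End SymmetryRelation.

Lemma coef_compN (F : idomainType) (P : {poly F}) r : (P \Po (- 'X))`_r = (-1) ^+ r * P`_r.
Proof.
elim/poly_ind: P r => [|P x IH] r; first by rewrite comp_poly0 coef0 mulr0.
rewrite comp_polyD comp_polyM comp_polyX comp_polyC mulrN coefD coefN coefMX coefC coefD coefMX coefC.
by case: r => [|r] /=; rewrite ?IH ?addr0 ?expr0 ?mul1r ?oppr0 // exprS mulN1r mulNr.
Qed.

(** * Extraction of coefficients *)

Section Coefficients.
Context (F : idomainType) (d : nat).
Local Notation B := 'M[F]_d.
Local Notation BP := 'M[{poly F}]_d.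

Definition mxcoef (r : nat) (A : BP) : B := map_mx (coefp r) A.

Lemma mxcoefE r A p q : mxcoef r A p q = (A p q)`_r.
Proof. by rewrite !mxE. Qed.

Lemma mxcoefM r (A A' : BP) : mxcoef r (A * A') = \sum_(i < r.+1) mxcoef i A * mxcoef (r - i) A'.
Proof.
apply/matrixP => p q; rewrite mxcoefE !mxE coef_sum summxE.
under [RHS]eq_bigr => i _ do rewrite !mxE.
by rewrite exchange_big /=; apply: eq_bigr => l _; rewrite coefM; apply: eq_bigr => i _; rewrite !mxE.
Qed.

Lemma mxcoefX r (A : BP) : mxcoef r ('X *: A) = if r is r'.+1 then mxcoef r' A else 0.
Proof.
by apply/matrixP => p q; rewrite mxcoefE !mxE coefXM; case: r => [|r] /=; rewrite !mxE.
Qed.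

Lemma mxcoefD r (A A' : BP) : mxcoef r (A + A') = mxcoef r A + mxcoef r A'.
Proof. exact: raddfD. Qed.

Lemma mxcoef_sum r (I : Type) (s : seq I) (P : pred I) (G : I -> BP) :
  mxcoef r (\sum_(i <- s | P i) G i) = \sum_(i <- s | P i) mxcoef r (G i).
Proof. exact: raddf_sum. Qed.

Lemma mxcoefC r (A : B) : mxcoef r (map_mx polyC A) = if r == 0%N then A else 0.
Proof.
by apply/matrixP => p q; rewrite mxcoefE !mxE coefC; case: ifP => _; rewrite ?mxE.
Qed.

Lemma mxcoefN r (A : BP) : mxcoef r (- A) = - mxcoef r A.
Proof. exact: raddfN. Qed.

Lemma mxcoefZ r (a : F) (A : BP) : mxcoef r (a%:P *: A) = a *: mxcoef r A.
Proof. by apply/matrixP => p q; rewrite mxcoefE !mxE coefCM. Qed.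

(* Negative powers of u^-1 have coefficient 0. *)
Definition zext (f : nat -> B) (p : int) : B := if p is Posz r then f r else 0.

Local Notation BPP := 'M[{poly {poly F}}]_d.

(** In two-variable polynomials the outer indeterminate ['X] stands for 1/u and the inner one,
    ['X%:P], for 1/v. *)
Definition inX (A : BP) : BPP := map_mx (map_poly polyC) A.
Definition inY (A : BP) : BPP := map_mx polyC A.

Definition bicoef (p q : int) (A : BPP) : B :=
  match p, q with
  | Posz m, Posz n => map_mx (coefp n \o coefp m) A
  | _, _ => 0
  end.

Lemma bicoefD p q (A A' : BPP) : bicoef p q (A + A') = bicoef p q A + bicoef p q A'.
Proof.
by case: p => p; case: q => q /=; rewrite ?addr0 //; apply/matrixP => a b; rewrite !mxE /= !coefD.
Qed.

Lemma bicoefN p q (A : BPP) : bicoef p q (- A) = - bicoef p q A.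
Proof.
by case: p => p; case: q => q /=; rewrite ?oppr0 //; apply/matrixP => a b; rewrite !mxE /= !coefN.
Qed.

Lemma bicoefX p q (A : BPP) : bicoef p q ('X *: A) = bicoef (p - 1) q A.
Proof.
case: p => [[|p]|p]; case: q => q //.
  by apply/matrixP => a b; rewrite !mxE /= coefXM coef0.
have -> : p.+1%:Z - 1 = p by lia.
by apply/matrixP => a b; rewrite !mxE /= coefXM.
Qed.

Lemma bicoefY p q (A : BPP) : bicoef p q ('X%:P *: A) = bicoef p (q - 1) A.
Proof.
case: q => [[|q]|q]; case: p => p //.
  by apply/matrixP => a b; rewrite !mxE /= coefCM coefXM.
have -> : q.+1%:Z - 1 = q by lia.
by apply/matrixP => a b; rewrite !mxE /= coefCM coefXM.
Qed.

Lemma bicoef_XY p q A A' : bicoef p q (inX A * inY A') = zext (mxcoef^~ A) p * zext (mxcoef^~ A') q.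
Proof.
case: p => p; case: q => q /=; rewrite ?mul0r ?mulr0 //.
apply/matrixP => a b; rewrite !mxE /= !coef_sum; apply: eq_bigr => l _.
by rewrite !mxE /= coefMC coef_map coefCM.
Qed.

Lemma bicoef_YX p q A A' : bicoef p q (inY A' * inX A) = zext (mxcoef^~ A') q * zext (mxcoef^~ A) p.
Proof.
case: p => p; case: q => q /=; rewrite ?mul0r ?mulr0 //.
apply/matrixP => a b; rewrite !mxE /= !coef_sum; apply: eq_bigr => l _.
by rewrite !mxE /= coefCM coef_map coefMC.
Qed.

(** The coefficient at u^-p v^-q of the defect of the quaternary relation multiplied by u^2 - v^2.
    Keeping f and g apart allows them to be rescaled one at a time in [quatZ_unshift]. *)
Definition quatZ (f g : bool -> bool -> int -> B) i j k l (p q : int) : B :=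
  let C p q := f i j p * g k l q - g k l q * f i j p in
  let T1 p q := f k j p * g i l q - g k j q * f i l p in
  let T2 p q := f i (~~ k) p * g (~~ j) l q - g k (~~ i) q * f (~~ l) j p in
  let T3 p q := f k (~~ i) p * g (~~ j) l q - g k (~~ i) q * f (~~ j) l p in
  C (p + 2) q - C p (q + 2) -
    (T1 (p + 1) q + T1 p (q + 1) - (T2 (p + 1) q - T2 p (q + 1)) + T3 p q).

Lemma quat_coef (S : bool -> bool -> BP) i j k l p q :
  quat 'X 'X%:P (fun a b => inX (S a b)) (fun a b => inY (S a b)) i j k l ->
  quatZ (fun a b => zext (mxcoef^~ (S a b))) (fun a b => zext (mxcoef^~ (S a b))) i j k l p q = 0.
Proof.
rewrite /quat !expr2 !mulrDr !mulrN -!mulrA !scalerDl !scaleNr -!scalerA.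
(* Compared with [quatZ], the relation [quat] carries an additional factor u^-2 v^-2, hence the
   shift of both degrees by 2. *)
move=> /(congr1 (bicoef (p + 2) (q + 2))).
rewrite !(bicoefD, bicoefN, bicoefX, bicoefY, bicoef_XY, bicoef_YX).
have -> : p + 2 - 1 = p + 1 by lia.
have -> : q + 2 - 1 = q + 1 by lia.
have -> : p + 1 - 1 = p by lia.
have -> : q + 1 - 1 = q by lia.
rewrite /quatZ => /eqP; rewrite -subr_eq0 => /eqP <-.
by apply/matrixP => a b; rewrite !mxE; ring.
Qed.

Lemma quatZ_shift (f g : bool -> bool -> int -> B) (a : F) i j k l p q :
  quatZ (fun x y r => f x y r + a *: f x y (r - 1)) g i j k l p q =
  quatZ f g i j k l p q + a *: quatZ f g i j k l (p - 1) q.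
Proof.
rewrite /quatZ; have -> : p + 2 - 1 = p - 1 + 2 by lia.
have -> : p + 1 - 1 = p - 1 + 1 by lia.
rewrite !mulrDl !mulrDr !scale_mulAl !scale_mulAr.
by apply/matrixP => x y; rewrite !mxE; ring.
Qed.

Lemma quatZ_shiftr (f g : bool -> bool -> int -> B) (a : F) i j k l p q :
  quatZ f (fun x y r => g x y r + a *: g x y (r - 1)) i j k l p q =
  quatZ f g i j k l p q + a *: quatZ f g i j k l p (q - 1).
Proof.
rewrite /quatZ; have -> : q + 2 - 1 = q - 1 + 2 by lia.
have -> : q + 1 - 1 = q - 1 + 1 by lia.
rewrite !mulrDl !mulrDr !scale_mulAl !scale_mulAr.
by apply/matrixP => x y; rewrite !mxE; ring.
Qed.

Lemma int_rec0 (h : int -> B) (a : F) (N : int) : (forall p, (p < N)%R -> h p = 0) ->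
  (forall p, h p + a *: h (p - 1) = 0) -> forall p, h p = 0.
Proof.
move=> h0 hs p; have [n] : exists n : nat, (p < N + n%:Z)%R by exists `|p - N|.+1; lia.
elim: n p => [|n IH] p hp; first by apply: h0; lia.
by have := hs p; rewrite (IH (p - 1)) ?scaler0 ?addr0 //; lia.
Qed.

Lemma quatZ_neg (f g : nat -> bool -> bool -> B) i j k l p q : (p < -2) || (q < -2) ->
  quatZ (fun a b => zext (fun r => f r a b)) (fun a b => zext (fun r => g r a b)) i j k l p q = 0.
Proof.
have z (h : nat -> bool -> bool -> B) a b r : r < 0 -> zext (fun r => h r a b) r = 0.
  by case: r.
case/orP => hp; rewrite /quatZ.
  by rewrite !(z f _ _ p, z f _ _ (p + 1), z f _ _ (p + 2)) ?(mulr0, mul0r, subrr, addr0, oppr0) //; lia.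
by rewrite !(z g _ _ q, z g _ _ (q + 1), z g _ _ (q + 2)) ?(mulr0, mul0r, subrr, addr0, oppr0) //; lia.
Qed.

(* Multiplying s(u) by 1 + a/u can be undone in the quaternary relation, by
   induction on the degree. *)
Lemma quatZ_unshift (f : nat -> bool -> bool -> B) (a : F) i j k l :
  let F0 x y := zext (fun r => f r x y) in
  let F1 x y r := F0 x y r + a *: F0 x y (r - 1) in
  (forall p q, quatZ F1 F1 i j k l p q = 0) ->
  forall p q, quatZ F0 F0 i j k l p q = 0.
Proof.
move=> F0 F1 h p; apply: (int_rec0 (a := a) (N := -2)) => q.
  by move=> hq; apply: quatZ_neg; rewrite hq orbT.
rewrite -quatZ_shiftr -/F1; move: p; apply: (int_rec0 (a := a) (N := -2)) => p.
  by move=> hp; rewrite quatZ_shiftr !quatZ_neg ?hp // scaler0 addr0.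
by rewrite -quatZ_shift h.
Qed.
End Coefficients.
Arguments mxcoef {F d}.
Arguments zext {F d}.

(** * The operators s_ij^(r) *)

Section Series.
Context (F : numFieldType) (d : nat) (J : eqType).
Local Notation B := 'M[F]_d.

(** This and the next definitions repeat the series of the evaluation modules for an arbitrary
    family E and, in [sser], arbitrary coefficients w, so that rescaled families are covered as
    well. *)
Definition conv (f g : nat -> B) (r : nat) : B := \sum_(i < r.+1) f i *m g (r - i)%N.

Definition Wser (c : F) (r : nat) : F :=
  (- 2^-1) ^+ r + (if r is r'.+1 then c * (- 2^-1) ^+ r' else 0).

Definition Wop (c : F) (a b : bool) (r : nat) : F :=
  match a, b with
  | true, true => Wser c r
  | false, false => Wser (1 - c) r
  | _, _ => 0
  end.

Fixpoint tser (E : J -> bool -> bool -> B) (js : seq J) (a b : bool) (r : nat) : B :=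
  match js with
  | [::] => if r == 0%N then ((a == b)%:R)%:M else 0
  | j :: js' =>
      \sum_(c : bool) conv (fun i => match i with 0 => ((a == c)%:R)%:M | 1 => E j a c | _ => 0 end)
         (fun r' => tser E js' c b r') r
  end.

Definition sser (E : J -> bool -> bool -> B) (w : bool -> bool -> nat -> F) js (i j : bool) r : B :=
  \sum_(a : bool) \sum_(b : bool)
    conv (conv (tser E js i a) (fun r => (-1) ^+ r *: tser E js (~~ j) (~~ b) r))
         (fun r' => (w a b r')%:M) r.

Lemma conv_mxcoef (A A' : 'M[{poly F}]_d) r : conv (mxcoef^~ A) (mxcoef^~ A') r = mxcoef r (A * A').
Proof. by rewrite mxcoefM. Qed.

Lemma convE (f g : nat -> B) r : conv f g r = \sum_(i < r.+1) f i * g (r - i)%N.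
Proof. by []. Qed.

Lemma eq_conv (f f' g g' : nat -> B) : f =1 f' -> g =1 g' -> conv f g =1 conv f' g'.
Proof. by move=> ff' gg' r; apply: eq_bigr => i _; rewrite ff' gg'. Qed.

Definition polyE (E : J -> bool -> bool -> B) j a b : 'M[{poly F}]_d := map_mx polyC (E j a b).

Lemma mxcoef_nat n r : mxcoef r ((n%:R)%:M : 'M[{poly F}]_d) = if r == 0%N then (n%:R)%:M else 0.
Proof. by rewrite -(rmorph_nat (@polyC F)) -map_scalar_mx mxcoefC. Qed.

Lemma mxcoef_tgen E js a b r : mxcoef r (tgen (polyE E) 'X js a b) = tser E js a b r.
Proof.
elim: js a b r => [|j js IH] a b r /=.
  by rewrite mxcoef_nat.
rewrite /mmul mxcoef_sum; apply: eq_bigr => c _; rewrite -conv_mxcoef.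
apply: eq_conv => {}r; last exact: IH.
rewrite /tfac mxcoefD mxcoefX mxcoef_nat.
by case: r => [|[|r]] /=; rewrite ?mxcoefC ?addr0 ?add0r.
Qed.

Lemma mxcoef_tgenN E js a b r : mxcoef r (tgen (polyE E) (- 'X) js a b) = (-1) ^+ r *: tser E js a b r.
Proof.
elim: js a b r => [|j js IH] a b r /=.
  rewrite mxcoef_nat.
  by case: r => [|r] /=; rewrite ?scale1r ?scaler0.
rewrite /mmul mxcoef_sum scaler_sumr; apply: eq_bigr => c _; rewrite -conv_mxcoef.
rewrite (eq_conv (f' := fun r => (-1) ^+ r *: match r with 0 => ((a == c)%:R)%:M | 1 => E j a c | _ => 0 end)
  (g' := fun r => (-1) ^+ r *: tser E js c b r)) //.
  rewrite !convE scaler_sumr; apply: eq_bigr => i _.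
  by rewrite scale_mulAl scale_mulAr scalerA -exprD subnKC // -ltnS.
move=> {}r; rewrite /tfac scaleNr mxcoefD mxcoefN mxcoefX mxcoef_nat.
by case: r => [|[|r]]; rewrite ?mxcoefC /= ?(expr0, oppr0, addr0, add0r, scale1r, scaler0, expr1, scaleN1r).
Qed.

(** Since (u + c)/(u + 1/2) times 1 + 1/(2u) equals 1 + c/u, this factor makes the series a
    polynomial. *)
Lemma W_conv (f : nat -> B) (c : F) r :
  conv f (fun r' => (Wser c r')%:M) r +
    (if r is r'.+1 then 2^-1 *: conv f (fun r' => (Wser c r')%:M) r' else 0) =
  f r + (if r is r'.+1 then c *: f r' else 0).
Proof.
rewrite !convE big_ord_recr /= subnn scalar_mulr {2}/Wser expr0 addr0 scale1r.
rewrite [_ + f r]addrC -!addrA; congr (_ + _); case: r => [|r] /=.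
  by rewrite big_ord0 addr0.
rewrite convE scaler_sumr -big_split /=.
rewrite (bigD1 ord_max) //= big1 ?addr0 => [|i /eqP ir].
  rewrite subSn // subnn !scalar_mulr scalerA -scalerDl /Wser; congr (_ *: _).
  by rewrite !expr1 !expr0; by field.
have lt : (i < r)%N by rewrite ltn_neqAle -ltnS ltn_ord andbT; apply/eqP => e; apply: ir; apply/val_inj.
rewrite subSn ?(ltnW lt) // !scalar_mulr scalerA -scalerDl.
rewrite -(subnSK lt) /Wser !exprS; set u := _ ^+ _.
rewrite [X in X *: _](_ : _ = 0) ?scale0r //; by field.
Qed.

Lemma sser_diag E w js i j r : (forall a, w a (~~ a) =1 fun=> 0) -> sser E w js i j r =
  \sum_(a : bool)
    conv (conv (tser E js i a) (fun r => (-1) ^+ r *: tser E js (~~ j) (~~ a) r))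
         (fun r' => (w a a r')%:M) r.
Proof.
move=> w0; apply: eq_bigr => a _; rewrite (bigD1 a) //= big1 ?addr0 // => b ba.
have -> : b = ~~ a by case: a b ba => [] [].
by rewrite convE big1 // => k _; rewrite w0 raddf0 mulr0.
Qed.

Lemma W_op_offdiag (c : F) a : Wop c a (~~ a) =1 fun=> 0.
Proof. by case: a. Qed.

Lemma mxcoef_sgenp E (c : F) js i j r :
  mxcoef r (sgenp (polyE E) c%:P 'X js i j) =
  sser E (Wop c) js i j r + (if r is r'.+1 then 2^-1 *: sser E (Wop c) js i j r' else 0).
Proof.
rewrite sgenpE mxcoef_sum !sser_diag; try exact: W_op_offdiag.
pose f a := conv (tser E js i a) (fun r => (-1) ^+ r *: tser E js (~~ j) (~~ a) r).
transitivity (\sum_a (f a r + (if r is r'.+1 then (if a then c else 1 - c) *: f a r' else 0))).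
  apply: eq_bigr => a _; have fE n : mxcoef n (tgen (polyE E) 'X js i a * tgen (polyE E) (- 'X) js (~~ j) (~~ a)) = f a n.
    rewrite -conv_mxcoef; apply: eq_conv => k; [exact: mxcoef_tgen|exact: mxcoef_tgenN].
  rewrite /wd scalerDl scale1r mxcoefD fE; congr (_ + _).
  have -> : (if a then c%:P else 1 - c%:P) = (if a then c else 1 - c)%:P.
    by case: (a); rewrite // polyCB.
  rewrite -scalerA mxcoefZ mxcoefX; case: r => [|r]; last by rewrite fE.
  by rewrite scaler0.
transitivity (\sum_a (conv (f a) (fun r' => (Wop c a a r')%:M) r +
   (if r is r'.+1 then 2^-1 *: conv (f a) (fun r' => (Wop c a a r')%:M) r' else 0))).
  by apply: eq_bigr => a _; rewrite -(W_conv (f a)); case: a.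
rewrite big_split /=; congr (_ + _).
by case: r => [|r]; [rewrite big1|rewrite -scaler_sumr sser_diag //; exact: W_op_offdiag].
Qed.
End Series.

(** * Change of the coefficient ring *)

Section MapFamilies.
Context (K L : comNzRingType) (phi : {rmorphism K -> L}) (d : nat) (J : eqType).
Implicit Types E : J -> bool -> bool -> 'M[K]_d.

Definition mapE E j a b : 'M[L]_d := map_mx phi (E j a b).

Lemma map_mulr (A A' : 'M[K]_d) : map_mx phi (A * A') = map_mx phi A * map_mx phi A'.
Proof. exact: map_mxM. Qed.

Lemma gl2_map E j : gl2_rel (E j) -> gl2_rel (mapE E j).
Proof.
move=> h a b k l; by rewrite /mapE -!map_mulr -map_mxB h map_mxB !raddfMn.
Qed.

Lemma fam_comm_map E : fam_comm E -> fam_comm (mapE E).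
Proof. by move=> h i j a b c e ij; rewrite /mapE -!map_mulr h. Qed.

Lemma map_tgen E z js a b :
  map_mx phi (tgen E z js a b) = tgen (mapE E) (phi z) js a b.
Proof.
elim: js a b => [|j js IH] a b /=; first by rewrite map_scalar_mx rmorph_nat.
rewrite /mmul raddf_sum; apply: eq_bigr => c _ /=.
by rewrite map_mulr IH /tfac raddfD /= map_scalar_mx rmorph_nat map_mxZ.
Qed.

Lemma map_sgenp E c z js i j :
  map_mx phi (sgenp E c z js i j) = sgenp (mapE E) (phi c) (phi z) js i j.
Proof.
rewrite /sgenp /mmul raddf_sum; apply: eq_bigr => a _ /=.
rewrite map_mulr map_tgen; congr (_ * _).
rewrite raddf_sum; apply: eq_bigr => b _ /=.
rewrite map_mulr /tr map_tgen rmorphN; congr (_ * _).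
rewrite /Wd map_scalar_mx; congr (_%:M).
by case: (a); rewrite !(rmorphM, rmorphD, rmorphN, rmorph1, rmorph_nat).
Qed.
End MapFamilies.
Arguments gl2_map {K L} phi {d J E j}.
Arguments fam_comm_map {K L} phi {d J E}.

(** In degrees 0, 1 and at least 2 respectively, the coefficients of the identity [sgenp_symm] say
    that the defect D_r of the symmetry relation for s itself satisfies D_0 = 0 and D_r =
    D_(r-1)/2. *)
Lemma symm_unshift00 (K : numFieldType) d (a b : 'M[K]_d) :
  2 *: ((-1) ^+ 0 *: (a + 0)) = 2 *: (b + 0) - 0 - (0 : 'M[K]_d) ->
  (2 * (-1) ^+ 0) *: a - (2 *: b + (1 + (-1) ^+ 0) *: 0) - 0 = 0.
Proof.
by rewrite expr0 scale1r mulr1 !addr0 !subr0 scaler0 addr0 => ->; rewrite subrr.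
Qed.

Lemma symm_unshift0 (K : numFieldType) d (w : K) (a a' b b' : 'M[K]_d) :
  2 *: ((w * -1) *: (a + 2^-1 *: a')) = 2 *: (b + 2^-1 *: b') - (b' + 0) - w *: (b' + 0) ->
  (2 * (w * -1)) *: a - (2 *: b + (1 + w * -1) *: b')
  - 2^-1 *: ((2 * w) *: a' - (2 *: b' + (1 + w) *: 0)) = 0.
Proof.
move=> /matrixP h; apply/matrixP => x y; move: (h x y); rewrite !mxE.
by move/eqP; rewrite -subr_eq0 => /eqP e; rewrite -[RHS]e; field.
Qed.

Lemma symm_unshift (K : numFieldType) d (w : K) (a a' b b' b'' : 'M[K]_d) :
  2 *: ((w * -1) *: (a + 2^-1 *: a')) =
    2 *: (b + 2^-1 *: b') - (b' + 2^-1 *: b'') - w *: (b' + 2^-1 *: b'') ->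
  (2 * (w * -1)) *: a - (2 *: b + (1 + w * -1) *: b')
  - 2^-1 *: ((2 * w) *: a' - (2 *: b' + (1 + w) *: b'')) = 0.
Proof.
move=> /matrixP h; apply/matrixP => x y; move: (h x y); rewrite !mxE.
by move/eqP; rewrite -subr_eq0 => /eqP e; rewrite -[RHS]e; field.
Qed.

Section Soundness.
Context (F : numFieldType) (d : nat) (J : eqType).
Local Notation B := 'M[F]_d.
Variables (E : J -> bool -> bool -> B) (c : F) (js : seq J).
Hypotheses (hc : fam_comm E) (hg : forall j, gl2_rel (E j)) (u : uniq js).
Local Notation s := (sser E (Wop c) js).

Lemma sgenp_ext (K : comNzRingType) (E1 E2 : J -> bool -> bool -> 'M[K]_d) c' z i j :
  (forall j a b, E1 j a b = E2 j a b) -> sgenp E1 c' z js i j = sgenp E2 c' z js i j.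
Proof. by move=> h; congr (sgenp _ _ _ _ _ _); do 3!apply/funext => ?; exact: h. Qed.

(** By [quatZ_unshift] the series may be replaced by the polynomial matrix [sgenp], for which the
    relation is the reflection equation over polynomials in two variables, evaluated at these
    variables. *)
Lemma sser_quat i j k l p q :
  quatZ (fun a b => zext (s a b)) (fun a b => zext (s a b)) i j k l p q = 0.
Proof.
apply: (@quatZ_unshift F d (fun r a b => s a b r) 2^-1) => {}p {}q.
pose S := sgenp (polyE E) c%:P 'X js.
have -> : (fun x y r => zext (s x y) r + 2^-1 *: zext (s x y) (r - 1)) =
  (fun a b => zext (mxcoef^~ (S a b))).
  apply/funext => a; apply/funext => b; apply/funext => -[[|r]|r].
  - by rewrite /= mxcoef_sgenp scaler0.
  - have -> : r.+1%:Z - 1 = r by lia.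
    by rewrite /= mxcoef_sgenp.
  - by rewrite /= scaler0 addr0.
apply: quat_coef; move: i j k l; apply/refl_quat.
pose E2 := mapE (@polyC {poly F}) (polyE E).
have -> : (fun a b => inX (S a b)) = sgenp E2 c%:P%:P 'X js.
  apply/funext => a; apply/funext => b; rewrite /inX /S map_sgenp /= map_polyC map_polyX.
  apply: sgenp_ext => j' a' b'; apply/matrixP => x y.
  by rewrite !mxE /= map_polyC.
have -> : (fun a b => inY (S a b)) = sgenp E2 c%:P%:P 'X%:P js.
  by apply/funext => a; apply/funext => b; rewrite /inY /S map_sgenp.
apply: sgenp_refl => //.
  by apply: fam_comm_map; exact: (fam_comm_map (@polyC F)).
by move=> j'; apply: gl2_map; exact: (gl2_map (@polyC F)).
Qed.

Lemma mxcoef_compN r (A : 'M[{poly F}]_d) :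
  mxcoef r (map_mx (fun p : {poly F} => p \Po (- 'X)) A) = (-1) ^+ r *: mxcoef r A.
Proof.
by apply/matrixP => a b; rewrite mxcoefE !mxE /= coef_compN.
Qed.

Lemma sser_symm i j r : (2 * (-1) ^+ r) *: s (~~ j) (~~ i) r =
  2 *: s i j r + (1 + (-1) ^+ r) *: (if r is r'.+1 then s i j r' else 0).
Proof.
have X0 : 'X != 0 :> {poly F} by rewrite polyX_eq0.
have := sgenp_symm c%:P i j X0 (fam_comm_map (@polyC F) hc) (fun j => gl2_map (@polyC F) (hg j)) u.
pose S := sgenp (polyE E) c%:P 'X js.
have SN a b : sgenp (polyE E) c%:P (- 'X) js a b = map_mx (fun p : {poly F} => p \Po (- 'X)) (S a b).
  have := @map_sgenp _ _ (comp_poly (- 'X)) d J (polyE E) c%:P 'X js a b.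
  rewrite /= comp_polyX comp_polyC => ->; apply: sgenp_ext => j' a' b'.
  by apply/matrixP => x y; rewrite !mxE /= comp_polyC.
rewrite !SN -/S => h.
pose D r := (2 * (-1) ^+ r) *: s (~~ j) (~~ i) r -
  (2 *: s i j r + (1 + (-1) ^+ r) *: (if r is r'.+1 then s i j r' else 0)).
suff : D r = 0 by move/eqP; rewrite subr_eq0 => /eqP.
have step n : D n - (if n is n'.+1 then 2^-1 *: D n' else 0) = 0.
  have := congr1 (mxcoef n) h.
  rewrite scalerBl -!(rmorph_nat (@polyC F)) !(mxcoefD, mxcoefN, mxcoefZ, mxcoefX, mxcoef_compN).
  case: n => [|[|n]]; rewrite ?mxcoef_compN !mxcoef_sgenp /D /=.
  - exact: symm_unshift00.
  - rewrite [(-1) ^+ 1](exprSr _ 0); exact: symm_unshift0.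
  - rewrite [(-1) ^+ n.+2](exprSr _ n.+1); exact: symm_unshift.
elim: r => [|r IH]; first by have := step 0; rewrite subr0.
by have := step r.+1; rewrite /= IH scaler0 subr0.
Qed.

Lemma tser0 a b : tser E js a b 0 = ((a == b)%:R)%:M.
Proof.
elim: (js) a b => [|j js' IH] a b //=.
rewrite big_bool !convE !big_ord1 /= !IH ?scalar_mull ?scale_scalar_mx -?raddfD; congr (_%:M).
by case: a; case: b; rewrite /= ?(mulr0, mul0r, mulr1, addr0, add0r).
Qed.

Lemma sser0 i j : s i j 0 = ((i == j)%:R)%:M.
Proof.
rewrite sser_diag; last exact: W_op_offdiag.
rewrite big_bool !convE !big_ord1 /= !convE !big_ord1 /= !tser0 !expr0 !scale1r ?scalar_mull ?scale_scalar_mx -?raddfD.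
rewrite !scalar_mull !scale_scalar_mx -raddfD; congr (_%:M); rewrite /Wser expr0 addr0 !mulr1.
by case: i; case: j; rewrite /= ?(mulr0, mul0r, mulr1, addr0, add0r).
Qed.
End Soundness.

Lemma symm_even_coef (K : numFieldType) d (w : K) (X Y : 'M[K]_d) : w = 1 ->
  (2 * w) *: X = 2 *: X + (1 + w) *: Y -> Y = 0.
Proof.
move=> ->; rewrite mulr1 => h; have : (1 + 1) *: Y = 0.
  by apply: (addrI (2 *: X)); rewrite addr0 -h.
by move/eqP; rewrite scalemx_eq0 (_ : 1 + 1 = 2%:R) // pnatr_eq0 => /eqP.
Qed.

Definition twisted_rep (F : numFieldType) (d : nat) (s : bool -> bool -> nat -> 'M[F]_d) := [/\
  (forall i j, s i j 0 = ((i == j)%:R)%:M),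
  (forall i j k l p q,
    quatZ (fun a b => zext (s a b)) (fun a b => zext (s a b)) i j k l p q = 0) &
  (forall i j r, (2 * (-1) ^+ r) *: s (~~ j) (~~ i) r =
    2 *: s i j r + (1 + (-1) ^+ r) *: (if r is r'.+1 then s i j r' else 0))].

(** * Commutation of the odd coefficients of s_11(u) *)

Section OddCommute.
Context (F : numFieldType) (d : nat) (s : bool -> bool -> nat -> 'M[F]_d).
Hypothesis hs : twisted_rep s.
Local Notation z := (fun a b => zext (s a b)).

(** The pair (a, -a) is fixed by (i, j) -> (-j, -i), so at the even degree r + 1 the symmetry
    relation reduces to 2 s^(r) = 0. *)
Lemma twisted_offdiag_odd a r : odd r -> s a (~~ a) r = 0.
Proof.
case: hs => _ _ hsym ro; have := hsym a (~~ a) r.+1; rewrite negbK.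
by apply: symm_even_coef; rewrite -signr_odd /= ro.
Qed.

(* With c(p, q) = [s_11^(p), s_11^(q)] and
   a(p, q) = s_{1,-1}^(p) s_{-1,1}^(q) - s_{1,-1}^(q) s_{-1,1}^(p), the
   quaternary relation gives c(p+1, q) + c(p, q+1) + a(p, q) = 0, where a(p, q)
   vanishes unless p and q are even; so c(p, q) = c(p-2, q+2) for odd p, q. *)
Lemma s11_odd_comm m l :
  s true true m.*2.+1 *m s true true l.*2.+1 = s true true l.*2.+1 *m s true true m.*2.+1.
Proof.
pose C p q := z true true p * z true true q - z true true q * z true true p.
pose a p q := z true false p * z false true q - z true false q * z false true p.
pose e p q := C (p + 1) q + C p (q + 1) + a p q.
have zneg x y (p : int) : p < 0 -> zext (s x y) p = 0 by case: p.
have Cneg p q : p < 0 -> C p q = 0 by move=> p0; rewrite /C !(zneg _ _ p) // mul0r mulr0 subrr.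
have aneg p q : p < 0 -> a p q = 0 by move=> p0; rewrite /a !(zneg _ _ p) // mul0r mulr0 subrr.
have [_ hq _] := hs.
(* For i = j = k = l = 1 the quaternary relation factors as u - v - 1 times the series with
   coefficients e(p, q). As e vanishes for p = -2, it vanishes for all larger p by induction. *)
have estep p q : e (p + 1) q = e p (q + 1) + e p q.
  have : C (p + 2) q - C p (q + 2) -
    (C (p + 1) q + C p (q + 1) - (a (p + 1) q - a p (q + 1)) + a p q) = 0 := hq true true true true p q.
  rewrite /e; have -> : p + 1 + 1 = p + 2 by lia.
  have -> : q + 1 + 1 = q + 2 by lia.
  move: (C (p + 2) q) (C p (q + 2)) (C (p + 1) q) (C p (q + 1)) (C (p + 1) (q + 1)).
  move: (a _ _) (a _ _) (a _ _) => a1 a2 a3 c1 c2 c3 c4 c5.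
  move=> h; apply/eqP; rewrite -subr_eq0; apply/eqP; rewrite -[RHS]h.
  by apply/matrixP => x y; rewrite !mxE; ring.
have e0 n q : e (n%:Z - 2) q = 0.
  elim: n q => [|n IH] q; first by rewrite /e !Cneg ?aneg ?addr0 //; lia.
  have -> : n.+1%:Z - 2 = n%:Z - 2 + 1 by lia.
  by rewrite estep !IH addr0.
have eq0 (p q : int) : 0 <= p + 2 -> e p q = 0.
  move=> p0; have -> : p = (absz (p + 2))%:Z - 2 by lia.
  exact: e0.
have aodd p q : odd p || odd q -> a p%:Z q%:Z = 0.
  by rewrite /a /= => /orP[] o; rewrite !(twisted_offdiag_odd true o, twisted_offdiag_odd false o)
    ?(mul0r, mulr0) subrr.
suff CO : forall l, C m.*2.+1 l.*2.+1 = 0 by have /eqP := CO l; rewrite subr_eq0 => /eqP.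
elim: m => [|m IH] {}l.
  have := eq0 (-1) l.*2.+2; rewrite /e (_ : -1 + 1 = 0%:Z) //.
  have := eq0 0 l.*2.+1; rewrite /e (_ : 0 + 1 = 1%:Z) // (aodd 0 l.*2.+1) /= ?odd_double //.
  have -> : l.*2.+1%:Z + 1 = l.*2.+2%:Z by lia.
  rewrite addr0 => /(_ isT) h1; rewrite (Cneg (-1)) // aneg // !addr0 => /(_ isT) h2.
  by move: h1; rewrite h2 addr0.
have := eq0 m.*2.+1 l.*2.+2 isT; have := eq0 m.*2.+2 l.*2.+1 isT.
rewrite /e !aodd /= ?odd_double ?orbT // !addr0 doubleS.
have -> : m.*2.+2%:Z + 1 = m.*2.+3 by lia.
have -> : m.*2.+1%:Z + 1 = m.*2.+2 by lia.
have -> : l.*2.+1%:Z + 1 = l.*2.+2 by lia.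
have -> : l.*2.+2%:Z + 1 = l.*2.+3 by lia.
have := IH l.+1; rewrite doubleS => -> h; rewrite addr0 => h2.
by move: h; rewrite h2 addr0.
Qed.
End OddCommute.

(** * Equal expressions in Y^+(2) act equally *)

Section YeqSound.
Context (R : realType) (d : nat) (s : bool -> bool -> nat -> 'M[Cx R]_d).

Lemma Yact_sgen i j p : Yact s (sgen R i j p) = zext (s i j) p.
Proof. by case: p => //= r; rewrite raddf0. Qed.

Lemma YactE x y : (Yact s (x - y)%Y = Yact s x - Yact s y) *
  ((Yact s (x + y)%Y = Yact s x + Yact s y) * (Yact s (x * y)%Y = Yact s x * Yact s y)).
Proof. by split; [rewrite /= mul_scalar_mx scaleN1r|split]. Qed.

Lemma Yact_sound x y : twisted_rep s -> Yeq x y -> Yact s x = Yact s y.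
Proof.
move=> [h0 hq hs]; elim.
- by [].
- by [].
- by move=> ? ? ? _ -> _ ->.
- by move=> ? ? ? ? _ /= -> _ ->.
- by move=> ? ? ? ? _ /= -> _ ->.
- by move=> * /=; rewrite addrA.
- by move=> * /=; rewrite addrC.
- by move=> * /=; rewrite raddf0 add0r.
- by move=> * /=; rewrite mulmxA.
- by move=> * /=; rewrite mulmxDl.
- by move=> * /=; rewrite mulmxDr.
- by move=> * /=; rewrite mul1mx.
- by move=> * /=; rewrite raddf0 mul0mx.
- by move=> * /=; rewrite raddfD.
- by move=> * /=; rewrite scalar_mxM.
- by move=> a z /=; rewrite mul_scalar_mx mul_mx_scalar.
- by move=> i j; exact: h0.
- move=> i j k l p q; have := hq i j k l p q.
  rewrite /Yquat_lhs /Yquat_rhs /Ycomm /Yterm1 /Yterm2 /Yterm3 !YactE !Yact_sgen.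
  by move/eqP; rewrite subr_eq0 => /eqP.
- move=> i j r; rewrite /Ysym_lhs /Ysym_rhs /= !Yact_sgen !mul_scalar_mx hs; congr (_ + _ *: _).
  case: r => [|r] //.
  by have -> : r.+1%:Z - 1 = r by lia.
Qed.
End YeqSound.

(** * A central element *)

HB.instance Definition _ (R : realType) := gen_eqMixin (yexpr R).
HB.instance Definition _ (R : realType) := gen_choiceMixin (yexpr R).

Section QuotientAlgebra.
Local Open Scope quotient_scope.
Context (R : realType).
Local Notation K := (Cx R).

Definition yeqb (x y : yexpr R) : bool := `[< Yeq x y >].

Lemma yeqb_equiv : equiv_class_of yeqb.
Proof.
split.
- by move=> x; apply/asboolP; exact: Yeq_refl.
- by move=> x y; apply/asboolP/asboolP => h; exact: Yeq_sym.
- move=> y x z /asboolP h /asboolP h'; apply/asboolP; exact: Yeq_trans h h'.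
Qed.

Canonical yeq_equiv := EquivRelPack yeqb_equiv.

(** Passing to the quotient makes Y^+(2) an actual ring, in which centrality is proved by rewriting
    instead of by explicit congruences. *)
Definition yalg := {eq_quot yeq_equiv}.
HB.instance Definition _ := Choice.on yalg.

Definition ycl (x : yexpr R) : yalg := \pi x.

Lemma yclP x y : ycl x = ycl y <-> Yeq x y.
Proof. by split=> [/eqmodP/asboolP|h] //; apply/eqmodP/asboolP. Qed.

Lemma Yeq_repr x : Yeq (repr (ycl x)) x.
Proof. by apply/yclP; rewrite /ycl reprK. Qed.

Definition yadd (x y : yalg) : yalg := ycl (repr x + repr y)%Y.
Definition ymul (x y : yalg) : yalg := ycl (repr x * repr y)%Y.
Definition yopp (x : yalg) : yalg := ycl (YCst (-1) * repr x)%Y.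

Lemma yclD x y : ycl (x + y)%Y = yadd (ycl x) (ycl y).
Proof. by apply/yclP/Yeq_sym/Yeq_add; exact: Yeq_repr. Qed.

Lemma yclM x y : ycl (x * y)%Y = ymul (ycl x) (ycl y).
Proof. by apply/yclP/Yeq_sym/Yeq_mul; exact: Yeq_repr. Qed.

Lemma yclN x : ycl (YCst (-1) * x)%Y = yopp (ycl x).
Proof. by apply/yclP/Yeq_sym/Yeq_mul; [exact: Yeq_refl|exact: Yeq_repr]. Qed.

Lemma yalgP (P : yalg -> Prop) : (forall x, P (ycl x)) -> forall x, P x.
Proof. by move=> h x; rewrite -[x]reprK; exact: h. Qed.

Lemma yaddA : associative yadd.
Proof. by do 3!elim/yalgP=> ?; rewrite -!yclD; apply/yclP; exact: Yeq_addA. Qed.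

Lemma yaddC : commutative yadd.
Proof. by do 2!elim/yalgP=> ?; rewrite -!yclD; apply/yclP; exact: Yeq_addC. Qed.

Lemma yadd0 : left_id (ycl (YCst 0)) yadd.
Proof. by elim/yalgP=> ?; rewrite -!yclD; apply/yclP; exact: Yeq_add0. Qed.

Lemma yaddN : left_inverse (ycl (YCst 0)) yopp yadd.
Proof.
elim/yalgP=> x; rewrite -yclN -yclD; apply/yclP.
apply: (Yeq_trans (y := (YCst (-1) * x + YCst 1 * x)%Y)).
  by apply: Yeq_add; [exact: Yeq_refl|exact/Yeq_sym/Yeq_mul1].
apply: Yeq_trans (Yeq_sym (Yeq_mulDl _ _ _)) _.
apply: (Yeq_trans (y := (YCst 0 * x)%Y)); last exact: Yeq_mul0.
apply: Yeq_mul; last exact: Yeq_refl.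
by apply: Yeq_trans (Yeq_sym (Yeq_cstD _ _)) _; rewrite addNr; exact: Yeq_refl.
Qed.

HB.instance Definition _ := GRing.isZmodule.Build yalg yaddA yaddC yadd0 yaddN.

Lemma ymulA : associative ymul.
Proof. by do 3!elim/yalgP=> ?; rewrite -!yclM; apply/yclP; exact: Yeq_mulA. Qed.

Lemma ymul1 : left_id (ycl (YCst 1)) ymul.
Proof. by elim/yalgP=> ?; rewrite -!yclM; apply/yclP; exact: Yeq_mul1. Qed.

Lemma ymulr1 : right_id (ycl (YCst 1)) ymul.
Proof.
elim/yalgP=> ?; rewrite -!yclM; apply/yclP.
by apply: Yeq_trans (Yeq_mul1 _); exact/Yeq_sym/Yeq_cstC.
Qed.

Lemma ymulDl : left_distributive ymul yadd.
Proof. by do 3!elim/yalgP=> ?; rewrite -!(yclM, yclD); apply/yclP; exact: Yeq_mulDl. Qed.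

Lemma ymulDr : right_distributive ymul yadd.
Proof. by do 3!elim/yalgP=> ?; rewrite -!(yclM, yclD); apply/yclP; exact: Yeq_mulDr. Qed.

HB.instance Definition _ :=
  GRing.Zmodule_isPzRing.Build yalg ymulA ymul1 ymulr1 ymulDl ymulDr.

Definition ygen i j p : yalg := ycl (sgen R i j p).

Lemma ycl_sub x y : ycl (x - y)%Y = ycl x - ycl y.
Proof. by rewrite yclD yclN. Qed.

Lemma yalgM x y : ycl (x * y)%Y = ycl x * ycl y.
Proof. exact: yclM. Qed.

Lemma yclE x y : (ycl (x + y)%Y = ycl x + ycl y) * (ycl (x * y)%Y = ycl x * ycl y).
Proof. by split; [exact: yclD|exact: yclM]. Qed.

Lemma ygen_neg i j n : ygen i j (Negz n) = 0.
Proof. by []. Qed.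

Lemma ygen0 i j : ygen i j 0 = (i == j)%:R.
Proof. by rewrite /ygen; transitivity (ycl (YCst (i == j)%:R)); [apply/yclP; exact: Yeq_gen0|case: (i == j)]. Qed.

Lemma ygen1_offdiag i : ygen i (~~ i) 1 = 0.
Proof.
have := Yeq_symm R i (~~ i) 1; rewrite /Ysym_lhs /Ysym_rhs negbK => /yclP.
rewrite !yclE -/(ygen _ _ _) (_ : YCst (1 + (-1) ^+ 1) = YCst 0); last by rewrite expr1 subrr.
have -> : ycl (YCst 0) = 0 by [].
rewrite mul0r addr0 expr1 mulrN1 => h.
(* The symmetry relation gives 2 s = -2 s; scalars act on [yalg] as classes of constants, so 4 is
   inverted as such a class. *)
have : ycl (YCst (2 + 2)) * ygen i (~~ i) 1 = 0.
  have -> : ycl (YCst (2 + 2)) = ycl (YCst 2) - ycl (YCst (- 2)).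
    rewrite -ycl_sub; apply/yclP; apply: Yeq_trans (Yeq_cstD _ _) _.
    apply: Yeq_add; first exact: Yeq_refl.
    by apply: Yeq_trans (Yeq_cstM _ _); rewrite mulN1r opprK; exact: Yeq_refl.
  by rewrite mulrBl h subrr.
move/(congr1 ( *%R (ycl (YCst (2 + 2)^-1)))); rewrite mulr0 mulrA -yalgM => <-.
transitivity (ycl (YCst 1) * ygen i (~~ i) 1); first by rewrite mul1r.
congr (_ * _); apply/yclP; apply: Yeq_trans (Yeq_cstM _ _).
by rewrite mulVf ?gt_eqF ?addr_gt0 //; exact: Yeq_refl.
Qed.

Lemma ygen_quat i j k l p q :
  let C p q := ygen i j p * ygen k l q - ygen k l q * ygen i j p in
  let T1 p q := ygen k j p * ygen i l q - ygen k j q * ygen i l p in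
  let T2 p q := ygen i (~~ k) p * ygen (~~ j) l q - ygen k (~~ i) q * ygen (~~ l) j p in
  let T3 p q := ygen k (~~ i) p * ygen (~~ j) l q - ygen k (~~ i) q * ygen (~~ j) l p in
  C (p + 2) q - C p (q + 2) =
    T1 (p + 1) q + T1 p (q + 1) - (T2 (p + 1) q - T2 p (q + 1)) + T3 p q.
Proof.
have := Yeq_quat R i j k l p q => /yclP.
by rewrite /Yquat_lhs /Yquat_rhs /Ycomm /Yterm1 /Yterm2 /Yterm3 !(ycl_sub, yclE).
Qed.

Local Notation h := (ygen true true 1).

(** Half of the adjoint action of s_11^(1), under which the generators s_kl have weights 0, 2 and
    -2. *)
Definition hcoef (k l : bool) (g : yalg) : yalg :=
  if k == l then 0 else if k then g else - g.

(** At p = -1 every term with a negative index vanishes: on the left s_11^(1) remains, on the right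
    only the scalars s^(0) times generators. In [ycomm2] the choice p = 0 isolates s_11^(2) in the
    same way. *)
Lemma ycomm1 k l q : h * ygen k l q - ygen k l q * h = hcoef k l (ygen k l q) *+ 2.
Proof.
have := ygen_quat true true k l (-1) q; rewrite /= !ygen0 !ygen_neg.
rewrite !(mul0r, mulr0, subr0, addr0, sub0r, oppr0) => ->.
by case: k; case: l; rewrite /hcoef /= ?(mul0r, mulr0, mul1r, mulr1, subrr, subr0, sub0r, oppr0, addr0, opprK, add0r) ?mul0rn // -?opprD mulr2n ?opprD.
Qed.

Lemma ycomm2 k l q : ygen true true 2 * ygen k l q - ygen k l q * ygen true true 2 =
  h * hcoef k l (ygen k l q) + hcoef k l (ygen k l q) * h - hcoef k l (ygen k l q).
Proof.
have := ygen_quat true true k l 0 q; rewrite /= !ygen0 !add0r.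
have c := ycomm1 k l q.
rewrite !(mul1r, mulr1) subrr subr0 => ->.
have o1 := ygen1_offdiag true; have o2 := ygen1_offdiag false; rewrite /= in o1 o2.
case: k l c => [] [] /=; rewrite /hcoef /= ?o1 ?o2 => c; rewrite ?c;
 rewrite ?(mul0r, mulr0, mul1r, mulr1, mul0rn, subrr, subr0, sub0r, oppr0, addr0, opprK, add0r) //.
- by rewrite opprD opprK !addrA addrAC addrK.
- by rewrite mulrN mulNr opprB addrA subrK addrC (addrC (- _)).
Qed.

(** From [x, g] = 2 b follows [x^2, g] = 2 (x b + b x), which cancels the quadratic part of 2
    [a, g]; the summand x cancels the remaining - 2 b. *)
Lemma casimir_comm (A : pzRingType) (a x g b : A) :
  x * g - g * x = b *+ 2 -> a * g - g * a = x * b + b * x - b ->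
  (a + a + x - x * x) * g = g * (a + a + x - x * x).
Proof.
move=> hx ha.
have exg : x * g = g * x + b *+ 2 by rewrite -hx addrC subrK.
have -> : (a + a + x - x * x) * g = (a * g) *+ 2 + x * g - x * (x * g).
  by rewrite mulrBl !mulrDl mulr2n mulrA.
have -> : a * g = g * a + (x * b + b * x - b) by rewrite -ha addrC subrK.
have -> : x * (x * g) = b * x *+ 2 + x * b *+ 2 + g * (x * x).
  by rewrite exg mulrDr mulrA exg mulrDl mulrnAr mulrnAl -mulrA -addrA addrC.
rewrite exg mulrnDl mulrnBl -mulrnDl (addrC (b * x)).
rewrite -[_ + (_ - _) + _]addrA (addrC (g * x)) [_ - _ + _]addrA subrK.
rewrite (addrC _ (g * x)) addrA [_ *+ 2 + g * (x * x)]addrC opprD addrA.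
by rewrite addrAC addrK mulrBr !mulrDr mulr2n.
Qed.

(* Up to normalization, the first nonconstant coefficient of the Sklyanin
   determinant. *)
Definition casimir : yexpr R :=
  (YGen R true true 2 + YGen R true true 2 + YGen R true true 1
   - YGen R true true 1 * YGen R true true 1)%Y.

Lemma casimir_central : Ycentral casimir.
Proof.
have yc x : ycl casimir * ycl x = ycl x * ycl casimir.
  elim: x => [k l r|a|x IHx y IHy|x IHx y IHy].
  - rewrite /casimir ycl_sub !yclE; apply: casimir_comm.
      exact: (ycomm1 k l r).
    exact: (ycomm2 k l r).
  - by rewrite -!yalgM; apply/yclP/Yeq_sym/Yeq_cstC.
  - by rewrite (yclE x y).1 mulrDr mulrDl IHx IHy.
  - by rewrite (yclE x y).2 mulrA IHx -mulrA IHy mulrA.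
by move=> x; apply/yclP; rewrite (yclE _ _).2 yc -yalgM.
Qed.
End QuotientAlgebra.

(** * Simple spectrum and discriminants *)

Section SimpleSpectrum.
Context (K : closedFieldType).

Lemma eigen_horner_mx n (X : 'M[K]_n.+1) (v : 'rV_n.+1) a (p : {poly K}) :
  v *m X = a *: v -> v *m horner_mx X p = p.[a] *: v.
Proof.
move=> va; elim/poly_ind: p => [|p c IH]; first by rewrite rmorph0 mulmx0 horner0 scale0r.
rewrite rmorphD rmorphM /= horner_mx_X horner_mx_C mulmxDr mul_mx_scalar mulmxA IH.
by rewrite -scalemxAl va scalerA hornerD hornerM hornerX hornerC scalerDl.
Qed.

(* Up to sign, the discriminant of the characteristic polynomial of X. *)
Definition disc_mx (L : comNzRingType) n (X : 'M[L]_n.+1) : L :=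
  \det (horner_mx X (char_poly X)^`()).

(** An eigenvector for a multiple root a of the characteristic polynomial p is killed by p'(X),
    whose determinant is then 0. *)
Lemma disc_separable n (X : 'M[K]_n.+1) :
  disc_mx X != 0 -> separable_poly (char_poly X).
Proof.
move=> dX; apply: contraNT dX; rewrite unlock => /closed_rootP[a]; rewrite root_gcd => /andP[ra ra'].
move: ra; rewrite -eigenvalue_root_char => /eigenvalueP[v va v0].
apply/det0P; exists v => //; rewrite (eigen_horner_mx _ va).
by move/rootP: ra' => ->; rewrite scale0r.
Qed.

Lemma disc_diag n (X : 'M[K]_n.+1) : disc_mx X != 0 ->
  exists (P : 'M[K]_n.+1) (mu : 'rV_n.+1),
    [/\ P \in unitmx, X *m P = P *m diag_mx mu & injective (mu 0)].
Proof.
move=> /disc_separable sX; have [r rE] := closed_field_poly_normal (char_poly X).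
move: rE; rewrite (monicP (char_poly_monic _)) scale1r => rE.
have ur : uniq r by rewrite -separable_prod_XsubC -rE.
have : diagonalizable X.
  by apply/diagonalizableP; exists r => //; rewrite -rE mxminpoly_dvd_char.
case=> P Pu /diagonalizable_forPex[mu /(simmxP Pu) e].
(* Diagonalizability is phrased with row eigenvectors; the inverse matrix has the column
   eigenvectors. *)
exists (invmx P), mu; split; first by rewrite unitmx_inv.
  by apply: (can_inj (mulKmx Pu)); rewrite mulmxA e -mulmxA mulmxV // mulmx1 mulKVmx.
have sr : size r = n.+1.
  by have := size_char_poly X; rewrite rE size_prod_XsubC => -[].
(* All n + 1 distinct roots occur among the n + 1 entries of mu, so these entries cannot repeat. *)
have sub : {subset r <= [seq mu 0 i | i <- enum 'I_n.+1]}.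
  move=> a ar; have : root (char_poly X) a by rewrite rE root_prod_XsubC.
  rewrite -eigenvalue_root_char => /eigenvalueP[v va v0].
  have [y vy] : exists y, v = y *m P by exists (v *m invmx P); rewrite mulmxKV.
  have y0 : y != 0 by apply: contraNneq v0 => y0; rewrite vy y0 mul0mx.
  have /rV0Pn[q yq] := y0; apply/mapP; exists q; first by rewrite mem_enum.
  have : y *m diag_mx mu = a *: y.
    apply: (can_inj (mulmxK Pu)); rewrite -mulmxA -e mulmxA -vy va vy.
    by rewrite scalemxAl.
  by move/matrixP/(_ 0 q); rewrite mul_mx_diag !mxE mulrC => h; apply: (mulIf yq); rewrite h.
have := leq_size_uniq ur sub; rewrite size_map size_enum_ord sr leqnn => /(_ isT) um.
exact/injectiveP.
Qed.

Lemma eigen_coord n (X P : 'M[K]_n) (mu : 'rV_n) a (w : 'cV_n) : P \in unitmx ->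
  X *m P = P *m diag_mx mu -> w != 0 -> X *m w = a *: w -> injective (mu 0) ->
  exists q c, a = mu 0 q /\ w = c *: col q P.
Proof.
move=> Pu XP w0 Xw mi; have [y wy] : exists y, w = P *m y by exists (invmx P *m w); rewrite mulKVmx.
have y0 : y != 0 by apply: contraNneq w0 => y0; rewrite wy y0 mulmx0.
have Dy i : mu 0 i * y i 0 = a * y i 0.
  have : P *m (diag_mx mu *m y) = P *m (a *: y).
    by rewrite mulmxA -XP -mulmxA -wy Xw wy scalemxAr.
  by move/(can_inj (mulKmx Pu))/matrixP/(_ i 0); rewrite mul_diag_mx !mxE.
have [q yq] : exists q, y q 0 != 0.
  by case/cV0Pn: y0 => q; exists q.
have aq : a = mu 0 q by apply: (mulIf yq); rewrite Dy.
exists q, (y q 0); split=> //; rewrite wy; apply/colP => i; rewrite !mxE (bigD1 q) //= big1.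
  by rewrite addr0 mulrC.
move=> k kq; suff -> : y k 0 = 0 by rewrite mulr0.
apply/eqP; apply: contraNT kq => yk; apply/eqP/mi; rewrite -aq.
by apply: (mulIf yk); rewrite Dy.
Qed.

Lemma eigen_col n (X P : 'M[K]_n) (mu : 'rV_n) q :
  X *m P = P *m diag_mx mu -> X *m col q P = mu 0 q *: col q P.
Proof.
move=> XP; rewrite !colE mulmxA XP -mulmxA scalemxAr; congr (_ *m _).
by apply/colP => i; rewrite mul_diag_mx !mxE; case: eqP => [->|]; rewrite ?mulr0.
Qed.

Lemma commuting_eigen n (X P Y : 'M[K]_n) (mu : 'rV_n) q : P \in unitmx ->
  X *m P = P *m diag_mx mu -> injective (mu 0) -> Y *m X = X *m Y ->
  exists a, Y *m col q P = a *: col q P.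
Proof.
move=> Pu XP mi YX.
have Xq := eigen_col q XP.
have [->|Y0] := eqVneq (Y *m col q P) 0; first by exists 0; rewrite scale0r.
have XY : X *m (Y *m col q P) = mu 0 q *: (Y *m col q P).
  by rewrite mulmxA -YX -mulmxA Xq scalemxAr.
have [q' [c [/mi -> ->]]] := eigen_coord Pu XP Y0 XY mi.
by exists c.
Qed.

Lemma disc_poly_eval n (X : 'M[{poly K}]_n.+1) e :
  (disc_mx X).[e] = disc_mx (map_mx (horner_eval e) X).
Proof.
rewrite /disc_mx -/(horner_eval e _) -det_map_mx map_horner_mx -deriv_map.
by rewrite map_char_poly.
Qed.

Lemma disc_poly_diag n (X : 'M[{poly K}]_n.+1) (d : 'rV_n.+1) :
  map_mx (horner_eval 0) X = diag_mx d -> injective (d 0) -> (disc_mx X).[0] != 0.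
Proof.
move=> X0 di; rewrite disc_poly_eval X0 /disc_mx horner_mx_diag det_diag.
have -> : char_poly (diag_mx d) = \prod_(a <- [seq d 0 i | i <- enum 'I_n.+1]) ('X - a%:P).
  rewrite char_poly_trig ?diag_mx_is_trig // big_map enumT.
  by apply: eq_bigr => i _; rewrite mxE eqxx.
apply/prodf_neq0 => i _; rewrite mxE.
have : separable_poly (\prod_(a <- [seq d 0 i | i <- enum 'I_n.+1]) ('X - a%:P)).
  by rewrite separable_prod_XsubC map_inj_uniq // enum_uniq.
rewrite unlock => /coprimep_root; apply; rewrite ?root_prod_XsubC.
by apply: map_f; rewrite mem_enum.
Qed.
End SimpleSpectrum.

(** * Eigenvectors near a diagonal matrix *)

Section Perturbation.
Context (K : numFieldType) (n : nat).
Implicit Types (M P : 'M[K]_n) (d mu : 'rV[K]_n).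

Lemma exists_norm_max (v : 'I_n -> K) (i0 : 'I_n) : exists i, forall j, `|v j| <= `|v i|.
Proof.
suff [i ih] : exists i, {in i0 :: enum 'I_n, forall j, `|v j| <= `|v i|}.
  by exists i => j; apply: ih; rewrite inE mem_enum orbT.
elim: (enum 'I_n) => [|a s [i ih]]; first by exists i0 => j; rewrite inE => /eqP->.
have [h|h] := real_leP (normr_real (v a)) (normr_real (v i)).
  exists i => j; rewrite !inE => /or3P[/eqP->|/eqP-> //|js]; apply: ih; rewrite inE ?eqxx //.
  by rewrite js orbT.
exists a => j; rewrite !inE => /or3P[/eqP->|/eqP-> //|js]; apply: le_trans (ltW h);
  by apply: ih; rewrite inE ?eqxx ?js ?orbT.
Qed.

Lemma row_sum_bound (E : 'I_n -> K) (w : 'I_n -> K) (k N : K) :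
  (forall j, `|E j| <= k) -> (forall j, `|w j| <= N) ->
  `|\sum_j E j * w j| <= n%:R * k * N.
Proof.
move=> hE hw; apply: le_trans (ler_norm_sum _ _ _) _.
apply: (@le_trans _ _ (\sum_(j < n) k * N)).
  by apply: ler_sum => j _; rewrite normrM ler_pM.
by rewrite sumr_const card_ord -mulrA mulr_natl.
Qed.

Context (M P : 'M[K]_n) (mu d : 'rV[K]_n) (g k : K).
Hypotheses (Pu : P \in unitmx) (MP : M *m P = P *m diag_mx mu) (mi : injective (mu 0)).
Hypotheses (gap : forall i j, i != j -> g <= `|d 0 i - d 0 j|) (g0 : 0 < g).
(** The constant 4 comes from [tau_inj]: two eigenvectors with the same dominant coordinate would
    force g / 2 <= 2 n k. *)
Hypotheses (close : forall i j, `|M i j - d 0 i *+ (i == j)| <= k) (kg : 4 * (n%:R * k) < g).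
Variable (tau : 'I_n -> 'I_n).
Hypothesis tau_max : forall q i, `|P i q| <= `|P (tau q) q|.

Lemma close_row i (w : 'I_n -> K) :
  \sum_j M i j * w j = d 0 i * w i + \sum_j (M i j - d 0 i *+ (i == j)) * w j.
Proof.
under [in RHS]eq_bigr do rewrite mulrBl.
rewrite sumrB (bigD1 i (F := fun j => d 0 i *+ (i == j) * w j)) //= [X in _ - (_ + X)]big1 => [|j ji].
  by rewrite eqxx mulr1n addr0 addrCA subrr addr0.
by rewrite eq_sym (negPf ji) mulr0n mul0r.
Qed.

Lemma eigen_entry q i : \sum_j M i j * P j q = mu 0 q * P i q.
Proof.
have /matrixP/(_ i q) := MP; rewrite mul_mx_diag !mxE => ->.
by rewrite mulrC.
Qed.

Lemma tau_neq0 q : P (tau q) q != 0.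
Proof.
apply/eqP => P0; have : P *m delta_mx q 0 = 0 :> 'cV_n.
  apply/colP => i; rewrite -colE !mxE; apply/eqP; rewrite -normr_le0.
  by apply: le_trans (tau_max q i) _; rewrite P0 normr0.
move/(canRL (mulKmx Pu)); rewrite mulmx0 => /colP/(_ q)/eqP.
by rewrite !mxE !eqxx oner_eq0.
Qed.

(** Gershgorin's argument: row i of the eigenvalue equation expresses (mu_q - d_i) P_iq through the
    entries of M - diag d, and every coordinate is bounded by the dominant one. *)
Lemma eigen_bound q i : `|mu 0 q - d 0 i| * `|P i q| <= n%:R * k * `|P (tau q) q|.
Proof.
rewrite -normrM mulrBl -eigen_entry close_row addrC addKr.
by apply: row_sum_bound.
Qed.

Lemma eigen_near q : `|mu 0 q - d 0 (tau q)| <= n%:R * k.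
Proof. by have := eigen_bound q (tau q); rewrite ler_pM2r // normr_gt0 tau_neq0. Qed.

Lemma eigen_far q i : i != tau q -> g / 2 <= `|mu 0 q - d 0 i|.
Proof.
move=> iq; have h1 := gap iq; have h2 := eigen_near q.
have h3 : `|d 0 i - d 0 (tau q)| <= `|mu 0 q - d 0 i| + `|mu 0 q - d 0 (tau q)|.
  rewrite -[X in X <= _]normrN -(normrN (mu 0 q - d 0 i)).
  rewrite (_ : - (_ - _) = - (mu 0 q - d 0 (tau q)) + (mu 0 q - d 0 i)); last by ring.
  by rewrite addrC [X in _ <= X]addrC; apply: le_trans (ler_normD _ _) _; rewrite !normrN addrC.
have nk0 : 0 <= n%:R * k := le_trans (normr_ge0 _) h2.
rewrite -(lerD2r (n%:R * k)); apply: le_trans (le_trans h1 (le_trans h3 _)); last by rewrite lerD2l.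
have e : g / 2 + g / 2 = g by field.
rewrite -[X in _ <= X]e lerD2l ler_pdivlMr // mulrC; apply: le_trans (ltW kg).
by rewrite ler_wpM2r // ler_nat.
Qed.

Lemma eigenvector_bound q i : i != tau q -> `|P i q| <= 2 * (n%:R * k) / g * `|P (tau q) q|.
Proof.
move=> iq; have := eigen_bound q i; have h := eigen_far iq => h1.
have : g / 2 * `|P i q| <= n%:R * k * `|P (tau q) q|.
  by apply: le_trans h1; rewrite ler_wpM2r.
rewrite mulrAC ler_pdivrMr // mulrC -ler_pdivlMr // => /le_trans; apply.
by rewrite (_ : _ / g = 2 * (n%:R * k) / g * `|P (tau q) q|) //; ring.
Qed.

(* Two eigenvectors with the same dominant coordinate b, normalized to 1 there,
   have a difference w with w_b = 0; comparing M w with mu w at b and at the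
   largest entry of w forces w = 0. *)
Lemma tau_inj : injective tau.
Proof.
move=> q q' tq; apply/mi.
set b := tau q in tq; pose w j := P j q / P b q - P j q' / P b q'.
have Pb : P b q != 0 := tau_neq0 q.
have Pb' : P b q' != 0 by rewrite tq tau_neq0.
have Mw i : \sum_j M i j * w j = mu 0 q * w i + (mu 0 q - mu 0 q') * (P i q' / P b q').
  transitivity ((\sum_j M i j * P j q) / P b q - (\sum_j M i j * P j q') / P b q').
    by rewrite !mulr_suml -sumrB; apply: eq_bigr => j _; rewrite /w; ring.
  by rewrite !eigen_entry /w; field; rewrite Pb Pb'.
have wb : w b = 0 by rewrite /w !divff // subrr.
have [i wi] := exists_norm_max w b.
have nk0 : 0 <= n%:R * k := le_trans (normr_ge0 _) (eigen_near q).
have db : `|mu 0 q - mu 0 q'| <= n%:R * k * `|w i|.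
  have := Mw b; rewrite close_row wb !mulr0 !add0r divff // mulr1 => <-.
  exact: row_sum_bound.
have [wi0|wi0] := eqVneq (w i) 0.
  by apply/eqP; rewrite -subr_eq0 -normr_le0; apply: le_trans db _; rewrite wi0 normr0 mulr0.
have ib : i != tau q by apply: contraNneq wi0 => ->; rewrite -/b wb.
have v'1 : `|P i q' / P b q'| <= 1.
  by rewrite normrM normfV ler_pdivrMr ?normr_gt0 // mul1r tq tau_max.
have : `|mu 0 q - d 0 i| * `|w i| <= 2 * (n%:R * k) * `|w i|.
  rewrite -normrM (_ : (mu 0 q - d 0 i) * w i = (\sum_j (M i j - d 0 i *+ (i == j)) * w j)
     - (mu 0 q - mu 0 q') * (P i q' / P b q')).
    apply: le_trans (ler_normB _ _) _; rewrite -mulrA mulr_natl mulr2n; apply: lerD.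
      exact: row_sum_bound.
    by rewrite normrM; apply: le_trans db; rewrite ler_piMr.
  have -> : \sum_j (M i j - d 0 i *+ (i == j)) * w j =
      mu 0 q * w i + (mu 0 q - mu 0 q') * (P i q' / P b q') - d 0 i * w i.
    by rewrite -Mw close_row addrC addKr.
  by ring.
rewrite ler_pM2r ?normr_gt0 // => h; have := le_trans (eigen_far ib) h.
rewrite ler_pdivrMr // => h'.
have : 2 * (n%:R * k) * 2 < g by apply: le_lt_trans kg; rewrite mulrAC -natrM.
by move/lt_le_trans => /(_ _ h'); rewrite ltxx.
Qed.
End Perturbation.

(** * Operators on tensor products and direct sums *)

Section OperatorCoefficients.
Context (R : realType) (I : finType).
Implicit Types X Y : op R I.

Lemma coef_op_of (K : I -> I -> Cx R) p q : coef (op_of K) p q = K p q.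
Proof. by rewrite /coef mxE !enum_rankK. Qed.

Lemma opP X Y : (forall p q, coef X p q = coef Y p q) -> X = Y.
Proof.
move=> h; apply/matrixP => a b; have := h (enum_val a) (enum_val b).
by rewrite /coef !enum_valK.
Qed.

Lemma coefM_op X Y p q : coef (X *m Y) p q = \sum_r coef X p r * coef Y r q.
Proof.
rewrite /coef mxE (reindex enum_rank) //.
by apply: onW_bij; exact: enum_rank_bij.
Qed.

Lemma coef_scalar (a : Cx R) (p q : I) : coef (a%:M : op R I) p q = a *+ (p == q).
Proof. by rewrite /coef mxE (inj_eq enum_rank_inj). Qed.

Lemma coefD_op X Y p q : coef (X + Y) p q = coef X p q + coef Y p q.
Proof. by rewrite /coef mxE. Qed.

Lemma coefN_op X p q : coef (- X) p q = - coef X p q.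
Proof. by rewrite /coef mxE. Qed.

Lemma coefZ_op (a : Cx R) X p q : coef (a *: X) p q = a * coef X p q.
Proof. by rewrite /coef mxE. Qed.

Lemma coef0_op (p q : I) : coef (0 : op R I) p q = 0.
Proof. by rewrite /coef mxE. Qed.

End OperatorCoefficients.

Section AtFactor.
Context (R : realType) (J : finType) (I_ : J -> finType).
Local Notation T := {dffun forall l, I_ l}.
Implicit Types (f g h : T) (j : J).

Definition agree_off j f g := [forall l, (l != j) ==> (f l == g l)].

Lemma agree_offP j f g : reflect (forall l, l != j -> f l = g l) (agree_off j f g).
Proof.
apply: (iffP forallP) => h l; first by move=> lj; apply/eqP; exact: (implyP (h l)).
by apply/implyP => /h ->.
Qed.

Definition upd f j (x : I_ j) : T := finfun (@eqtype.dfwith J (fun l => I_ l) f j x).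
Arguments upd f {j} x.

Lemma upd_same f j (x : I_ j) : upd f x j = x.
Proof. by rewrite ffunE eqtype.dfwith_in. Qed.

Lemma upd_other f j l (x : I_ j) : l != j -> upd f x l = f l.
Proof. by rewrite ffunE eq_sym => lj; rewrite dfwith_out. Qed.

Lemma coef_at_factor j (X : op R (I_ j)) f g :
  coef (at_factor X) f g = if agree_off j f g then coef X (f j) (g j) else 0.
Proof. exact: coef_op_of. Qed.

Lemma agree_upd j f g (x : I_ j) : agree_off j (upd f x) g = agree_off j f g.
Proof. by apply/agree_offP/agree_offP => h l lj; rewrite -h // upd_other. Qed.

Lemma agree_sym j f g : agree_off j f g = agree_off j g f.
Proof. by apply/agree_offP/agree_offP => h l lj; rewrite h. Qed.

Lemma agree_eq j f h : agree_off j f h -> h = upd f (h j).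
Proof.
move=> /agree_offP e; apply/ffunP => l.
by have [->|lj] := eqVneq l j; rewrite ?upd_same // upd_other // e.
Qed.

Lemma sum_agree j f (G : T -> Cx R) :
  \sum_(h | agree_off j f h) G h = \sum_(x : I_ j) G (upd f x).
Proof.
rewrite (reindex_onto (fun x : I_ j => upd f x) (fun h => h j)) => [|h]; last by move/agree_eq.
apply: eq_bigl => x; rewrite upd_same eqxx andbT agree_sym agree_upd.
by apply/agree_offP.
Qed.

Lemma at_factorM j (X Y : op R (I_ j)) : at_factor (X *m Y) = at_factor X *m at_factor Y.
Proof.
apply/opP => f g; rewrite coef_at_factor !coefM_op.
transitivity (\sum_(h | agree_off j f h) coef X (f j) (h j) * coef (at_factor Y) h g).
  rewrite sum_agree; under [RHS]eq_bigr do rewrite upd_same coef_at_factor agree_upd upd_same.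
  by case: ifP => // _; rewrite big1 // => x _; rewrite mulr0.
rewrite [RHS](bigID (agree_off j f)) /= [X in _ + X]big1 ?addr0 => [|h /negPf fh].
  by apply: eq_bigr => h fh; rewrite (coef_at_factor X) fh.
by rewrite (coef_at_factor X) fh mul0r.
Qed.

Lemma at_factorD j (X Y : op R (I_ j)) : at_factor (X + Y) = at_factor X + at_factor Y.
Proof.
apply/opP => f g; rewrite coefD_op !coef_at_factor coefD_op.
by case: ifP => //; rewrite addr0.
Qed.

Lemma at_factorN j (X : op R (I_ j)) : at_factor (- X) = - at_factor X.
Proof.
apply/opP => f g; rewrite coefN_op !coef_at_factor coefN_op.
by case: ifP => //; rewrite oppr0.
Qed.

Lemma at_factorZ j a (X : op R (I_ j)) : at_factor (a *: X) = a *: at_factor X.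
Proof.
apply/opP => f g; rewrite coefZ_op !coef_at_factor coefZ_op.
by case: ifP => //; rewrite mulr0.
Qed.

Lemma at_factor_scalar j a : at_factor (a%:M : op R (I_ j)) = a%:M.
Proof.
apply/opP => f g; rewrite coef_at_factor !coef_scalar.
have [->|fg] := eqVneq f g; first by rewrite eqxx; case: agree_offP => // -[].
case: ifP => // /agree_eq gE; case: eqP => // fgj.
by case/eqP: fg; rewrite gE -fgj; apply/ffunP => l;
  have [->|lj] := eqVneq l j; rewrite ?upd_same ?upd_other.
Qed.

(** Only one intermediate index contributes, namely f with its coordinate j replaced by that of g.
    The resulting formula is symmetric in the two factors, which gives [at_factorC]. *)
Lemma coef_at_factor2 j j' (X : op R (I_ j)) (Y : op R (I_ j')) f g : j != j' ->
  coef (at_factor X *m at_factor Y) f g =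
  if [forall l, (l != j) ==> ((l != j') ==> (f l == g l))]
  then coef X (f j) (g j) * coef Y (f j') (g j') else 0.
Proof.
move=> jj'; have j'j : j' != j by rewrite eq_sym.
rewrite coefM_op (bigD1 (upd f (g j))) //= [X in _ + X]big1 ?addr0 => [|h hne].
  rewrite !coef_at_factor agree_sym agree_upd !upd_same upd_other //.
  have -> : agree_off j f f by apply/agree_offP.
  have -> : agree_off j' (upd f (g j)) g =
      [forall l, (l != j) ==> ((l != j') ==> (f l == g l))].
    apply/agree_offP/forallP => h l.
      by apply/implyP => lj; apply/implyP => lj'; rewrite -h // upd_other.
    move=> lj'; have [->|lj] := eqVneq l j; first by rewrite upd_same.
    by rewrite upd_other //; apply/eqP; exact: (implyP (implyP (h l) lj)).
  by case: ifP => // _; rewrite mulr0.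
rewrite !coef_at_factor; case: ifP; last by rewrite mul0r.
move=> /agree_eq hE; case: agree_offP; last by rewrite mulr0.
by move=> /(_ j jj') hg; case/eqP: hne; rewrite hE hg.
Qed.

Lemma at_factorC j j' (X : op R (I_ j)) (Y : op R (I_ j')) : j != j' ->
  at_factor X *m at_factor Y = at_factor Y *m at_factor X.
Proof.
move=> jj'; apply/opP => f g; rewrite !coef_at_factor2 // 1?eq_sym // mulrC.
congr (if _ then _ else _); apply/forallP/forallP => h l;
by apply/implyP => a; apply/implyP => b; exact: (implyP (implyP (h l) b) a).
Qed.
End AtFactor.

Section DirectSumAlgebra.
Context (R : realType) (J : finType) (I_ : J -> finType).

Lemma coef_direct_sum (X : forall j, op R (I_ j)) x y : coef (direct_sum X) x y =
  if tag x == tag y then coef (X (tag x)) (tagged x) (tagged_as x y) else 0.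
Proof. exact: coef_op_of. Qed.

Lemma direct_sumM (X Y : forall j, op R (I_ j)) :
  direct_sum X *m direct_sum Y = direct_sum (fun j => X j *m Y j).
Proof.
apply/opP => -[c x] [c' y]; rewrite coefM_op coef_direct_sum /=.
transitivity (\sum_(z : I_ c) coef (X c) x z * coef (direct_sum Y) (Tagged I_ z) (Tagged I_ y)).
  rewrite (partition_big (fun z : {j & I_ j} => tag z) predT) //= (bigD1 c) //=.
  rewrite [X in _ + X]big1 ?addr0 => [|j jc].
    rewrite (reindex_onto (fun z : I_ c => Tagged I_ z) (fun w => tagged_as (Tagged I_ x) w)) /=.
      apply: eq_big => [z|z _]; first by rewrite tagged_asE !eqxx.
      by rewrite coef_direct_sum /= eqxx tagged_asE.
    by move=> [j w] /= /eqP jc; rewrite /= in w *; subst j; rewrite tagged_asE.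
  apply: big1 => w /eqP wj; rewrite coef_direct_sum; case: ifP => [/eqP cw|_]; last by rewrite mul0r.
  by case/eqP: jc; rewrite -wj -cw.
under eq_bigr do rewrite coef_direct_sum /=.
case: eqVneq => [cc'|_]; last by rewrite big1 // => z _; rewrite mulr0.
by subst c'; rewrite coefM_op; apply: eq_bigr => z _; rewrite !tagged_asE.
Qed.

Lemma direct_sumZ a (X : forall j, op R (I_ j)) :
  direct_sum (fun j => a *: X j) = a *: direct_sum X.
Proof.
apply/opP => x y; rewrite coefZ_op !coef_direct_sum coefZ_op.
by case: ifP => //; rewrite mulr0.
Qed.
End DirectSumAlgebra.

(** * Evaluation modules *)

Section Gl2Kernel.
Context (K : comNzRingType) (m : nat) (alpha : K).
Implicit Types p q r : 'I_m.+1.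

Definition gl2k (a b : bool) p q : K :=
  match a, b with
  | false, false => if p == q then alpha - q%:R else 0
  | true, true => if p == q then alpha - m%:R + q%:R else 0
  | true, false => if p == q.+1 :> nat then 1 else 0
  | false, true => if q == p.+1 :> nat then (q * (m.+1 - q))%:R else 0
  end.

Definition gl2d (a : bool) p : K := if a then alpha - m%:R + p%:R else alpha - p%:R.

Lemma gl2k_diag a p q : gl2k a a p q = if p == q then gl2d a p else 0.
Proof. by case: a; rewrite /gl2k /gl2d; case: eqP => // ->. Qed.

Lemma sum_diagl a (f : 'I_m.+1 -> K) p : \sum_r gl2k a a p r * f r = gl2d a p * f p.
Proof.
rewrite (bigD1 p) //= gl2k_diag eqxx big1 ?addr0 // => r /negPf rp.
by rewrite gl2k_diag eq_sym rp mul0r.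
Qed.

Lemma sum_diagr a (f : 'I_m.+1 -> K) q : \sum_r f r * gl2k a a r q = f q * gl2d a q.
Proof.
rewrite (bigD1 q) //= gl2k_diag eqxx big1 ?addr0 // => r /negPf rp.
by rewrite gl2k_diag rp mulr0.
Qed.

Lemma sum_LU p q : \sum_r gl2k true false p r * gl2k false true r q =
  if p == q then (p * (m.+1 - p))%:R else 0.
Proof.
case: (posnP p) => p0.
  rewrite big1 => [|r _]; first by rewrite p0 mul0n if_same.
  by rewrite /= p0 mul0r.
have lt : (p.-1 < m.+1)%N by have := ltn_ord p; lia.
rewrite (bigD1 (Ordinal lt)) //= big1 ?addr0 => [|r rp].
  rewrite prednK // eqxx mul1r -val_eqE /= eq_sym.
  by case: (eqVneq (nat_of_ord p) q) => [<-|].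
case: eqP => e; last by rewrite mul0r.
by case/eqP: rp; apply/val_inj => /=; rewrite e.
Qed.

Lemma sum_UL p q : \sum_r gl2k false true p r * gl2k true false r q =
  if p == q then (p.+1 * (m - p))%:R else 0.
Proof.
case: (ltnP p m) => pm; last first.
  rewrite big1 => [|r _].
    by case: eqP => // _; rewrite (_ : m - p = 0)%N ?muln0 //; lia.
  by rewrite /=; case: eqP => e; rewrite ?mul0r //; have := ltn_ord r; lia.
have lt : (p.+1 < m.+1)%N by [].
rewrite (bigD1 (Ordinal lt)) //= big1 ?addr0 => [|r rp].
  by rewrite eqxx eqSS subSS -val_eqE /=; case: eqP; rewrite ?mulr1 ?mulr0.
case: eqP => e; last by rewrite mul0r.
by case/eqP: rp; apply/val_inj.
Qed.

Lemma gl2k_shift_diff a i j p q : i != j ->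
  (gl2d a p - gl2d a q) * gl2k i j p q = gl2k i j p q *+ (a == i) - gl2k i j p q *+ (a == j).
Proof.
case: i j => [] [] // _ /=; case: eqP => e; rewrite ?mulr0 ?mul0rn ?subrr //.
  by rewrite /gl2d e -natr1; case: a => /=; ring.
by rewrite /gl2d e -(natr1 p); case: a => /=; ring.
Qed.

(** Off-diagonal generators shift the diagonal eigenvalues by one, which settles every case with a
    diagonal generator. Two opposite off-diagonal ones come down to (q + 1)(m - q) - q (m + 1 - q) =
    m - 2 q. *)
Lemma gl2k_comm i j k l p q :
  \sum_r gl2k i j p r * gl2k k l r q - \sum_r gl2k k l p r * gl2k i j r q =
  gl2k i l p q *+ (j == k) - gl2k k j p q *+ (i == l).
Proof.
have [<-|ij] := eqVneq i j.
  rewrite sum_diagl sum_diagr mulrC -mulrBr.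
  have [<-|kl] := eqVneq k l.
    have -> : gl2k k k p q * (gl2d i p - gl2d i q) = 0.
      by rewrite gl2k_diag; case: eqP => [->|_]; rewrite ?subrr ?mulr0 ?mul0r.
    by case: (i); case: (k); rewrite ?mulr0n ?subrr.
  rewrite mulrC gl2k_shift_diff //.
  by case: (i); case: (k); case: (l).
have [<-|kl] := eqVneq k l.
  rewrite sum_diagl sum_diagr mulrC -mulrBl -opprB mulNr gl2k_shift_diff // opprB.
  by case: (i); case: (k); case: (j).
have -> : j = ~~ i by case: i j ij => [] [].
have -> : l = ~~ k by case: k l kl => [] [].
move: ij kl => _ _; case: i; case: k; rewrite /= ?subrr //.
  rewrite sum_LU sum_UL /=; case: eqP => [->|_]; rewrite ?mulr1n ?subrr //.
  have := ltn_ord q; rewrite ltnS => qm.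
  rewrite (natrM _ q) (natrM _ q.+1) subSn // -!natr1 !natrB //; ring.
rewrite sum_LU sum_UL /=; case: eqP => [->|_]; rewrite ?mulr1n ?subrr //.
have := ltn_ord q; rewrite ltnS => qm.
rewrite (natrM _ q) (natrM _ q.+1) subSn // -!natr1 !natrB //; ring.
Qed.
End Gl2Kernel.

Section EvaluationRep.
Context (R : realType) (N : nat) (m : 'I_N -> nat) (alpha : 'I_N -> Cx R) (delta : Cx R).

Definition E_at (j : 'I_N) (a b : bool) : op R (tensor_basis m) :=
  at_factor (I_ := fun j : 'I_N => 'I_(m j).+1 : finType) (gl2_op (m j) (alpha j) a b).

Lemma coef_gl2_op n (a : Cx R) i j p q : coef (gl2_op n a i j) p q = gl2k a i j p q.
Proof. exact: coef_op_of. Qed.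

Lemma gl2_opP n (a : Cx R) : gl2_rel (gl2_op n a).
Proof.
move=> i j k l; apply/opP => p q.
rewrite coefD_op coefN_op !coefM_op coefD_op coefN_op.
have cMn (b : bool) X : coef (X *+ b : op R 'I_n.+1) p q = coef X p q *+ b.
  by case: b; rewrite ?mulr1n // !mulr0n coef0_op.
under eq_bigr do rewrite !coef_gl2_op.
under [X in _ - X]eq_bigr do rewrite !coef_gl2_op.
by rewrite !cMn !coef_gl2_op gl2k_comm.
Qed.

Lemma E_at_gl2 j : gl2_rel (E_at j).
Proof.
move=> a b k l; rewrite /E_at -!mulmxE -!at_factorM -at_factorN -at_factorD !mulmxE gl2_opP.
rewrite at_factorD at_factorN; congr (_ - _).
  by case: (b == k); rewrite ?mulr1n // !mulr0n -[0 in LHS](scale0r 0) at_factorZ scale0r.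
by case: (a == l); rewrite ?mulr1n // !mulr0n -[0 in LHS](scale0r 0) at_factorZ scale0r.
Qed.

Lemma E_at_comm : fam_comm E_at.
Proof. by move=> i j a b c e ij; exact: at_factorC. Qed.

Lemma t_tensorE js a b r : t_tensor m alpha js a b r = tser E_at js a b r.
Proof.
elim: js a b r => [|j js IH] a b r //=; apply: eq_bigr => c _.
by apply: eq_bigr => i _; rewrite IH; case: (nat_of_ord i) => [|[|k]].
Qed.

Lemma W_opE a b r : W_op delta a b r = Wop delta a b r.
Proof. by case: a; case: b. Qed.

Lemma s_opE : s_op m alpha delta = sser E_at (Wop delta) (enum 'I_N).
Proof.
apply/funext => i; apply/funext => j; apply/funext => r.
apply: eq_bigr => a _; apply: eq_bigr => b _; apply: eq_bigr => k _.
rewrite W_opE; congr (_ *m _); apply: eq_bigr => l _.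
by rewrite /t_op_neg /t_op !t_tensorE.
Qed.

Lemma s_op_rep : twisted_rep (s_op m alpha delta).
Proof.
rewrite s_opE; have u : uniq (enum 'I_N) := enum_uniq _.
have E := E_at_comm; have G := E_at_gl2.
split.
- exact: sser0.
- exact: (sser_quat delta E G u).
- exact: (sser_symm delta E G u).
Qed.
End EvaluationRep.

(** * Commutation with the Bethe subalgebra on a module *)

Section BetheCommute.
Context (R : realType) (d : nat) (s : bool -> bool -> nat -> 'M[Cx R]_d).
Hypothesis hs : twisted_rep s.

Lemma Yact_central x z : Ycentral z -> Yact s z *m Yact s x = Yact s x *m Yact s z.
Proof. by move=> /(_ x) /(Yact_sound hs). Qed.

Lemma Bethe_comm_odd x m : Bethe x ->
  Yact s x *m s true true m.*2.+1 = s true true m.*2.+1 *m Yact s x.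
Proof.
elim=> {x} [l|z zc|a|x y _ IHx _ IHy|x y _ IHx _ IHy|x y xy _ IH] /=.
- exact: s11_odd_comm.
- exact: (Yact_central (YGen R true true m.*2.+1) zc).
- by rewrite mul_scalar_mx mul_mx_scalar.
- by rewrite mulmxDl mulmxDr IHx IHy.
- by rewrite -mulmxA IHy mulmxA IHx -mulmxA.
- by rewrite -(Yact_sound hs xy).
Qed.
End BetheCommute.

(** * First order expansions *)

Section Expansions.
Context (F : numFieldType) (d : nat).
Local Notation B := 'M[F]_d.
Local Notation BP := 'M[{poly F}]_d.

(* f is polynomial in e, with f(e) = A0 + e A1 + O(e^2). *)
Definition pexp (f : F -> B) (A0 A1 : B) := exists M : BP,
  [/\ forall e, f e = map_mx (horner_eval e) M, mxcoef 0 M = A0 & mxcoef 1 M = A1].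

Lemma pexp_ext f g A0 A1 : f =1 g -> pexp f A0 A1 -> pexp g A0 A1.
Proof. by move=> fg [M [h h0 h1]]; exists M; split=> // e; rewrite -fg h. Qed.

Lemma map_horner_polyC e (A : B) : map_mx (horner_eval e) (map_mx polyC A) = A.
Proof. by apply/matrixP => i j; rewrite !mxE /= /horner_eval hornerC. Qed.

Lemma pexp_lin (A A' : B) : pexp (fun e => A + e *: A') A A'.
Proof.
exists (map_mx polyC A + 'X *: map_mx polyC A'); split.
- move=> e; rewrite raddfD /= map_mxZ !map_horner_polyC.
  by congr (_ + _ *: _); exact/esym/hornerX.
- by rewrite mxcoefD mxcoefX mxcoefC addr0.
- by rewrite mxcoefD mxcoefX !mxcoefC add0r.
Qed.

Lemma pexp_const (A : B) : pexp (fun=> A) A 0.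
Proof. by apply: (@pexp_ext (fun e => A + e *: 0)); [move=> e; rewrite scaler0 addr0|exact: pexp_lin]. Qed.

Lemma pexp_add f g A0 A1 B0 B1 :
  pexp f A0 A1 -> pexp g B0 B1 -> pexp (fun e => f e + g e) (A0 + B0) (A1 + B1).
Proof.
move=> [M [h h0 h1]] [N [k k0 k1]]; exists (M + N); split.
- by move=> e; rewrite h k raddfD.
- by rewrite mxcoefD h0 k0.
- by rewrite mxcoefD h1 k1.
Qed.

Lemma pexp_mul f g A0 A1 B0 B1 : pexp f A0 A1 -> pexp g B0 B1 ->
  pexp (fun e => f e * g e) (A0 * B0) (A0 * B1 + A1 * B0).
Proof.
move=> [M [h h0 h1]] [N [k k0 k1]]; exists (M * N); split.
- by move=> e; rewrite h k (@map_mulr _ _ (horner_eval e)).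
- by rewrite mxcoefM big_ord1 h0 k0.
- by rewrite mxcoefM !big_ord_recl big_ord0 addr0 /= h0 h1 k0 k1.
Qed.

Lemma pexp_scale c f A0 A1 : pexp f A0 A1 -> pexp (fun e => c *: f e) (c *: A0) (c *: A1).
Proof.
move=> [M [h h0 h1]]; exists (c%:P *: M); split.
- by move=> e; rewrite h map_mxZ; congr (_ *: _); exact/esym/hornerC.
- by rewrite mxcoefZ h0.
- by rewrite mxcoefZ h1.
Qed.

Lemma pexp_sum (I : Type) (s : seq I) (f : I -> F -> B) A0 A1 :
  (forall i, pexp (f i) (A0 i) (A1 i)) ->
  pexp (fun e => \sum_(i <- s) f i e) (\sum_(i <- s) A0 i) (\sum_(i <- s) A1 i).
Proof.
move=> h; elim: s => [|i s IH].
  rewrite !big_nil; apply: pexp_ext (pexp_const 0) => e; by rewrite big_nil.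
rewrite !big_cons; apply: pexp_ext (pexp_add (h i) IH) => e; by rewrite big_cons.
Qed.

Lemma mxcoef_scalar r (p : {poly F}) : mxcoef r (p%:M : BP) = (p`_r)%:M.
Proof. by apply/matrixP => x y; rewrite mxcoefE !mxE coefMn. Qed.

Lemma mxcoef0 r : mxcoef r (0 : BP) = 0.
Proof. by apply/matrixP => x y; rewrite mxcoefE !mxE coef0. Qed.

Lemma pexp_mono (w : F) r : pexp (fun e => (e ^+ r * w)%:M)
  (if r == 0%N then w%:M else 0) (if r == 1%N then w%:M else 0).
Proof.
exists (('X^r * w%:P)%:M); split.
- by move=> e; rewrite map_scalar_mx /= /horner_eval !hornerE.
- by rewrite mxcoef_scalar coefMC coefXn; case: r => [|[|r]] /=; rewrite ?mul1r ?mul0r ?raddf0.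
- by rewrite mxcoef_scalar coefMC coefXn; case: r => [|[|r]] /=; rewrite ?mul1r ?mul0r ?raddf0.
Qed.

(** The indeterminate of F0 and F1 is the inverse of the rescaled spectral parameter, not the small
    parameter e. Cauchy products of series thereby become products of polynomial matrices. *)
Definition sexp (f : F -> nat -> B) (F0 F1 : BP) := forall r, pexp (f^~ r) (mxcoef r F0) (mxcoef r F1).

Lemma sexp_conv f g F0 F1 G0 G1 : sexp f F0 F1 -> sexp g G0 G1 ->
  sexp (fun e => conv (f e) (g e)) (F0 * G0) (F0 * G1 + F1 * G0).
Proof.
move=> hf hg r; rewrite mxcoefD !mxcoefM -big_split /=.
by apply: pexp_sum => i; exact: pexp_mul.
Qed.

Definition negX (A : BP) : BP := map_mx (fun p : {poly F} => p \Po (- 'X)) A.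

Lemma sexp_neg f F0 F1 : sexp f F0 F1 ->
  sexp (fun e r => (-1) ^+ r *: f e r) (negX F0) (negX F1).
Proof. by move=> h r; rewrite !mxcoef_compN; exact: pexp_scale. Qed.

Lemma sexp_ext f g F0 F1 : (forall e r, f e r = g e r) -> sexp f F0 F1 -> sexp g F0 F1.
Proof. by move=> fg h r; apply: pexp_ext (h r) => e; exact: fg. Qed.

Lemma sexp_sum_bool (f : bool -> F -> nat -> B) F0 F1 : (forall c, sexp (f c) (F0 c) (F1 c)) ->
  sexp (fun e r => \sum_(c : bool) f c e r) (\sum_(c : bool) F0 c) (\sum_(c : bool) F1 c).
Proof. by move=> h r; rewrite !mxcoef_sum; apply: pexp_sum => c; exact: h. Qed.

Context (J : eqType) (dd : J -> F) (G : J -> bool -> bool -> B).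

(* e times the generators at the parameters alpha + dd/e, when G holds the
   generators at the parameters alpha. *)
Definition Ehat (e : F) (j : J) (a b : bool) : B := (dd j *+ (a == b))%:M + e *: G j a b.
Definition pprod (js : seq J) : {poly F} := \prod_(j <- js) (1 + (dd j)%:P * 'X).
Definition qprod (js : seq J) (i : J) : {poly F} :=
  \prod_(j <- js | j != i) (1 + (dd j)%:P * 'X).
Definition T0 js (a b : bool) : BP := (pprod js *+ (a == b))%:M.
Definition T1 js (a b : bool) : BP := \sum_(j <- js) ('X * qprod js j) *: map_mx polyC (G j a b).

Lemma sexp_factor j a c : sexp
  (fun e i => match i with 0 => ((a == c)%:R)%:M | 1 => Ehat e j a c | _ => 0 end)
  (((1 + (dd j)%:P * 'X) *+ (a == c))%:M) ('X *: map_mx polyC (G j a c)).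
Proof.
move=> r; rewrite mxcoefX mxcoef_scalar coefMn coefD coef1 coefCM coefX.
case: r => [|[|r]] /=.
- rewrite mulr0 addr0; exact: pexp_const.
- rewrite mulr1 add0r mxcoefC; exact: pexp_lin.
- rewrite mulr0 addr0 mul0rn raddf0 mxcoefC; exact: pexp_const.
Qed.

(** To zeroth order the factor j is the scalar 1 + d_j X, so the order of the factors is immaterial
    and T1 is given by the product rule. *)
Lemma tser_exp js a b : uniq js ->
  sexp (fun e r => tser (Ehat e) js a b r) (T0 js a b) (T1 js a b).
Proof.
elim: js a b => [|j js IH] a b /=.
  move=> _ r; rewrite /T0 /T1 /pprod !big_nil mxcoef0 mxcoef_scalar coefMn coef1.
  by case: r => [|r] /=; [|rewrite mul0rn raddf0]; exact: pexp_const.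
move=> /andP[jjs ujs].
have h c := sexp_conv (sexp_factor j a c) (IH c b ujs).
have := sexp_sum_bool h.
have -> : \sum_c (((1 + (dd j)%:P * 'X) *+ (a == c))%:M * T0 js c b) = T0 (j :: js) a b.
  rewrite (bigD1 a) //= big1 ?addr0 => [|c /negPf ca]; last first.
    by rewrite eq_sym ca mulr0n raddf0 mul0r.
  by rewrite eqxx mulr1n /T0 scalar_mull scale_scalar_mx /pprod big_cons mulrnAr.
have -> // : \sum_c (((1 + (dd j)%:P * 'X) *+ (a == c))%:M * T1 js c b +
      'X *: map_mx polyC (G j a c) * T0 js c b) = T1 (j :: js) a b.
rewrite big_split /= (bigD1 a) //= big1 ?addr0 => [|c /negPf ca]; last first.
  by rewrite eq_sym ca mulr0n raddf0 mul0r.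
rewrite [X in _ + X](bigD1 b) //= [X in _ + (_ + X)]big1 ?addr0 => [|c /negPf cb]; last first.
  by rewrite /T0 cb mulr0n raddf0 mulr0.
rewrite !eqxx !mulr1n /T1 big_cons addrC; congr (_ + _).
  rewrite /T0 eqxx mulr1n scalar_mulr scalerA mulrC; congr (_ * _ *: _).
  rewrite /qprod /pprod big_cons eqxx /= big_seq [RHS]big_seq_cond.
  apply: eq_bigl => k; case: (boolP (k \in js)) => //= kjs.
  by rewrite (memPn jjs).
rewrite scalar_mull scaler_sumr !big_seq; apply: eq_bigr => k kjs.
rewrite scalerA; congr (_ *: _); rewrite /qprod big_cons.
have -> : j != k by apply: contraNneq jjs => ->.
by rewrite mulrCA.
Qed.

(* The series e^r s_11^(r) tends to [Phi0]; [S1] is its first order term. *)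
Definition Phi0 js : {poly F} := pprod js * (pprod js \Po - 'X).
Definition S1 (c : F) js : BP :=
  \sum_(j <- js) ('X * qprod js j * (pprod js \Po - 'X)) *: map_mx polyC (G j true true)
  - \sum_(j <- js) ('X * pprod js * (qprod js j \Po - 'X)) *: map_mx polyC (G j false false)
  + ((c - 2^-1)%:P * 'X * Phi0 js)%:M.

(** The summand a = -1 is a product of two off-diagonal entries of first order each, so only a = 1
    contributes, together with the expansion 1 + e (c - 1/2) X of the W factor. *)
Lemma sser_exp c js : uniq js ->
  sexp (fun e r => sser (Ehat e) (fun a b r => e ^+ r * Wop c a b r) js true true r)
    ((Phi0 js)%:M) (S1 c js).
Proof.
move=> ujs.
apply: (sexp_ext (f := fun e r => \sum_(a : bool)
    conv (conv (tser (Ehat e) js true a)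
               (fun r => (-1) ^+ r *: tser (Ehat e) js false (~~ a) r))
         (fun r' => (e ^+ r' * Wop c a a r')%:M) r)).
  by move=> e r; rewrite sser_diag // => a k; rewrite W_op_offdiag mulr0.
have W a : sexp (fun e r => (e ^+ r * Wop c a a r)%:M)
    1%:M ((((if a then c else 1 - c) - 2^-1)%:P * 'X)%:M).
  move=> r; have := pexp_mono (Wop c a a r) r.
  rewrite !mxcoef_scalar coef1 coefCM coefX.
  by case: a; case: r => [|[|r]] /=; rewrite /Wser ?expr0 ?expr1 ?mulr0 ?mulr1 ?addr0 ?raddf0 // addrC.
have h a := sexp_conv (sexp_conv (tser_exp true a ujs) (sexp_neg (tser_exp false (~~ a) ujs))) (W a).
have := sexp_sum_bool h; rewrite !big_bool /=.
have T0tf : T0 js true false = 0 by rewrite /T0 mulr0n raddf0.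
have T0ft : T0 js false true = 0 by rewrite /T0 mulr0n raddf0.
have n0 : negX 0 = 0.
  by apply/matrixP => x y; rewrite !mxE comp_poly0.
have nT0 : negX (T0 js false false) = (pprod js \Po - 'X)%:M.
  by apply/matrixP => x y; rewrite /T0 !mxE mulr1n; case: (x == y); rewrite ?comp_poly0.
rewrite T0tf T0ft n0 nT0 !mul0r !mulr0 !addr0 !mul0r addr0.
have T0tt : T0 js true true = (pprod js)%:M by rewrite /T0 mulr1n.
rewrite !scalar_mulr !scale1r addr0 T0tt scalar_mull !scale_scalar_mx.
rewrite (mulrC _ (pprod js)) -/(Phi0 js).
suff -> : ((c - 2^-1)%:P * 'X * Phi0 js)%:M + (pprod js *: negX (T1 js false false) +
    (pprod js \Po - 'X) *: T1 js true true) = S1 c js by [].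
rewrite addrC /S1; congr (_ + _); rewrite addrC; congr (_ + _).
  rewrite /T1 scaler_sumr; apply: eq_bigr => j _; rewrite scalerA; congr (_ *: _).
  by rewrite mulrC.
rewrite /negX /T1 raddf_sum /= scaler_sumr -sumrN; apply: eq_bigr => j _.
apply/matrixP => x y; rewrite !mxE /= comp_polyM comp_polyM comp_polyX comp_polyC; ring.
Qed.
End Expansions.

(** * Rescaling of the spectral parameter *)

Section Homogeneity.
Context (F : numFieldType) (d : nat) (J : eqType).
Implicit Types (E : J -> bool -> bool -> 'M[F]_d).

Lemma conv_scale (e : F) (f g : nat -> 'M[F]_d) r :
  conv (fun k => e ^+ k *: f k) (fun k => e ^+ k *: g k) r = e ^+ r *: conv f g r.
Proof.
rewrite !convE scaler_sumr; apply: eq_bigr => i _.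
by rewrite scale_mulAl scale_mulAr scalerA -exprD subnKC // -ltnS.
Qed.

Lemma tser_scale (e : F) E js a b r :
  tser (fun j a b => e *: E j a b) js a b r = e ^+ r *: tser E js a b r.
Proof.
elim: js a b r => [|j js IH] a b r /=.
  by case: r => [|r] /=; rewrite ?expr0 ?scale1r ?scaler0.
rewrite scaler_sumr; apply: eq_bigr => c _; rewrite -conv_scale; apply: eq_conv => //.
by case=> [|[|k]] /=; rewrite ?expr0 ?expr1 ?scale1r ?scaler0.
Qed.

Lemma sser_scale (e : F) E w js i j r :
  sser (fun j a b => e *: E j a b) (fun a b r => e ^+ r * w a b r) js i j r =
  e ^+ r *: sser E w js i j r.
Proof.
rewrite /sser scaler_sumr; apply: eq_bigr => a _; rewrite scaler_sumr; apply: eq_bigr => b _.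
rewrite -conv_scale; apply: eq_conv => k; last by rewrite scale_scalar_mx.
rewrite -conv_scale; apply: eq_conv => l; first exact: tser_scale.
by rewrite tser_scale !scalerA mulrC.
Qed.
End Homogeneity.

(** * The leading coefficients and the weights they determine *)

Section LeadingTerms.
Context (F : numFieldType) (J : eqType) (dd : J -> F).
Local Notation p := (pprod dd).
Local Notation q := (qprod dd).

Lemma even_coef_odd (P : {poly F}) r : P \Po (- 'X) = P -> odd r -> P`_r = 0.
Proof.
move=> Pe ro; have := coef_compN P r; rewrite Pe -signr_odd ro expr1 mulN1r => /eqP.
by rewrite -addr_eq0 -mulr2n mulrn_eq0 => /eqP.
Qed.

Lemma compNK (P : {poly F}) : (P \Po (- 'X)) \Po (- 'X) = P.
Proof. by rewrite -comp_polyA rmorphN /= comp_polyX opprK comp_polyXr. Qed.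

(** The product p(X) p(-X) is even. This removes the zeroth order term from the odd coefficients and
    permits their division by e. *)
Lemma Phi0_odd js r : odd r -> (Phi0 dd js)`_r = 0.
Proof. by apply: even_coef_odd; rewrite /Phi0 comp_polyM compNK mulrC. Qed.

Lemma Phi0_cons j js : Phi0 dd (j :: js) = (1 - (dd j ^+ 2)%:P * 'X^2) * Phi0 dd js.
Proof.
rewrite /Phi0 /pprod big_cons comp_polyM comp_polyD comp_polyM comp_polyX !comp_polyC.
by rewrite rmorph1 rmorphXn /=; ring.
Qed.

Lemma Phi0_coef0 js : (Phi0 dd js)`_0 = 1.
Proof.
elim: js => [|j js IH]; first by rewrite /Phi0 /pprod big_nil rmorph1 mulr1 coef1.
by rewrite Phi0_cons mulrBl mul1r coefB IH -mulrA coefCM coefXnM /= mulr0 subr0.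
Qed.

Lemma Phi0_coef2 js : (Phi0 dd js)`_2 = - \sum_(j <- js) dd j ^+ 2.
Proof.
elim: js => [|j js IH]; first by rewrite /Phi0 /pprod !big_nil rmorph1 mulr1 coef1 oppr0.
rewrite Phi0_cons mulrBl mul1r coefB IH -mulrA coefCM coefXnM /= subnn Phi0_coef0 big_cons mulr1.
by rewrite opprD addrC.
Qed.

(** The diagonal entry of [S1] at a vector on which E_11 and E_{-1,-1} of the factor j have the
    eigenvalues x j and y j. *)
Definition Phi1 (c : F) js (x y : J -> F) : {poly F} :=
  \sum_(j <- js) 'X * q js j * (p js \Po - 'X) * (x j)%:P
  - \sum_(j <- js) 'X * p js * (q js j \Po - 'X) * (y j)%:P
  + (c - 2^-1)%:P * 'X * Phi0 dd js.

Lemma mxcoef_S1_diag n (G : J -> bool -> bool -> 'M[F]_n) (g : J -> bool -> 'rV[F]_n) c js r :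
  (forall j a, G j a a = diag_mx (g j a)) ->
  mxcoef r (S1 dd G c js) =
  diag_mx (\row_k (Phi1 c js (fun j => g j true 0 k) (fun j => g j false 0 k))`_r).
Proof.
move=> hG; apply/matrixP => k l; rewrite mxcoefE /S1 !mxE !summxE.
have [<-|kl] := eqVneq k l.
  rewrite mulr1n mulr1n /Phi1.
  rewrite (eq_bigr (fun j => 'X * q js j * (p js \Po - 'X) * (g j true 0 k)%:P)); last first.
    by move=> j _; rewrite hG !mxE eqxx mulr1n.
  rewrite [X in _ - X](eq_bigr (fun j => 'X * p js * (q js j \Po - 'X) * (g j false 0 k)%:P)) //.
  by move=> j _; rewrite hG !mxE eqxx mulr1n.
rewrite !mulr0n addr0 !big1 ?subrr ?coef0 // => j _; by rewrite hG !mxE (negPf kl) mulr0n polyC0 mulr0.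
Qed.

Lemma horner_pprod js a : (p js).[a] = \prod_(j <- js) (1 + dd j * a).
Proof. by rewrite /pprod horner_prod; apply: eq_bigr => j _; rewrite !hornerE. Qed.

Lemma horner_qprod js i a : (q js i).[a] = \prod_(j <- js | j != i) (1 + dd j * a).
Proof. by rewrite /qprod horner_prod; apply: eq_bigr => j _; rewrite !hornerE. Qed.

(* The difference of the two sides is odd, hence vanishes; its value at 1/d_i
   only involves the i-th summand. *)
Lemma Phi1_sep c js (x y x' y' : J -> F) :
  uniq js ->
  {in js, forall j, dd j != 0} -> {in js &, forall i j, dd i + dd j != 0} ->
  {in js &, injective dd} ->
  {in js, forall j, x j + y j = x' j + y' j} ->
  (forall r, odd r -> (Phi1 c js x y)`_r = (Phi1 c js x' y')`_r) ->
  {in js, x =1 x'}.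
Proof.
move=> ujs d0 dD di xy h i ijs.
pose del j := x j - x' j.
pose H j := q js j * (p js \Po - 'X) + p js * (q js j \Po - 'X).
have E : Phi1 c js x y - Phi1 c js x' y' = 'X * \sum_(j <- js) H j * (del j)%:P.
  have lin (P : J -> {poly F}) (u u' : J -> F) :
      \sum_(j <- js) P j * (u j)%:P - \sum_(j <- js) P j * (u' j)%:P =
      \sum_(j <- js) P j * (u j - u' j)%:P.
    by rewrite -sumrB; apply: eq_bigr => j _; rewrite polyCB mulrBr.
  transitivity (\sum_(j <- js) 'X * q js j * (p js \Po - 'X) * (x j - x' j)%:P -
      \sum_(j <- js) 'X * p js * (q js j \Po - 'X) * (y j - y' j)%:P).
    by rewrite -!lin /Phi1; ring.
  rewrite -sumrB mulr_sumr big_seq [RHS]big_seq; apply: eq_bigr => j jjs.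
  have -> : y j - y' j = - del j.
    by rewrite /del -[y j](addKr (x j)) xy //; ring.
  by rewrite /H polyCN -/(del j); ring.
have Hneg j : H j \Po (- 'X) = H j.
  by rewrite /H comp_polyD !comp_polyM !compNK addrC mulrC [X in _ + X]mulrC.
have E0 : 'X * \sum_(j <- js) H j * (del j)%:P = 0.
  rewrite -E; apply/polyP => r; rewrite coef0; have [ro|re] := boolP (odd r).
    by rewrite coefB h // subrr.
  rewrite E coefXM; case: r re => //= r; rewrite negbK => ro.
  apply: even_coef_odd ro; rewrite raddf_sum /=; apply: eq_bigr => j _.
  by rewrite comp_polyM Hneg comp_polyC.
pose a := (dd i)^-1; have a0 : a != 0 by rewrite invr_eq0 d0.
have pa : (p js).[- a] = 0.
  rewrite horner_pprod (big_rem i) //= mulrN /a divff ?d0 // subrr mul0r //.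
have qa j : j \in js -> j != i -> (q js j).[- a] = 0.
  move=> jjs ji; rewrite horner_qprod (big_rem i) //= eq_sym ji.
  by rewrite mulrN /a divff ?d0 // subrr mul0r.
have := congr1 (fun P => P.[a]) E0; rewrite hornerM hornerX horner0 horner_sum.
rewrite (bigD1_seq i) //= big_seq_cond big1 ?addr0 => [|j /andP[jjs ji]]; last first.
  by rewrite /H hornerM hornerD !hornerM !horner_comp hornerN hornerX pa qa // !mulr0 addr0 mul0r.
rewrite /H hornerM hornerD !hornerM !horner_comp hornerN hornerX hornerC pa mulr0 add0r => /eqP.
rewrite !mulf_eq0 (negPf a0) /= => /orP[/orP[]|]; last by rewrite subr_eq0 => /eqP.
  rewrite horner_pprod prodf_seq_eq0 => /hasP[j jjs /=]; rewrite /a.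
  rewrite -(inj_eq (mulIf (d0 i ijs))) mul0r mulrDl mul1r divfK ?d0 //.
  by rewrite (negPf (dD _ _ ijs jjs)).
rewrite horner_qprod prodf_seq_eq0 => /hasP[j jjs /= /andP[ji]]; rewrite /a.
rewrite -(inj_eq (mulIf (d0 i ijs))) mul0r mulrDl mul1r mulrN mulNr divfK ?d0 // subr_eq0.
by move=> /eqP e; case/eqP: ji; apply: di.
Qed.
End LeadingTerms.

(** * Generic directions *)

Section Generic.
Context (F : numFieldType).

Lemma exists_nonroot (P : {poly F}) : P != 0 -> exists x : F, P.[x] != 0.
Proof.
move=> P0; pose s := [seq i%:R : F | i <- iota 0 (size P)].
have us : uniq s.
  by rewrite map_inj_uniq ?iota_uniq // => i j /eqP; rewrite eqr_nat => /eqP.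
have : ~~ all (root P) s.
  apply/negP => h; have := max_poly_roots P0 h us.
  by rewrite size_map size_iota ltnn.
by case/allPn => x _ h; exists x.
Qed.

(** The weights lie on the moment curve g_i = z^i: a collision of x and y makes z a root of the
    nonzero polynomial Q x - Q y, and z is chosen off all these roots. *)
Lemma generic_weights (I T : finType) (phi : I -> T -> F) :
  (forall x y, x != y -> exists i, phi i x != phi i y) ->
  exists g : I -> F, injective (fun x => \sum_i g i * phi i x).
Proof.
move=> sep; pose Q x : {poly F} := \sum_(i < #|I|) (phi (enum_val i) x)%:P * 'X^i.
have Qc x (i : 'I_#|I|) : (Q x)`_i = phi (enum_val i) x.
  rewrite coef_sum (bigD1 i) //= coefCM coefXn eqxx mulr1 big1 ?addr0 // => j ji.
  by rewrite coefCM coefXn eq_sym (inj_eq val_inj) (negPf ji) mulr0.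
pose P := \prod_(p : T * T | p.1 != p.2) (Q p.1 - Q p.2).
have P0 : P != 0.
  apply/prodf_neq0 => -[x y] /= xy; rewrite subr_eq0; apply/eqP => e.
  have [k] := sep x y xy; have := congr1 (fun q : {poly F} => q`_(enum_rank k)) e.
  by rewrite /= !Qc enum_rankK => ->; rewrite eqxx.
have [z Pz] := exists_nonroot P0; exists (fun i => z ^+ enum_rank i) => x y /= e.
apply/eqP; apply: contraTT Pz => xy; rewrite negbK /P horner_prod (bigD1 (x, y)) //=.
have Qz t : (Q t).[z] = \sum_i z ^+ enum_rank i * phi i t.
  rewrite horner_sum (reindex enum_rank); last exact/onW_bij/enum_rank_bij.
  by apply: eq_bigr => i _; rewrite !hornerE enum_rankK mulrC.
by rewrite hornerD hornerN !Qz e subrr mul0r.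
Qed.

Lemma exists_pos_lower (s : seq F) : (forall x, x \in s -> 0 < x) ->
  exists2 g : F, 0 < g & forall x, x \in s -> g <= x.
Proof.
elim: s => [|a s IH] h; first by exists 1.
have [|g g0 gs] := IH; first by move=> x xs; apply: h; rewrite inE xs orbT.
have a0 : 0 < a by apply: h; rewrite mem_head.
have [ag|ga] := real_leP (gtr0_real a0) (gtr0_real g0).
  by exists a => // x; rewrite inE => /orP[/eqP->|/gs] //; exact: le_trans.
by exists g => // x; rewrite inE => /orP[/eqP->|/gs] //; exact: ltW.
Qed.

Lemma poly_lipschitz0 (P : {poly F}) :
  exists2 C : F, 0 <= C & forall e, `|e| <= 1 -> `|P.[e] - P.[0]| <= C * `|e|.
Proof.
elim/poly_ind: P => [|P c [C C0 IH]].
  by exists 0 => // e _; rewrite !horner0 subrr normr0 mul0r.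
exists (C + `|P.[0]|) => [|e e1]; first exact: addr_ge0.
rewrite !hornerD !hornerM !hornerX !hornerC mulr0 add0r addrK normrM ler_wpM2r // -[P.[e]](subrK P.[0]).
apply: le_trans (ler_normD _ _) _; rewrite lerD2r; apply: le_trans (IH e e1) _.
by rewrite ler_piMr.
Qed.

Lemma mx_lipschitz0 n (X : 'M[{poly F}]_n) :
  exists2 C : F, 0 <= C & forall e, `|e| <= 1 -> forall i j,
    `|(X i j).[e] - (X i j).[0]| <= C * `|e|.
Proof.
have h (p : 'I_n * 'I_n) := poly_lipschitz0 (X p.1 p.2).
have /choice[C hC] : forall p : 'I_n * 'I_n, exists C : F, 0 <= C /\
    forall e, `|e| <= 1 -> `|(X p.1 p.2).[e] - (X p.1 p.2).[0]| <= C * `|e|.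
  by move=> p; have [C C0 hC] := h p; exists C.
exists (\sum_p C p) => [|e e1 i j]; first by apply: sumr_ge0 => p _; case: (hC p).
apply: le_trans ((hC (i, j)).2 e e1) _; rewrite ler_wpM2r // (bigD1 (i, j)) //=.
by rewrite lerDl; apply: sumr_ge0 => p _; case: (hC p).
Qed.

Lemma pexp0_div d (f : F -> 'M[F]_d) A1 : pexp f 0 A1 ->
  exists M : 'M[{poly F}]_d,
    (forall e, f e = e *: map_mx (horner_eval e) M) /\ map_mx (horner_eval 0) M = A1.
Proof.
move=> [M [h h0 h1]]; have e0 i j : (M i j)`_0 = 0 by rewrite -mxcoefE h0 mxE.
pose N := map_mx (fun p : {poly F} => \poly_(i < size p) p`_i.+1) M.
have MN i j : M i j = 'X * N i j.
  apply/polyP => -[|k]; rewrite coefXM ?e0 //= mxE coef_poly; case: ltnP => // ks.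
  by rewrite nth_default // (leq_trans ks).
exists N; split=> [e|].
  rewrite h; apply/matrixP => i j; rewrite [LHS]mxE [RHS]mxE [X in _ * X]mxE MN.
  by rewrite /horner_eval hornerM hornerX.
apply/matrixP => i j; rewrite -h1 mxcoefE MN coefXM [LHS]mxE.
by rewrite /horner_eval horner_coef0.
Qed.

Lemma pexp_poly d (f : F -> 'M[F]_d) A0 A1 : pexp f A0 A1 ->
  exists M : 'M[{poly F}]_d,
    (forall e, f e = map_mx (horner_eval e) M) /\ map_mx (horner_eval 0) M = A0.
Proof.
move=> [M [h h0 h1]]; exists M; split=> //.
by rewrite -h0; apply/matrixP => i j; rewrite !mxE /horner_eval horner_coef0.
Qed.
End Generic.

Lemma spectral_family (F : closedFieldType) n (X : 'M[{poly F}]_n) (d : 'rV[F]_n) :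
  map_mx (horner_eval 0) X = diag_mx d -> injective (d 0) ->
  exists2 r : {poly F}, r.[0] != 0 & forall e, r.[e] != 0 ->
    exists (P : 'M[F]_n) (mu : 'rV[F]_n),
      [/\ P \in unitmx, map_mx (horner_eval e) X *m P = P *m diag_mx mu & injective (mu 0)].
Proof.
case: n => [|n] in X d *.
  (* The basis could a priori be empty, while [disc_mx] requires a positive size. *)
  move=> _ _; exists 1 => [|e _]; first by rewrite hornerC oner_eq0.
  exists 1%:M, 0; split; [exact: unitmx1|by apply/matrixP => -[] |by case].
move=> X0 di; exists (disc_mx X); first exact: disc_poly_diag X0 di.
by move=> e; rewrite disc_poly_eval => /disc_diag.
Qed.

Import numFieldNormedType.Exports.

Local Open Scope classical_set_scope.
Local Open Scope ring_scope.
Local Open Scope complex_scope.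

Section Spectrum.
Context (R : realType) (d : nat) (A : 'M[Cx R]_d -> Prop).
Variables (X P : 'M[Cx R]_d) (mu : 'rV[Cx R]_d).
Hypotheses (AX : A X) (Acomm : forall Y, A Y -> Y *m X = X *m Y).
Hypotheses (Pu : P \in unitmx) (XP : X *m P = P *m diag_mx mu) (mi : injective (mu 0)).

Lemma col_unit_neq0 q : col q P != 0.
Proof.
apply/eqP => Pq; have : P *m delta_mx q 0 = 0 :> 'cV_d by rewrite -colE.
move/(canRL (mulKmx Pu)); rewrite mulmx0 => /colP/(_ q)/eqP.
by rewrite !mxE !eqxx oner_eq0.
Qed.

Lemma joint_eigenvector_col q : joint_eigenvector A (col q P).
Proof.
split; first exact: col_unit_neq0.
by move=> Y /Acomm YX; exact: commuting_eigen Pu XP mi YX.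
Qed.

Lemma joint_eigenvectorE w : joint_eigenvector A w -> exists q c, w = c *: col q P.
Proof.
move=> [w0 /(_ X AX)[a Xw]]; have [q [c [_ ->]]] := eigen_coord Pu XP w0 Xw mi.
by exists q, c.
Qed.

Lemma col_scale_inj q q' (a a' : Cx R) : a *: col q P = a' *: col q' P ->
  a *: col q P != 0 -> q = q'.
Proof.
move=> e n0; apply: mi.
have h : X *m (a *: col q P) = mu 0 q *: (a *: col q P).
  by rewrite -scalemxAr (eigen_col q XP) !scalerA mulrC.
have h' : X *m (a *: col q P) = mu 0 q' *: (a *: col q P).
  by rewrite e -scalemxAr (eigen_col q' XP) !scalerA mulrC.
move: h; rewrite h' => /eqP; rewrite -subr_eq0 -scalerBl scalemx_eq0 (negPf n0) orbF subr_eq0.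
by move/eqP.
Qed.

Lemma simple_spectrum_diag : simple_spectrum A.
Proof.
split; first by exists P; split=> // q; exact: joint_eigenvector_col.
move=> chi v w v0 hv hw.
have [w0|w0] := eqVneq w 0; first by exists 0; rewrite w0 scale0r.
have [q [c [cq vE]]] := eigen_coord Pu XP v0 (hv X AX) mi.
have [q' [c' [cq' wE]]] := eigen_coord Pu XP w0 (hw X AX) mi.
have qq : q = q' by apply: mi; rewrite -cq -cq'.
have c0 : c != 0 by apply: contraNneq v0 => c0; rewrite vE c0 scale0r.
by exists (c' / c); rewrite wE vE scalerA divfK // qq.
Qed.

Lemma eigenlines_perm (I : Type) (s : I -> 'I_d) : bijective s ->
  eigenlines A (fun b => col (s b) P).
Proof.
case=> s' sK s'K; split; first by move=> b; exact: joint_eigenvector_col.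
move=> w jw; have [q [c wE]] := joint_eigenvectorE jw.
exists (s' q); split; first by exists c; rewrite s'K.
move=> b [a wE']; have w0 := jw.1.
by rewrite -[RHS]sK; congr s'; apply: (@col_scale_inj _ _ c a); rewrite -wE.
Qed.
End Spectrum.

(** An eigenline is labelled by the position of its dominant coordinate. The labelling is fixed
    before k, so one family v obeys the bound for every admissible k. *)
Lemma labelled_eigenlines (R : realType) (I : finType) (A : op R I -> Prop)
    (X P : op R I) (mu d : 'rV[Cx R]_#|I|) (g : Cx R) :
  A X -> (forall Y, A Y -> Y *m X = X *m Y) ->
  P \in unitmx -> X *m P = P *m diag_mx mu -> injective (mu 0) ->
  (forall i j, i != j -> g <= `|d 0 i - d 0 j|) -> 0 < g ->
  exists v : I -> vec R I, eigenlines A v /\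
    forall k, (forall i j, `|X i j - d 0 i *+ (i == j)| <= k) -> 4 * (#|I|%:R * k) < g ->
    forall b, v b (enum_rank b) 0 != 0 /\
      forall i, i != enum_rank b ->
        `|v b i 0| <= 2 * (#|I|%:R * k) / g * `|v b (enum_rank b) 0|.
Proof.
move=> AX Ac Pu XP mi gap g0.
have /choice[tau tau_max] : forall q, exists i, forall j, `|P j q| <= `|P i q|.
  by move=> q; exact: (exists_norm_max (P^~ q) q).
pose good k := (forall i j, `|X i j - d 0 i *+ (i == j)| <= k) /\ 4 * (#|I|%:R * k) < g.
have eb := @enum_rank_bij I.
(* If X is close to diag d for some k, then [tau] is a bijection and its inverse gives the labels.
   Otherwise the bound is vacuous and any labelling will do. *)
have [[k0 [h0 hk0]]|nogood] := pselect (exists k, good k); last first.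
  exists (fun b => col (enum_rank b) P); split; first exact: (eigenlines_perm AX Ac Pu XP mi eb).
  by move=> k hk hkg; case: nogood; exists k.
have ti := tau_inj Pu XP mi gap h0 hk0 tau_max.
have tb : bijective tau := injF_bij ti.
exists (fun b => col (invF ti (enum_rank b)) P); split.
  apply: (eigenlines_perm AX Ac Pu XP mi (s := fun b => invF ti (enum_rank b))).
  apply: bij_comp eb; exists tau; [exact: f_invF|exact: invF_f].
move=> k hk hkg b; have tE : tau (invF ti (enum_rank b)) = enum_rank b by rewrite f_invF.
split; first by have := tau_neq0 Pu tau_max (invF ti (enum_rank b)); rewrite mxE tE.
move=> i ib; have it : i != tau (invF ti (enum_rank b)) by rewrite tE.
by have := eigenvector_bound Pu XP gap g0 hk hkg tau_max it; rewrite !mxE tE.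
Qed.

(** Dividing v t by its coordinate at b brings it into a ball around the basis vector; an open cone
    does not notice the division. *)
Lemma proj_cvg_basis (R : realType) (I : finType) (v : R -> vec R I) (b : I) :
  (forall eta : Cx R, 0 < eta -> \forall t \near +oo,
    v t (enum_rank b) 0 != 0 /\
    forall i, i != enum_rank b -> `|v t i 0| <= eta * `|v t (enum_rank b) 0|) ->
  proj_cvg v (basis_vec R b).
Proof.
move=> h U Uo Ucone Ub.
have /nbhs_ballP[e /= e0 eU] : nbhs (basis_vec R b) U by exact: open_nbhs_nbhs.
have e2 : 0 < e / 2 by rewrite divr_gt0.
apply: filterS (h _ e2) => t [vb vi].
have -> : v t = v t (enum_rank b) 0 *: ((v t (enum_rank b) 0)^-1 *: v t).
  by rewrite scalerA divff // scale1r.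
apply: Ucone => //; apply: eU; split=> // i j; rewrite ord1 -ball_normE /= !mxE eqxx andbT.
have [->|ib] := eqVneq i (enum_rank b); first by rewrite mulVf // subrr normr0.
rewrite sub0r normrN normrM normfV mulrC ltr_pdivrMr ?normr_gt0 //.
apply: le_lt_trans (vi i ib) _; rewrite ltr_pM2r ?normr_gt0 //.
by rewrite ltr_pdivrMr // ltr_pMr // ltr1n.
Qed.

Lemma small_bound (F : numFieldType) (N C g eta : F) : 0 <= N -> 0 <= C -> 0 < g -> 0 < eta ->
  exists2 B : F, 0 < B <= 1 & 4 * (N * (C * B)) < g /\ 2 * (N * (C * B)) / g <= eta.
Proof.
move=> N0 C0 g0 eta0; have NC : 0 <= N * C by exact: mulr_ge0.
have NC1 : 0 < N * C + 1 by exact: ltr_wpDl.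
pose b1 := g / (4 * (N * C + 1)); pose b2 := eta * g / (2 * (N * C + 1)).
have b10 : 0 < b1 by rewrite divr_gt0 // mulr_gt0.
have b20 : 0 < b2 by rewrite divr_gt0 ?mulr_gt0.
have [|B B0 Bs] := @exists_pos_lower F [:: 1; b1; b2].
  by move=> x; rewrite !inE => /or3P[] /eqP->.
exists B; first by rewrite B0 Bs // !inE eqxx.
have /Bs B1 : b1 \in [:: 1; b1; b2] by rewrite !inE eqxx orbT.
have /Bs B2 : b2 \in [:: 1; b1; b2] by rewrite !inE eqxx !orbT.
split.
  have h : B * (4 * (N * C + 1)) <= g by rewrite -ler_pdivlMr // mulr_gt0.
  apply: lt_le_trans h; have -> : 4 * (N * (C * B)) = B * (4 * (N * C)) by ring.
  by rewrite !ltr_pM2l // ltrDl.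
rewrite ler_pdivrMr //.
have h : B * (2 * (N * C + 1)) <= eta * g by rewrite -ler_pdivlMr // mulr_gt0.
apply: le_trans h; have -> : 2 * (N * (C * B)) = B * (2 * (N * C)) by ring.
by rewrite !ler_pM2l // lerDl.
Qed.

(* The slope of the ray avoids those of the inverses of the roots. *)
Lemma ray_avoiding (R : realType) (r : {poly Cx R}) : r != 0 ->
  exists2 w : Cx R, w != 0 & forall t : R, 0 < t -> r.[(w * t%:C)^-1] != 0.
Proof.
move=> r0; have [rs rE] := closed_field_poly_normal r.
pose bad := [seq complex.Im (x^-1 : R[i]) / complex.Re (x^-1 : R[i]) | x <- rs].
have [s sbad] : exists s : R, s \notin bad.
  pose S := [seq i%:R : R | i <- iota 0 (size bad).+1].
  have uS : uniq S by rewrite map_inj_uniq ?iota_uniq // => i j /eqP; rewrite eqr_nat => /eqP.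
  have /allPn[s _ sb] : ~~ all [in bad] S.
    apply/negP => /allP h; have := uniq_leq_size uS h.
    by rewrite !size_map size_iota ltnn.
  by exists s.
pose w : R[i] := (1 +i* s)%C.
have w0 : w != 0 by rewrite eq_complex /= oner_eq0.
exists w => // t t0; apply: contraNN sbad => rt.
have : (w * t%:C)^-1 \in rs.
  move: rt; rewrite rE hornerZ mulf_eq0 lead_coef_eq0 (negPf r0) /= => rt.
  by rewrite -root_prod_XsubC.
move=> /(map_f (fun x : R[i] => complex.Im (x^-1 : R[i]) / complex.Re (x^-1 : R[i]))).
suff -> : complex.Im (((w * t%:C)^-1)^-1 : R[i]) / complex.Re (((w * t%:C)^-1)^-1 : R[i]) = s by [].
rewrite invrK /w; simpc => /=.
by rewrite mulfK // gt_eqF.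
Qed.

(** The algebra A is indexed by z and the matrix X by e = 1/z. The eigenlines are chosen separately
    for each t; their limit comes from the estimate of X(e) - diag d by a multiple of |e|, which
    bounds the ratios of their coordinates. *)
Lemma spectral_path (R : realType) (I : finType) (A : Cx R -> op R I -> Prop)
    (X : 'M[{poly Cx R}]_#|{: I}|) (d : 'rV[Cx R]_#|{: I}|) :
  map_mx (horner_eval 0) X = diag_mx d -> injective (d 0) ->
  (forall e, e != 0 -> A e^-1 (map_mx (horner_eval e) X)) ->
  (forall e, e != 0 -> forall Y, A e^-1 Y ->
     Y *m map_mx (horner_eval e) X = map_mx (horner_eval e) X *m Y) ->
  exists w : Cx R,
    (forall t : R, 0 < t -> simple_spectrum (A (w * t%:C))) /\
    exists v : R -> I -> vec R I,
      (forall t : R, 0 < t -> eigenlines (A (w * t%:C)) (v t)) /\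
      (forall b, proj_cvg (v^~ b) (basis_vec R b)).
Proof.
move=> X0 di AX Ac; have [r r0 hr] := spectral_family X0 di.
have rn0 : r != 0 by apply: contraNneq r0 => ->; rewrite horner0.
have [w w0 hw] := ray_avoiding rn0.
have e0 (t : R) : 0 < t -> (w * t%:C)^-1 != 0.
  by move=> t0; rewrite invr_eq0 mulf_neq0 // -(rmorph0 (real_complex R)) (inj_eq (fmorph_inj _)) gt_eqF.
have AXt (t : R) : 0 < t -> A (w * t%:C) (map_mx (horner_eval (w * t%:C)^-1) X).
  by move=> t0; have := AX _ (e0 t t0); rewrite invrK.
have Act (t : R) : 0 < t -> forall Y, A (w * t%:C) Y ->
    Y *m map_mx (horner_eval (w * t%:C)^-1) X = map_mx (horner_eval (w * t%:C)^-1) X *m Y.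
  by move=> t0; have := Ac _ (e0 t t0); rewrite invrK.
exists w; split=> [t t0|].
  have [P [mu [Pu XP mi]]] := hr _ (hw t t0).
  exact: simple_spectrum_diag (AXt t t0) (Act t t0) Pu XP mi.
pose ds := [seq `|d 0 p.1 - d 0 p.2| | p <- enum {: 'I_#|{: I}| * 'I_#|{: I}|} & p.1 != p.2].
have [|g g0 gs] := @exists_pos_lower (Cx R) ds.
  move=> x /mapP[p]; rewrite mem_filter => /andP[p12 _] ->.
  by rewrite normr_gt0 subr_eq0 (inj_eq di).
have gap i j : i != j -> g <= `|d 0 i - d 0 j|.
  move=> ij; apply: gs; apply/mapP; exists (i, j) => //.
  by rewrite mem_filter ij mem_enum.
have /choice[v hv] : forall t : R, exists v : I -> vec R I, 0 < t -> eigenlines (A (w * t%:C)) v /\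
    forall k, (forall i j, `|(map_mx (horner_eval (w * t%:C)^-1) X) i j - d 0 i *+ (i == j)| <= k) ->
      4 * (#|I|%:R * k) < g ->
    forall b, v b (enum_rank b) 0 != 0 /\
      forall i, i != enum_rank b ->
        `|v b i 0| <= 2 * (#|I|%:R * k) / g * `|v b (enum_rank b) 0|.
  move=> t; have [t0|nt0] := pselect (0 < t); last by exists (fun=> 0).
  have [P [mu [Pu XP mi]]] := hr _ (hw t t0).
  have [v hv] := labelled_eigenlines (AXt t t0) (Act t t0) Pu XP mi gap g0.
  by exists v.
exists v; split=> [t t0|b]; first exact: (hv t t0).1.
apply: proj_cvg_basis => eta eta0.
have [C C0 hC] := mx_lipschitz0 X.
have [B /andP[B0 B1] [hB1 hB2]] := small_bound (ler0n (Cx R) #|I|) C0 g0 eta0.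
(* For t > 0 the condition |1/(w t)| <= B reads t >= 1/(B |w|); this bound is a real number that
   lives in [Cx R]. *)
pose T : R := complex.Re ((B * `|w|)^-1 : R[i]).
have Bw : 0 < B * `|w| by rewrite mulr_gt0 // normr_gt0.
have TE : (B * `|w|)^-1 = T%:C.
  apply/esym/RRe_real; apply: ger0_real; rewrite invr_ge0; exact: ltW.
near=> t.
have t0 : 0 < t by near: t; apply: nbhs_pinfty_gt; exact: num_real.
have tT : T <= t by near: t; apply: nbhs_pinfty_ge; exact: num_real.
have eB : `|(w * t%:C)^-1| <= B.
  rewrite normfV normrM invf_ple ?posrE ?mulr_gt0 ?normr_gt0 //; last first.
    by have := e0 t t0; rewrite invr_eq0 mulf_eq0 negb_or => /andP[].
  rewrite mulrC -ler_pdivrMr ?normr_gt0 // -invfM.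
  have -> : `|t%:C| = t%:C :> R[i] by rewrite ger0_norm // lecR ltW.
  by rewrite TE lecR.
have [|b0 hb] := (hv t t0).2 (C * B) _ hB1 b.
  move=> i j; have -> : d 0 i *+ (i == j) = (X i j).[0].
    have /matrixP/(_ i j) := X0; rewrite !mxE /horner_eval => ->.
    by [].
  rewrite mxE /horner_eval; apply: le_trans (hC _ _ i j) _; first exact: le_trans eB B1.
  by rewrite ler_wpM2l.
split=> // i ib; apply: le_trans (hb i ib) _.
by rewrite ler_wpM2r.
Unshelve. all: by end_near.
Qed.

(** * Asymptotics along a line of parameters *)

Section CasimirExpansion.
Context (F : numFieldType) (d : nat).

Lemma pexp_eps (f : F -> 'M[F]_d) A0 A1 : pexp f A0 A1 -> pexp (fun e => e *: f e) 0 A0.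
Proof.
move=> [M [h h0 h1]]; exists ('X *: M); split.
- by move=> e; rewrite h map_mxZ; congr (_ *: _); exact/esym/hornerX.
- by rewrite mxcoefX.
- by rewrite mxcoefX h0.
Qed.

(** With f1 = e s_11^(1) and f2 = e^2 s_11^(2), the terms e f1 and f1^2 are of second order because
    f1 vanishes at e = 0; only 2 f2 reaches the limit. *)
Lemma casimir_exp (f1 f2 : F -> 'M[F]_d) A0 A1 B1 : pexp f1 0 B1 -> pexp f2 A0 A1 ->
  exists C1, pexp (fun e => f2 e + f2 e + e *: f1 e - f1 e * f1 e) (A0 + A0) C1.
Proof.
move=> h1 h2.
have := pexp_add (pexp_add (pexp_add h2 h2) (pexp_eps h1)) (pexp_scale (-1) (pexp_mul h1 h1)).
set C1 := (X in pexp _ _ X); rewrite mul0r scaler0 !addr0 => h; exists C1.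
by apply: pexp_ext h => e; rewrite scaleN1r.
Qed.

Lemma casimir_scale (e : F) (s1 s2 : 'M[F]_d) :
  e ^+ 2 *: (s2 + s2 + s1 + (-1)%:M *m (s1 *m s1)) =
  e ^+ 2 *: s2 + e ^+ 2 *: s2 + e *: (e ^+ 1 *: s1) - (e ^+ 1 *: s1) * (e ^+ 1 *: s1).
Proof.
rewrite mul_scalar_mx scaleN1r !scalerDr scalerN expr1 scalerA scale_mulAl scale_mulAr scalerA.
by rewrite -expr2.
Qed.

Lemma gl2k_shift (K : comNzRingType) m (al x : K) a b (p q : 'I_m.+1) :
  gl2k (al + x) a b p q = gl2k al a b p q + (x *+ (a == b)) *+ (p == q).
Proof.
case: a; case: b; rewrite /gl2k /= ?mulr0n ?mul0rn ?addr0 //;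
  by case: eqP => _; rewrite ?mulr1n ?mulr0n ?addr0 //; ring.
Qed.
End CasimirExpansion.

Section LevelExpansion.
Context (R : realType) (N : nat) (m : 'I_N -> nat) (alpha0 dd : 'I_N -> Cx R) (delta : Cx R).
Local Notation G := (E_at m alpha0).
Local Notation js := (enum 'I_N).

Definition s_path (e : Cx R) := s_op m (fun j => alpha0 j + e^-1 * dd j) delta.

Lemma gl2_op_shift n (al x : Cx R) a b :
  gl2_op n (al + x) a b = gl2_op n al a b + (x *+ (a == b))%:M.
Proof.
apply/opP => p q; rewrite coefD_op coef_scalar !coef_gl2_op; exact: gl2k_shift.
Qed.

Lemma E_at_path (e : Cx R) j a b : e != 0 ->
  e *: E_at m (fun j => alpha0 j + e^-1 * dd j) j a b = Ehat dd G e j a b.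
Proof.
move=> e0; rewrite /E_at /Ehat gl2_op_shift at_factorD at_factor_scalar scalerDr addrC.
by congr (_ + _); rewrite scale_scalar_mx mulrnAr (mulVKf e0).
Qed.

Lemma s_path_scale (e : Cx R) r : e != 0 ->
  e ^+ r *: s_path e true true r =
  sser (Ehat dd G e) (fun a b r => e ^+ r * Wop delta a b r) js true true r.
Proof.
move=> e0; rewrite /s_path s_opE.
have <- : (fun j a b => e *: E_at m (fun j => alpha0 j + e^-1 * dd j) j a b) = Ehat dd G e.
  by apply/funext => j; apply/funext => a; apply/funext => b; exact: E_at_path.
exact: (esym (sser_scale e _ (Wop delta) js true true r)).
Qed.

Lemma E_at_diag j a : G j a a =
  diag_mx (\row_p gl2d (alpha0 j) a ((enum_val p : tensor_basis m) j)).
Proof.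
apply/matrixP => p q; rewrite /E_at /at_factor !mxE coef_gl2_op gl2k_diag.
have [<-|pq] := eqVneq p q.
  rewrite mulr1n eqxx; case: forallP => // -[] l; exact/implyP.
rewrite mulr0n; case: forallP => // h; case: eqP => // e; case/eqP: pq.
apply: enum_val_inj; apply/ffunP => l; have [->//|lj] := eqVneq l j.
by apply/eqP; exact: (implyP (h l)).
Qed.

Definition Phi_at (f : tensor_basis m) : {poly Cx R} :=
  Phi1 dd delta js (fun j => gl2d (alpha0 j) true (f j)) (fun j => gl2d (alpha0 j) false (f j)).

(** The power of e is one less than the degree of the coefficient, because the zeroth order term
    vanishes by [Phi0_odd]. The limit is the diagonal first order term. *)
Lemma odd_level_poly k : exists M : 'M[{poly Cx R}]_#|{: tensor_basis m}|,
  (forall e, e != 0 -> e ^+ k.*2 *: s_path e true true k.*2.+1 = map_mx (horner_eval e) M) /\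
  map_mx (horner_eval 0) M = diag_mx (\row_p (Phi_at (enum_val p))`_(k.*2.+1)).
Proof.
have := sser_exp dd G delta (enum_uniq 'I_N) k.*2.+1.
rewrite mxcoef_scalar Phi0_odd /= ?odd_double // raddf0 => /pexp0_div[M [h h0]].
exists M; split=> [e e0|].
  by apply: (scalerI e0); rewrite -h scalerA -exprS s_path_scale.
rewrite h0 (mxcoef_S1_diag dd _ _ _ E_at_diag); congr diag_mx; apply/rowP => p.
rewrite !mxE; congr (polyseq _)`_ _; congr Phi1; apply/funext => j; exact: mxE.
Qed.

Lemma casimir_level_poly : exists M : 'M[{poly Cx R}]_#|{: tensor_basis m}|,
  (forall e, e != 0 -> e ^+ 2 *: Yact (s_path e) (casimir R) = map_mx (horner_eval e) M) /\
  map_mx (horner_eval 0) M = ((Phi0 dd js)`_2 + (Phi0 dd js)`_2)%:M.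
Proof.
have h2 := sser_exp dd G delta (enum_uniq 'I_N) 2.
have := sser_exp dd G delta (enum_uniq 'I_N) 1.
rewrite !mxcoef_scalar in h2 *; rewrite (Phi0_odd _ _ (r := 1)) // raddf0 => h1.
have [C1 /pexp_poly[M [h h0]]] := casimir_exp h1 h2.
exists M; split=> [e e0|]; last by rewrite h0 -raddfD.
rewrite -h -!s_path_scale //; exact: casimir_scale.
Qed.
End LevelExpansion.

Section Arithmetic.
Context (F : numFieldType).

Lemma sum_sqr_shift_inj k (r r' : nat) : (0 < k)%N ->
  (\sum_(j < k) (r + j).+1 ^ 2)%N = (\sum_(j < k) (r' + j).+1 ^ 2)%N -> r = r'.
Proof.
have mono a b : (0 < k)%N -> (a < b)%N ->
    (\sum_(j < k) (a + j).+1 ^ 2 < \sum_(j < k) (b + j).+1 ^ 2)%N.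
  case: k => // k _ ab; rewrite !big_ord_recl -addSn leq_add //.
    by rewrite ltn_exp2r // !addn0 ltnS.
  by apply: leq_sum => j _; rewrite leq_exp2r // ltnS leq_add2r ltnW.
move=> k0 e; have [ab|ba|//] := ltngtP r r'.
  by have := mono _ _ k0 ab; rewrite e ltnn.
by have := mono _ _ k0 ba; rewrite e ltnn.
Qed.

Lemma sum_sqr_separates k (r r' : nat) : (0 < k)%N ->
  - (\sum_(j <- enum 'I_k) ((r + j).+1%:R : F) ^+ 2) - \sum_(j <- enum 'I_k) (r + j).+1%:R ^+ 2 =
  - (\sum_(j <- enum 'I_k) ((r' + j).+1%:R : F) ^+ 2) - \sum_(j <- enum 'I_k) (r' + j).+1%:R ^+ 2 ->
  r = r'.
Proof.
move=> k0; have E s : \sum_(j <- enum 'I_k) ((s + j).+1%:R : F) ^+ 2 =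
    (\sum_(j < k) (s + j).+1 ^ 2)%N%:R.
  by rewrite big_enum natr_sum; apply: eq_bigr => j _; rewrite natrX.
rewrite !E -!opprD => /oppr_inj; rewrite -!natrD => /eqP.
rewrite eqr_nat !addnn => /eqP /double_inj; exact: sum_sqr_shift_inj.
Qed.

Lemma gl2d_sum m (al : F) (p q : 'I_m.+1) :
  gl2d al true p + gl2d al false p = gl2d al true q + gl2d al false q.
Proof. by rewrite /gl2d; ring. Qed.

Lemma gl2d_inj m (al : F) : injective (@gl2d F m al true).
Proof. by move=> p q /addrI /eqP; rewrite eqr_nat => /eqP /val_inj. Qed.
End Arithmetic.

(** * Elements acting on a single level of all chains *)

Section SingleFactor.
Context (R : realType) (n : nat) (V : o_module R n) (lam : seq R) (al : params V lam).

Definition single (k0 : 'I_n) (y : yexpr R) (k : 'I_n) : yexpr R :=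
  if k == k0 then y else YCst 1.

Lemma big_mulmx_single d (A : 'I_n -> 'M[Cx R]_d) k0 :
  (forall k, k != k0 -> A k = 1%:M) -> \big[mulmx/1%:M]_(k < n) A k = A k0.
Proof.
move=> h; have E (s : seq 'I_n) : uniq s ->
    \big[mulmx/1%:M]_(k <- s) A k = if k0 \in s then A k0 else 1%:M.
  elim: s => [|k s IH] /=; first by rewrite big_nil.
  move=> /andP[ks us]; rewrite big_cons IH // inE.
  have [kk|kk0] := eqVneq k k0; first by rewrite -kk (negPf ks) mulmx1.
  by rewrite h // mul1mx.
by rewrite E ?index_enum_uniq // mem_index_enum.
Qed.

Lemma pure_act_single k0 y :
  pure_act al (single k0 y) =
  direct_sum (fun c => at_factor (I_ := level_basis (V := V) (lam := lam) c) (level_act al c k0 y)).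
Proof.
congr direct_sum; apply/functional_extensionality_dep => c.
rewrite (big_mulmx_single (k0 := k0)) /single ?eqxx // => k /negPf ->.
by rewrite /level_act /= at_factor_scalar.
Qed.

Lemma pure_act_comm b b' :
  (forall c k, level_act al c k (b k) *m level_act al c k (b' k) =
               level_act al c k (b' k) *m level_act al c k (b k)) ->
  pure_act al b *m pure_act al b' = pure_act al b' *m pure_act al b.
Proof.
move=> h; rewrite [LHS]direct_sumM [RHS]direct_sumM; congr direct_sum; apply/functional_extensionality_dep => c.
set A := fun k => at_factor (I_ := level_basis c) (level_act al c k (b k)).
set A' := fun k => at_factor (I_ := level_basis c) (level_act al c k (b' k)).
have AA k l : A k *m A' l = A' l *m A k.
  have [->|kl] := eqVneq k l; last exact: at_factorC.
  by rewrite -!at_factorM h.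
have AP k : A k *m \big[mulmx/1%:M]_(l < n) A' l = \big[mulmx/1%:M]_(l < n) A' l *m A k.
  elim/big_ind: _ => [|x y hx hy|l _]; first by rewrite mulmx1 mul1mx.
    by rewrite mulmxA hx -mulmxA hy mulmxA.
  exact: AA.
elim/big_ind: (\big[mulmx/1%:M]_(k < n) A k) => [|x y hx hy|k _]; first by rewrite mulmx1 mul1mx.
  by rewrite -mulmxA hy mulmxA hx mulmxA.
exact: AP.
Qed.
End SingleFactor.

(** * The line of parameters and the separating elements *)

Section Family.
Context (R : realType) (n : nat) (hn : (0 < n)%N) (V : o_module R n) (lam : seq R).
Local Notation K := (Cx R).
Local Notation C := (chains V lam).

(* Distinct positive slopes on each factor, whose sum of squares on the last
   level depends on the chain. *)
Definition slope (c : C) (k : 'I_n) (j : 'I_k) : K := (enum_rank c + j).+1%:R.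
Definition alpha_start : params V lam := fun c k j => (alpha_occ (val c) k.+1 j.+1)%:C.
Definition alpha_line (z : K) : params V lam := fun c k j => alpha_start c j + z * slope c j.
Definition delta_of (c : C) (k : 'I_n) : K := - (alpha_occ (val c) k.+1 0)%:C.

Lemma pred_lt : (n.-1 < n)%N.
Proof. by rewrite prednK. Qed.

Definition last_level : 'I_n := Ordinal pred_lt.

Context (M : nat).
Local Notation Idx := (option ('I_n * 'I_M)).

Definition probe_level (i : Idx) : 'I_n := if i is Some (k, _) then k else last_level.
(** The powers of e are those for which the action is polynomial in e and keeps the wanted leading
    term. The central element is used on the last level only, where the sum of squares of the slopes
    identifies the chain. *)
Definition probe (i : Idx) (e : K) : yexpr R :=
  if i is Some (_, m) then (YCst (e ^+ m.*2) * YGen R true true m.*2.+1)%Y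
  else (YCst (e ^+ 2) * casimir R)%Y.

Definition lead (i : Idx) (c : C) : level_basis c (probe_level i) -> K :=
  match i return level_basis c (probe_level i) -> K with
  | Some (k, m) => fun f => (Phi_at (alpha_start c (k := k)) (slope c (k := k)) (delta_of c k) f)`_(m.*2.+1)
  | None => fun _ =>
      (Phi0 (slope c (k := last_level)) (enum 'I_last_level))`_2 +
      (Phi0 (slope c (k := last_level)) (enum 'I_last_level))`_2
  end.

Lemma level_act_line (c : C) (k : 'I_n) e x : level_act (alpha_line e^-1) c k x =
  Yact (s_path (@gaps R n V lam c k) (alpha_start c (k := k)) (slope c (k := k)) (delta_of c k) e) x.
Proof. by []. Qed.

Lemma probe_poly (i : Idx) (c : C) : exists N : 'M[{poly K}]_#|{: level_basis c (probe_level i)}|,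
  (forall e, e != 0 -> level_act (alpha_line e^-1) c (probe_level i) (probe i e) =
     map_mx (horner_eval e) N) /\
  map_mx (horner_eval 0) N = diag_mx (\row_p lead (enum_val p)).
Proof.
case: i => [[k m]|].
  have [N [h h0]] := odd_level_poly (@gaps R n V lam c k) (alpha_start c (k := k))
    (slope c (k := k)) (delta_of c k) m.
  exists N; split=> [e e0|]; last exact: h0.
  by rewrite -h // level_act_line /= mul_scalar_mx.
have [N [h h0]] := casimir_level_poly (@gaps R n V lam c last_level)
  (alpha_start c (k := last_level)) (slope c (k := last_level)) (delta_of c last_level).
exists N; split=> [e e0|].
  by rewrite -h // level_act_line /probe [Yact _ _]/= mul_scalar_mx.
rewrite h0; apply/matrixP => p q; rewrite !mxE.
by [].
Qed.

Definition total_lead (i : Idx) (x : sum_basis V lam) : K :=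
  lead (i := i) (tagged x (probe_level i)).

Lemma total_poly (i : Idx) : exists N : 'M[{poly K}]_#|{: sum_basis V lam}|,
  (forall e, e != 0 -> pure_act (alpha_line e^-1) (single (probe_level i) (probe i e)) =
     map_mx (horner_eval e) N) /\
  map_mx (horner_eval 0) N = diag_mx (\row_p total_lead i (enum_val p)).
Proof.
(* The size of the matrix depends on the chain c, so the witnesses form a dependent family and are
   picked by [cid]. *)
pose ML c := projT1 (cid (probe_poly i c)).
have MLP c := projT2 (cid (probe_poly i c)); rewrite -/(ML _) in MLP.
pose k := probe_level i.
pose N : 'M[{poly K}]_#|{: sum_basis V lam}| := \matrix_(a, b) (let x : sum_basis V lam := enum_val a in let y : sum_basis V lam := enum_val b in
  if tag x == tag y then
    if agree_off k (tagged x) (tagged_as x y) then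
      ML (tag x) (enum_rank (tagged x k)) (enum_rank (tagged_as x y k)) else 0
  else 0).
have NE e : map_mx (horner_eval e) N =
    direct_sum (fun c => at_factor (I_ := level_basis (V := V) (lam := lam) c)
       (map_mx (horner_eval e) (ML c))).
  apply/matrixP => a b; rewrite !mxE /horner_eval.
  case: ifP => _; last by rewrite horner0.
  rewrite coef_at_factor; case: ifP => _; last by rewrite horner0.
  by rewrite /coef mxE.
exists N; split=> [e e0|].
  rewrite pure_act_single NE; congr direct_sum; apply/functional_extensionality_dep => c.
  by rewrite (MLP c).1.
rewrite NE; apply/opP => x y; rewrite coef_direct_sum.
have -> : coef (diag_mx (\row_p total_lead i (enum_val p)) : op R (sum_basis V lam)) x y =
    total_lead i x *+ (x == y).
  by rewrite /coef !mxE enum_rankK (inj_eq enum_rank_inj).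
case: x y => [c f] [c' f'] /=; case: (eqVneq c c') => [cc|ne]; last first.
  rewrite (_ : (existT _ c f == existT _ c' f' :> sum_basis V lam) = false) ?mulr0n //.
  by apply/eqP => e; case/eqP: ne; exact: (congr1 tag e).
subst c'; rewrite tagged_asE coef_at_factor (MLP c).2.
have -> : (existT _ c f == existT _ c f' :> sum_basis V lam) = (f == f').
  by rewrite -tag_eqE /tag_eq /= eqxx tagged_asE.
have -> : coef (diag_mx (\row_p lead (enum_val p)) : op R (level_basis c k)) (f k) (f' k) =
    lead (f k) *+ (f k == f' k).
  by rewrite /coef !mxE enum_rankK (inj_eq enum_rank_inj).
have [<-|ff] := eqVneq f f'.
  by rewrite eqxx; case: agree_offP => // -[].
case: agree_offP => // h; case: eqP => // fk; case/eqP: ff.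
apply/ffunP => l; have [->//|lk] := eqVneq l k; exact: h.
Qed.

Lemma s_rep (al : params V lam) c k :
  twisted_rep (s_op (@gaps R n V lam c k) (al c k) (delta_of c k)).
Proof. exact: s_op_rep. Qed.

Lemma probe_Bethe (i : Idx) a e k : Bethe (single (probe_level i) (YCst a * probe i e)%Y k).
Proof.
rewrite /single; case: ifP => _; last exact: Bethe_cst.
apply: Bethe_mul; first exact: Bethe_cst.
case: i => [[? m]|] /=; (apply: Bethe_mul; first exact: Bethe_cst).
  exact: Bethe_gen.
exact/Bethe_center/casimir_central.
Qed.

Lemma probe_comm (al : params V lam) (i : Idx) a e c k x : Bethe x ->
  level_act al c k x *m level_act al c k (single (probe_level i) (YCst a * probe i e)%Y k) =
  level_act al c k (single (probe_level i) (YCst a * probe i e)%Y k) *m level_act al c k x.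
Proof.
move=> bx; rewrite /single; case: ifP => _; last by rewrite /level_act /= mulmx1 mul1mx.
have rep := s_rep al c k.
have scal b y : level_act al c k (YCst b * y)%Y = b *: level_act al c k y.
  by rewrite /level_act /= mul_scalar_mx.
rewrite scal -scalemxAl -scalemxAr; congr (_ *: _).
case: i => [[k0 m]|]; rewrite /probe scal -scalemxAl -scalemxAr; congr (_ *: _).
  exact: (Bethe_comm_odd rep).
exact: (esym (Yact_central rep x (@casimir_central R))).
Qed.

Lemma pure_act_scale (al : params V lam) k a y :
  pure_act al (single k (YCst a * y)%Y) = a *: pure_act al (single k y).
Proof.
rewrite (pure_act_single al k y) (pure_act_single al k (YCst a * y)%Y) -direct_sumZ.
congr direct_sum; apply/functional_extensionality_dep => c; rewrite -at_factorZ; congr at_factor.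
by rewrite /level_act /= mul_scalar_mx.
Qed.

(** For each e the combination of the probes with weights g lies in the image of the Bethe algebras
    and commutes with all of it, although it is assembled from matrices polynomial in e. *)
Lemma family_poly (g : Idx -> K) : exists X : 'M[{poly K}]_#|{: sum_basis V lam}|,
  [/\ map_mx (horner_eval 0) X = diag_mx (\row_p \sum_i g i * total_lead i (enum_val p)),
      forall e, e != 0 -> Bethe_tensor (alpha_line e^-1) (map_mx (horner_eval e) X) &
      forall e, e != 0 -> forall Y, Bethe_tensor (alpha_line e^-1) Y ->
        Y *m map_mx (horner_eval e) X = map_mx (horner_eval e) X *m Y].
Proof.
pose N i := projT1 (cid (total_poly i)).
have NP i : (forall e, e != 0 -> pure_act (alpha_line e^-1) (single (probe_level i) (probe i e)) =
     map_mx (horner_eval e) (N i)) /\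
  map_mx (horner_eval 0) (N i) = diag_mx (\row_p total_lead i (enum_val p)).
  exact: projT2 (cid (total_poly i)).
pose X := \sum_i (g i)%:P *: N i.
have XE e : map_mx (horner_eval e) X = \sum_i g i *: map_mx (horner_eval e) (N i).
  rewrite /X raddf_sum; apply: eq_bigr => i _ /=; rewrite map_mxZ; congr (_ *: _).
  exact: hornerC.
have Xp e : e != 0 -> map_mx (horner_eval e) X =
    \sum_i pure_act (alpha_line e^-1) (single (probe_level i) (YCst (g i) * probe i e)%Y).
  by move=> e0; rewrite XE; apply: eq_bigr => i _; rewrite pure_act_scale (NP i).1.
exists X; split.
- rewrite XE; apply/matrixP => p q; rewrite summxE !mxE.
  rewrite -sumrMnl; apply: eq_bigr => i _.
  by rewrite mxE (NP i).2 !mxE mulrnAr.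
- move=> e e0; exists #|{: Idx}|, (fun j : 'I_#|{: Idx}| => single (probe_level (enum_val j))
    (YCst (g (enum_val j)) * probe (enum_val j) e)%Y); split.
    by move=> j k; exact: probe_Bethe.
  rewrite Xp // (reindex (@enum_val _ predT)) //.
  by apply: onW_bij; exact: enum_val_bij.
- move=> e e0 Y [L [b [bB ->]]]; rewrite Xp // mulmx_suml mulmx_sumr.
  apply: eq_bigr => l _; rewrite [LHS]mulmx_sumr [RHS]mulmx_suml; apply: eq_bigr => i _.
  by apply: pure_act_comm => c k; exact: probe_comm.
Qed.

Lemma slope_neq0 (c : C) (k : 'I_n) (j : 'I_k) : slope c j != 0.
Proof. by rewrite /slope pnatr_eq0. Qed.

Lemma slope_add_neq0 (c : C) (k : 'I_n) (i j : 'I_k) : slope c i + slope c j != 0.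
Proof. by rewrite /slope -natrD pnatr_eq0. Qed.

Lemma slope_inj (c : C) (k : 'I_n) : injective (@slope c k).
Proof. by move=> i j /eqP; rewrite /slope eqr_nat eqSS eqn_add2l => /eqP/val_inj. Qed.

(** For n = 1 the last level has no factors, hence no slopes that could distinguish chains; but then
    the chain consists of lam alone. *)
Lemma chain_rank1 (c c' : C) : n = 1%N -> c = c'.
Proof.
move=> n1; have single_chain (a : C) : val a = [:: lam].
  have := valP a; rewrite /chains in_fset_set ?inE; last exact: finite_is_chain.
  move=> [sa la _]; move: (val a) sa la => l; rewrite n1 /level /=.
  by case: l => [|x []] //= _ ->.
by apply/val_inj; rewrite !single_chain.
Qed.
End Family.

(** * The limiting eigenvalues separate the basis vectors *)

Section Separation.
Context (R : realType) (n : nat) (hn : (0 < n)%N) (V : o_module R n) (lam : seq R).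
Local Notation K := (Cx R).
Local Notation C := (chains V lam).

Definition Phi_of (c : C) (k : 'I_n) (f : level_basis c k) : {poly K} :=
  Phi_at (alpha_start c (k := k)) (slope c (k := k)) (delta_of c k) f.

Lemma Phi_of_sep (c : C) (k : 'I_n) (f f' : level_basis c k) :
  (forall r, odd r -> (Phi_of f)`_r = (Phi_of f')`_r) -> f = f'.
Proof.
move=> h; apply/ffunP => j.
apply: (@gl2d_inj K _ (alpha_start c j)).
apply: (@Phi1_sep K _ (slope c (k := k)) (delta_of c k) (enum 'I_k)
  (fun j => gl2d (alpha_start c j) true (f j)) (fun j => gl2d (alpha_start c j) false (f j))
  (fun j => gl2d (alpha_start c j) true (f' j)) (fun j => gl2d (alpha_start c j) false (f' j))).
- exact: enum_uniq.
- by move=> i _; exact: slope_neq0.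
- by move=> i i' _ _; exact: slope_add_neq0.
- by move=> i i' _ _; exact: slope_inj.
- by move=> i _; exact: gl2d_sum.
- exact: h.
- by rewrite mem_enum.
Qed.

(** Vectors in different chains are separated by the central element. In one chain, equality of all
    probes would give equality of all odd coefficients on each level, hence of the vectors: M bounds
    the sizes of the polynomials, so no nonzero odd coefficient is left untested. *)
Lemma total_lead_sep : exists M, forall x y : sum_basis V lam, x != y ->
  exists i : option ('I_n * 'I_M), total_lead hn i x != total_lead hn i y.
Proof.
pose sz (x : sum_basis V lam) := (\max_(k < n) size (Phi_of (tagged x k)))%N.
exists (\max_x sz x)%N => x y; have szP (z : sum_basis V lam) k : (size (Phi_of (tagged z k)) <= \max_x sz x)%N.
  apply: leq_trans (leq_bigmax z); exact: (leq_bigmax k).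
case: x y => [c f] [c' f'] xy.
have [cc|cc] := eqVneq c c'; last first.
  exists None; apply/eqP => e; case/eqP: cc; move: e; rewrite /total_lead /lead !Phi0_coef2.
  have [n1|n1] := eqVneq n 1%N; first by move=> _; exact: chain_rank1.
  have l0 : (0 < last_level hn)%N by rewrite /=; lia.
  move/(sum_sqr_separates l0) => e; apply/enum_rank_inj/val_inj; exact: e.
subst c'; apply: contrapT => noi.
case/eqP: xy; congr (existT _ c _); apply/ffunP => k; apply: Phi_of_sep => r ro.
have rE : r = (r./2).*2.+1 by rewrite -[LHS]odd_double_half ro.
have [rM|Mr] := ltnP r./2 (\max_x sz x)%N.
  have [//|ne] := eqVneq (Phi_of (f k))`_r (Phi_of (f' k))`_r.
  case: noi; exists (Some (k, Ordinal rM)).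
  by rewrite /total_lead /= -rE.
have hr : (\max_x sz x <= r)%N.
  by apply: leq_trans Mr _; rewrite {2}rE -addnn; lia.
by rewrite !nth_default // (leq_trans _ hr) //;
  [exact: (szP (existT _ c f') k)|exact: (szP (existT _ c f) k)].
Qed.
End Separation.

Lemma continuous_affine_path (R : realType) (a w : Cx R) (b : Cx R) :
  continuous (fun t : R => a + (w * t%:C) * b : Cx R).
Proof.
move=> t; apply: cvgD; first exact: cvg_cst.
apply: cvgM; last exact: cvg_cst.
apply: cvgM; first exact: cvg_cst.
apply/cvgrPdist_lt => e e0.
have eE : e = (complex.Re (e : R[i]))%:C by apply/esym/RRe_real/gtr0_real.
have e0' : 0 < complex.Re (e : R[i]) by rewrite -ltcR -eE.
near=> s.
have : `|t - s| < complex.Re (e : R[i]).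
  near: s; apply/nbhs_ballP; exists (complex.Re (e : R[i])) => //= s.
rewrite -ltcR -eE; apply: le_lt_trans.
rewrite -rmorphB /= [X in X <= _]normc_def /= expr0n addr0 sqrtr_sqr.
exact: lexx.
Unshelve. all: by end_near.
Qed.

Theorem theorem2 (R : realType) (n : nat) (hn : (0 < n)%N)
    (V : o_module R n) (lam : seq R) (hV : irrep_of_weight V lam) :
  exists alpha : R -> params V lam,
    [/\ (forall c k j,
           {within `[0, +oo[, continuous (fun t => alpha t c k j)}),
        (forall c k j, alpha 0 c k j = (alpha_occ (val c) k.+1 j.+1)%:C),
        (forall t, 0 < t -> simple_spectrum (Bethe_tensor (alpha t))) &
        (exists v : R -> sum_basis V lam -> vec R (sum_basis V lam),
           (forall t, 0 < t -> eigenlines (Bethe_tensor (alpha t)) (v t)) /\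
           (forall b, proj_cvg (v^~ b) (basis_vec R b)))].
Proof.
have [M sep] := total_lead_sep hn V lam.
have [g g_inj] := generic_weights sep.
have [X [X0 XA XC]] := family_poly hn V lam g.
have d_inj : injective ((\row_p \sum_i g i * total_lead hn i (enum_val p)
    : 'rV[Cx R]_#|{: sum_basis V lam}|) 0).
  by move=> p q; rewrite !mxE => /g_inj /enum_val_inj.
have [w [simple [v [vE vcvg]]]] :=
  @spectral_path R _ (fun z => Bethe_tensor (alpha_line z)) X _ X0 d_inj XA XC.
exists (fun t => alpha_line (w * t%:C)); split.
- move=> c k j; apply: continuous_subspaceT; exact: continuous_affine_path.
- move=> c k j; rewrite /alpha_line (_ : 0%:C = 0) // mulr0 mul0r addr0.
  by [].
- exact: simple.
- by exists v.
Qed.
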